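(* Let $r\ge 1$ and $\lambda\vdash r$. Let $\{C_Q : Q\in \mathrm{SYT}(\lambda)\}$ and $\{C'_Q : Q\in\mathrm{SYT}(\lambda)\}$ be the upper and lower canonical bases of the irreducible $K\mathcal{H}_r$-module $M_\lambda$ (see context), and let $S(\lambda)=(S_{Q'Q})_{Q',Q\in\mathrm{SYT}(\lambda)}$ be the transition matrix defined by $C'_Q=\sum_{Q'\in\mathrm{SYT}(\lambda)} S_{Q'Q}\,C_{Q'}$. Then, after multiplying $S(\lambda)$ by a suitable nonzero scalar in $K$ (equivalently, for a suitable choice of the isomorphism identifying the two realizations of $M_\lambda$), every entry of $S(\lambda)$ is invariant under the involution $u\mapsto u^{-1}$ of $K$, every entry lies in $K_0\cap K_\infty$, and $S(\lambda)$ evaluated at $u=0$ and evaluated at $u=\infty$ is the identity matrix.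
   Context: Let $\mathbf{A}=\mathbb{Z}[u,u^{-1}]$, $K=\mathbb{Q}(u)$, with the ring involution $\overline{\cdot}$ determined by $\overline{u}=u^{-1}$. Let $K_0$ (resp. $K_\infty$) be the subring of $K$ of rational functions with no pole at $u=0$ (resp. $u=\infty$). Put $[k]=(u^k-u^{-k})/(u-u^{-1})$. Let $S=\{s_1,\dots,s_{r-1}\}$ be the adjacent transpositions of $\mathfrak{S}_r$, $\ell$ the length function, $\le$ Bruhat order, and $R(w)=\{s\in S: ws<w\}$. The Hecke algebra $\mathcal{H}_r$ is the $\mathbf{A}$-algebra with basis $\{T_w\}_{w\in\mathfrak{S}_r}$ and relations $T_vT_w=T_{vw}$ if $\ell(vw)=\ell(v)+\ell(w)$, $(T_s-u)(T_s+u^{-1})=0$ for $s\in S$. Its bar involution is the additive map extending $\overline{\cdot}$ on $\mathbf{A}$ with $\overline{T_w}=T_{w^{-1}}^{-1}$ (a ring automorphism). $C_w$ (resp. $C'_w$) is the unique bar-invariant element congruent to $T_w$ modulo $u\,\mathbb{Z}[u]\{T_x\}$ (resp. modulo $u^{-1}\mathbb{Z}[u^{-1}]\{T_x\}$). Write $C'_w=\sum_x P'_{x,w}T_x$ and let $\mu(x,w)$ be the coefficient of $u^{-1}$ in $P'_{x,w}$ if $x\le w$, in $P'_{w,x}$ if $w\le x$, and $0$ otherwise. For $w\in\mathfrak{S}_r$, $P(w),Q(w)$ are the RSK insertion and recording tableaux of the word $w(1)\cdots w(r)$; $Q^T$ denotes the transpose of a tableau. Note $C_s=T_s-u$, $C'_s=T_s+u^{-1}$.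 Upper canonical basis of $M_\lambda$: $M_\lambda$ is the $K\mathcal{H}_r$-module with basis $\{C_Q\}_{Q\in\mathrm{SYT}(\lambda)}$ and right action $C_QC_s=-[2]C_Q$ if $s\in R(C_Q)$, and $C_QC_s=\sum_{Q': s\in R(C_{Q'})}\mu(Q',Q)C_{Q'}$ otherwise, where $R(C_Q)=\{s_i: i+1 \text{ lies strictly south of } i \text{ in } Q\}$ and $\mu(Q',Q)=\mu(w',w)$ for any $w',w$ with $P(w')=P(w)$, $Q(w')=Q'$, $Q(w)=Q$ (this is the right cellular subquotient of $\mathcal{H}_r$ spanned by $\{C_w:P(w)=P\}$ for any fixed $P$ of shape $\lambda$; the $M_\lambda$, $\lambda\vdash r$, are the irreducible $K\mathcal{H}_r$-modules). Lower canonical basis: the module with basis $\{C'_Q\}_{Q\in\mathrm{SYT}(\lambda)}$ and action $C'_QC'_s=[2]C'_Q$ if $s\in R(C'_Q)=\{s_i: i+1\text{ lies strictly east of } i \text{ in } Q\}$, and $C'_QC'_s=\sum_{Q': s\in R(C'_{Q'})}\mu(Q',Q)C'_{Q'}$ otherwise, where here $\mu(Q',Q)=\mu(w',w)$ for any $w',w$ with $P(w')^T=P(w)^T$, $Q(w')^T=Q'$, $Q(w)^T=Q$, is isomorphic to $M_\lambda$; via such an isomorphism (unique up to a nonzero scalar) $\{C'_Q\}$ is regarded as a second basis of $M_\lambda$. A matrix is ''the identity at $u=0$'' (resp. $u=\infty$) if its entries lie in $K_0$ (resp. $K_\infty$) and its evaluation there is the identity matrix. *)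

(* Defs.v *)
From HB Require Import structures.
From mathcomp Require Import all_boot all_order all_fingroup all_algebra.
From Stdlib Require Import ClassicalEpsilon.
Set Implicit Arguments. Unset Strict Implicit. Unset Printing Implicit Defensive.
Import Order.TTheory GRing.Theory Num.Theory.
Local Open Scope ring_scope.

Notation K := {fraction {poly rat}}.
Definition toK (p : {poly rat}) : K := @FracField.tofrac _ p.
Definition uK : K := toK 'X.

Definition evalQ (p : {poly rat}) (y : K) : K :=
  \sum_(i < size p) toK (p`_i)%:P * y ^+ i.
Definition evalZ (p : {poly int}) (y : K) : K :=
  \sum_(i < size p) (p`_i)%:~R * y ^+ i.

(* epsilon-based "the": well defined whenever the described object exists
   and is unique *)
Definition the {T : Type} (t0 : T) (P : T -> Prop) : T := epsilon (inhabits t0) P.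

Definition barK (x : K) : K :=
  the 0 (fun y => exists p q : {poly rat}, q != 0 /\ x = toK p / toK q /\
                     y = evalQ p uK^-1 / evalQ q uK^-1).

Definition evalK0 (x : K) (v : rat) : Prop :=
  exists p q : {poly rat}, q.[0] != 0 /\ x = toK p / toK q /\ v = p.[0] / q.[0].

Definition evalKinf (x : K) (v : rat) : Prop :=
  exists p q : {poly rat}, q != 0 /\ (size p <= size q)%N /\ x = toK p / toK q /\
    v = p`_(size q).-1 / lead_coef q.

Definition two : K := uK + uK^-1.

Definition in_uinvZuinv (y : K) : Prop :=
  exists p : {poly int}, p`_0 = 0 /\ y = evalZ p uK^-1.

Definition coef_uinv (y : K) : int :=
  the 0 (fun c => exists (p : {poly int}) (m : nat),
                    y = evalZ p uK / uK ^+ m.+1 /\ c = p`_m).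

Section Sym.
Variable r : nat.
Definition perm_r := {perm 'I_r}.

(* mathematical composition (v w)(i) = v (w i) ; MathComp's  w * v  *)
Definition pmul (v w : perm_r) : perm_r := (w * v)%g.

Definition simple_refl : {set perm_r} :=
  [set s | [exists i : 'I_r, exists j : 'I_r,
             (val j == (val i).+1) && (s == tperm i j)]].

Fixpoint prods (n : nat) : {set perm_r} :=
  match n with
  | 0 => [set 1%g]
  | n.+1 => [set pmul x s | x in prods n, s in simple_refl]
  end.

(* Coxeter length: least n such that w is a product of n simple
   reflections (the bound r^2 exceeds the maximal length r(r-1)/2) *)
Definition len (w : perm_r) : nat :=
  find (fun n => w \in prods n) (iota 0 (r ^ 2).+1).

Definition refls : {set perm_r} :=
  [set pmul (pmul g s) g^-1%g | g in [set: perm_r], s in simple_refl].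

Definition bruhat_step (x y : perm_r) : bool :=
  [exists t in refls, (y == pmul x t) && (len x < len y)%N].
Definition bruhat_le (x w : perm_r) : bool := connect bruhat_step x w.

Definition hecke := {ffun perm_r -> K}.
Definition Tb (w : perm_r) : hecke := [ffun x => (x == w)%:R].
Definition hscale (c : K) (h : hecke) : hecke := [ffun x => c * h x].
Definition hadd (h1 h2 : hecke) : hecke := [ffun x => h1 x + h2 x].
Definition hsum (F : perm_r -> hecke) : hecke :=
  [ffun x => \sum_(w : perm_r) F w x].

(* T_w T_s  (from T_vT_w = T_vw if lengths add, T_s^2 = (u-u^-1)T_s + 1) *)
Definition TwTs (w s : perm_r) : hecke :=
  if (len w < len (pmul w s))%N then Tb (pmul w s)
  else hadd (hscale (uK - uK^-1) (Tb w)) (Tb (pmul w s)).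

Definition mulTs (h : hecke) (s : perm_r) : hecke :=
  hsum (fun w => hscale (h w) (TwTs w s)).

(* right multiplication by T_w = T_{ws} T_s for a right descent s *)
Fixpoint mulTw (n : nat) (h : hecke) (w : perm_r) : hecke :=
  match n with
  | 0 => h
  | n.+1 =>
    match [pick s in simple_refl | (len (pmul w s) < len w)%N] with
    | Some s => mulTs (mulTw n h (pmul w s)) s
    | None => h
    end
  end.

Definition hmul (h1 h2 : hecke) : hecke :=
  hsum (fun w => hscale (h2 w) (mulTw (r ^ 2) h1 w)).

Definition barT (w : perm_r) : hecke :=
  the (Tb 1%g) (fun h => hmul h (Tb w^-1%g) = Tb 1%g /\ hmul (Tb w^-1%g) h = Tb 1%g).

Definition hbar (h : hecke) : hecke :=
  hsum (fun w => hscale (barK (h w)) (barT w)).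

Definition KLlow (w : perm_r) : hecke :=
  the (Tb w) (fun h => hbar h = h /\
                       forall x, in_uinvZuinv (h x - (x == w)%:R)).

Definition Pp (x w : perm_r) : K := KLlow w x.

Definition mu (x w : perm_r) : int :=
  if bruhat_le x w then coef_uinv (Pp x w)
  else if bruhat_le w x then coef_uinv (Pp w x) else 0.

(* RSK (row insertion, English convention), 0-based entries            *)
Fixpoint bumprow (row : seq nat) (x : nat) : seq nat * option nat :=
  match row with
  | [::] => ([:: x], None)
  | y :: row' => if (x < y)%N then (x :: row', Some y)
                 else let (r', b) := bumprow row' x in (y :: r', b)
  end.

Fixpoint tinsert (t : seq (seq nat)) (x : nat) : seq (seq nat) * nat :=
  match t with
  | [::] => ([:: [:: x]], 0%N)
  | row :: t' =>
    let (row', b) := bumprow row x in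
    match b with
    | None => (row' :: t', 0%N)
    | Some y => let (t'', i) := tinsert t' y in (row' :: t'', i.+1)
    end
  end.

Definition addbox (Q : seq (seq nat)) (i k : nat) : seq (seq nat) :=
  if (i < size Q)%N then set_nth [::] Q i (rcons (nth [::] Q i) k)
  else rcons Q [:: k].

Fixpoint rsk_aux (word : seq nat) (k : nat) (PQ : seq (seq nat) * seq (seq nat))
  : seq (seq nat) * seq (seq nat) :=
  match word with
  | [::] => PQ
  | x :: word' =>
    let (P', i) := tinsert PQ.1 x in
    rsk_aux word' k.+1 (P', addbox PQ.2 i k)
  end.

Definition rsk (w : perm_r) : seq (seq nat) * seq (seq nat) :=
  rsk_aux [seq val (w i) | i <- enum 'I_r] 0 ([::], [::]).
Definition Ptab w := (rsk w).1.
Definition Qtab w := (rsk w).2.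

Definition pos_of (t : seq (seq nat)) (k : nat) : nat * nat :=
  let i := find (fun row => k \in row) t in (i, index k (nth [::] t i)).

Definition is_partition_of (lam : seq nat) : bool :=
  sorted geq lam && all (fun x => 0 < x)%N lam && (sumn lam == r).

(* a tableau with entries 0..r-1 is encoded by the position of each entry *)
Definition tab := {ffun 'I_r -> 'I_r * 'I_r}.
Definition tpos (f : tab) (a : 'I_r) : nat * nat := (val (f a).1, val (f a).2).

Definition is_SYT (lam : seq nat) (f : tab) : bool :=
  [forall a, forall b, (tpos f a == tpos f b) ==> (a == b)] &&
  [forall a, ((tpos f a).2 < nth 0 lam (tpos f a).1)%N] &&
  [forall a, forall b, ((tpos f a).1 == (tpos f b).1) &&
                       ((tpos f a).2 < (tpos f b).2)%N ==> (a < b)%N] &&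
  [forall a, forall b, ((tpos f a).2 == (tpos f b).2) &&
                       ((tpos f a).1 < (tpos f b).1)%N ==> (a < b)%N].

Definition SYT (lam : seq nat) := {f : tab | is_SYT lam f}.

Definition swap (p : nat * nat) : nat * nat := (p.2, p.1).

Definition tab_is (t : seq (seq nat)) (Q : tab) : Prop :=
  forall a : 'I_r, pos_of t a = tpos Q a.
Definition tabT_is (t : seq (seq nat)) (Q : tab) : Prop :=
  forall a : 'I_r, swap (pos_of t a) = tpos Q a.

Variable lam : seq nat.

Definition mu_up (Q' Q : SYT lam) : int :=
  the 0 (fun m => exists w' w : perm_r, Ptab w' = Ptab w /\
            tab_is (Qtab w') (val Q') /\ tab_is (Qtab w) (val Q) /\ m = mu w' w).
Definition mu_low (Q' Q : SYT lam) : int :=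
  the 0 (fun m => exists w' w : perm_r, Ptab w' = Ptab w /\
            tabT_is (Qtab w') (val Q') /\ tabT_is (Qtab w) (val Q) /\ m = mu w' w).

(* s_i = (i j), j = i+1, is in R(C_Q) (resp. R(C'_Q)) *)
Definition southR (Q : SYT lam) (i j : 'I_r) : bool :=
  ((tpos (val Q) i).1 < (tpos (val Q) j).1)%N.
Definition eastR (Q : SYT lam) (i j : 'I_r) : bool :=
  ((tpos (val Q) i).2 < (tpos (val Q) j).2)%N.

(* matrix of the right action of C_{s_i} on the basis C_Q:
   C_Q C_s = sum_Q' Aup i j Q' Q C_Q' *)
Definition Aup (i j : 'I_r) (Q' Q : SYT lam) : K :=
  if southR Q i j then (Q' == Q)%:R * - two
  else if southR Q' i j then (mu_up Q' Q)%:~R else 0.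

(* matrix of the right action of C'_{s_i} on the basis C'_Q *)
Definition Blow (i j : 'I_r) (Q' Q : SYT lam) : K :=
  if eastR Q i j then (Q' == Q)%:R * two
  else if eastR Q' i j then (mu_low Q' Q)%:~R else 0.

(* S is the transition matrix C'_Q = sum_Q' S Q' Q C_Q' of a
   K H_r-module isomorphism between the two realizations of M_lambda.
   On M_lambda (C-basis) C'_s = C_s + [2] acts by Aup + [2] I. *)
Definition transition_iso (S : SYT lam -> SYT lam -> K) : Prop :=
  (forall i j : 'I_r, val j = (val i).+1 -> forall Q' Q : SYT lam,
     \sum_(Q'' : SYT lam) S Q' Q'' * Blow i j Q'' Q =
     \sum_(Q'' : SYT lam) (Aup i j Q' Q'' + (Q' == Q'')%:R * two) * S Q'' Q) /\
  (exists T : SYT lam -> SYT lam -> K, forall Q' Q : SYT lam,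
     \sum_(Q'' : SYT lam) S Q' Q'' * T Q'' Q = (Q' == Q)%:R /\
     \sum_(Q'' : SYT lam) T Q' Q'' * S Q'' Q = (Q' == Q)%:R).

Definition good_matrix (S : SYT lam -> SYT lam -> K) : Prop :=
  forall Q' Q : SYT lam,
    barK (S Q' Q) = S Q' Q /\
    evalK0 (S Q' Q) (Q' == Q)%:R /\ evalKinf (S Q' Q) (Q' == Q)%:R.

End Sym.

(* Main.v *)
(* For a fixed insertion tableau P let w_Q be the permutation with tableaux (P, Q). The duality
   mu(w0 y, w0 w) = mu(w, y) shows that the matrix B_s of C'_s on the lower basis and the matrix of
   C'_s = C_s + [2] on the upper basis are transposes of each other, both read off the right cell
   {w0 w_Q}. So S is an intertwiner iff S B_s = (B_s)^T S for every s.

   A nonzero solution exists: multiplication by C'_s is self-adjoint for the bilinear form making the T_w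
   orthonormal, so the Gram matrix of the C'_w of the cell, made orthogonal to the lower cells, is one.
   This form is anisotropic because zero is not a sum of nonzero squares in Q(u).

   Scale a solution S to be polynomial in u and nonzero at u = 0. The equations at orders 0 and 1 say that
   S(0) only relates elements with the same descents and commutes with the Knuth star operations. An
   element is determined by P and by its generalized tau-invariant, so S(0) is diagonal, and it is scalar
   because the cell is connected under star operations. Hence a solution with one zero diagonal entry
   vanishes, solutions are unique up to a scalar, the one with some diagonal entry equal to 1 is
   bar-invariant, and its value at infinity follows from its value at 0. *)
Require Import Defs.
From HB Require Import structures.
From mathcomp Require Import all_boot all_order all_fingroup all_algebra.
From mathcomp Require Import zify ring.
From Stdlib Require Import ClassicalEpsilon.
Set Implicit Arguments. Unset Strict Implicit. Unset Printing Implicit Defensive.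
Import Order.TTheory GRing.Theory Num.Theory.
Local Open Scope ring_scope.

(** * The field of rational functions and its involution *)

Section Field.
Local Notation v := (uK^-1).

(** The main obstacle is that [mu_up] and [mu_low] choose among all pairs with a common insertion
    tableau, so [mu] must first be shown to depend on recording tableaux alone. Left star operations
    give this: they change [P], keep [Q], and preserve the structure constants of right
    multiplication, since left and right multiplications commute. By [Q(w) = P(w^-1)], left stars
    are Knuth moves on inverse words. The cell [w0 w_Q] fits the lower basis because [Q(w0 w)] is
    the transpose of [Q(w)].

    The theorem on tau-invariants serves twice: it identifies the right cells with the fibres of
    [P], and it makes [S(0)] diagonal. It rests on counting: a cut of a word into increasing runs
    bounds the number of cells in the first columns, and row reading words attain the bound.

    As [u [2] = u^2 + 1], an entry [N] whose indices are separated by a descent satisfies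
    [(u^2 + 1) N = u R], where [R] sums [mu] times other entries. Order 0 kills [N(0)]; order 1
    gives the next coefficient of [N] from [S(0)]. Between star domains [mu] is the Kronecker delta
    of the star operation, and computing one order-1 coefficient from both sides gives the
    compatibility with stars. *)

Lemma theP (T : Type) (t0 : T) (P : T -> Prop) : (exists x, P x) -> P (the t0 P).
Proof. exact: epsilon_spec. Qed.

Lemma the_eq (T : Type) (t0 x : T) (P : T -> Prop) :
  P x -> (forall y, P y -> y = x) -> the t0 P = x.
Proof. by move=> Px uniqP; apply: uniqP; apply: theP; exists x. Qed.

HB.instance Definition _ := GRing.RMorphism.copy toK (@FracField.tofrac {poly rat}).

Lemma toKM : {morph toK : p q / p * q}. Proof. exact: rmorphM. Qed.
Lemma toKX n : {morph toK : p / p ^+ n}. Proof. exact: rmorphXn. Qed.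
Lemma uK_X : uK = toK 'X. Proof. by []. Qed.

Lemma toK_inj : injective toK.
Proof. by move=> p q /eqP; rewrite tofrac_eq => /eqP. Qed.

Lemma toK_eq0 p : (toK p == 0) = (p == 0).
Proof. exact: tofrac_eq0. Qed.

Lemma K_frac (x : K) : exists p q : {poly rat}, q != 0 /\ x = toK p / toK q.
Proof.
elim/quotW: x => -[[p q] /= q0]; exists p, q; split => //.
apply: (canRL (mulfK _)); first by rewrite toK_eq0.
rewrite /toK /FracField.tofrac; unlock.
rewrite !piE /=; apply/eqmodP => /=.
by rewrite FracField.equivfE /FracField.mulf /= !numden_Ratio ?mulf_neq0 ?oner_eq0 // !mulr1 mulrC.
Qed.

#[global] Opaque toK uK.

Definition constK : rat -> K := toK \o polyC.
HB.instance Definition _ := GRing.RMorphism.on constK.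

Lemma coef_constK p i : (map_poly constK p)`_i = toK (p`_i)%:P.
Proof. exact: coef_map. Qed.

Definition subst_uinv (p : {poly rat}) : K := (map_poly constK p).[v].

Lemma evalQE p (y : K) : evalQ p y = (map_poly constK p).[y].
Proof.
rewrite horner_coef size_map_poly; apply: eq_bigr => i _.
by rewrite coef_constK.
Qed.
Lemma uK_neq0 : uK != 0.
Proof. by rewrite toK_eq0 polyX_eq0. Qed.
#[local] Hint Resolve uK_neq0 : core.

Lemma uK_expB n i : (i <= n)%N -> uK ^+ n * v ^+ i = uK ^+ (n - i).
Proof.
move=> le_in; rewrite exprVn; apply: (canLR (mulfK _)); first by rewrite expf_neq0.
by rewrite -exprD subnK.
Qed.

Lemma toK_horner p : toK p = (map_poly constK p).[uK].
Proof.
rewrite horner_coef size_map_poly -{1}[p]coefK poly_def rmorph_sum.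
apply: eq_bigr => i _ /=.
by rewrite -mul_polyC toKM toKX -uK_X coef_constK.
Qed.

(** When [p] has degree at most [n] this is [u^n p(u^-1)]. It turns identities in [u^-1] into
    identities between polynomials in [u], where [toK_inj] applies. *)
Definition rev_poly (R : nzRingType) n (p : {poly R}) : {poly R} :=
  \poly_(i < n.+1) p`_(n - i)%N.

Lemma toK_rev n (p : {poly rat}) : (size p <= n.+1)%N -> toK (rev_poly n p) = uK ^+ n * subst_uinv p.
Proof.
move=> sp; rewrite /subst_uinv (@horner_coef_wide _ n.+1) ?size_map_poly //.
rewrite /rev_poly poly_def rmorph_sum mulr_sumr (reindex_inj rev_ord_inj) /=.
apply: eq_bigr => i _.
rewrite -mul_polyC toKM toKX -uK_X coef_constK subSS subKn ?(ltnSE (ltn_ord i)) //.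
rewrite mulrCA; congr (_ * _).
by rewrite uK_expB // (ltnSE (ltn_ord i)).
Qed.

Lemma subst_uinvD : {morph subst_uinv : p q / p + q}.
Proof. by move=> p q; rewrite /subst_uinv rmorphD hornerD. Qed.
Lemma subst_uinvM : {morph subst_uinv : p q / p * q}.
Proof. by move=> p q; rewrite /subst_uinv rmorphM hornerM. Qed.
Lemma subst_uinv0 : subst_uinv 0 = 0.
Proof. by rewrite /subst_uinv rmorph0 horner0. Qed.
Lemma subst_uinv1 : subst_uinv 1 = 1.
Proof. by rewrite /subst_uinv rmorph1 hornerC. Qed.

Lemma subst_uinv_eq0 p : (subst_uinv p == 0) = (p == 0).
Proof.
apply/eqP/eqP => [p0|->]; last by rewrite subst_uinv0.
have /eqP : toK (rev_poly (size p) p) == 0 by rewrite toK_rev ?p0 ?mulr0.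
move/eqP; rewrite toK_eq0 => /eqP /polyP rp0; apply/polyP => i.
rewrite coef0; case: (ltnP i (size p)) => [ip|]; last by move/leq_sizeP; apply.
have := rp0 (size p - i)%N.
by rewrite coef_poly coef0 ltnS leq_subr subKn // ltnW.
Qed.

Lemma barK_frac p q : q != 0 -> barK (toK p / toK q) = subst_uinv p / subst_uinv q.
Proof.
move=> q0; apply: the_eq; first by exists p, q; rewrite !evalQE.
move=> _ [p' [q' [q'0 [eqpq ->]]]]; rewrite !evalQE -!/(subst_uinv _).
apply/eqP; rewrite eqr_div ?subst_uinv_eq0 // -!subst_uinvM; apply/eqP; congr subst_uinv.
move/eqP: eqpq; rewrite eqr_div ?toK_eq0 // -!rmorphM => /eqP /toK_inj ->.
by [].
Qed.

Lemma barK_is_zmod_morphism : zmod_morphism barK.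
Proof.
suff barD x y : barK (x + y) = barK x + barK y.
  move=> x y; apply: (canRL (addrK _)); rewrite -barD subrK //.
have [p [q [q0 ->]]] := K_frac x; have [p' [q' [q'0 ->]]] := K_frac y.
rewrite addf_div ?toK_eq0 // -!rmorphM -rmorphD !barK_frac ?mulf_neq0 //.
by rewrite subst_uinvD !subst_uinvM addf_div ?subst_uinv_eq0.
Qed.

Lemma barK_is_monoid_morphism : monoid_morphism barK.
Proof.
split.
  have := @barK_frac 1 1 (oner_neq0 _).
  by rewrite !rmorph1 subst_uinv1 divr1.
move=> x y.
have [p [q [q0 ->]]] := K_frac x; have [p' [q' [q'0 ->]]] := K_frac y.
rewrite mulf_div -!rmorphM !barK_frac ?mulf_neq0 //.
by rewrite !subst_uinvM mulf_div.
Qed.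

HB.instance Definition _ := GRing.isZmodMorphism.Build K K barK barK_is_zmod_morphism.
HB.instance Definition _ := GRing.isMonoidMorphism.Build K K barK barK_is_monoid_morphism.

Lemma barK_toK p : barK (toK p) = subst_uinv p.
Proof. by have := @barK_frac p 1 (oner_neq0 _); rewrite rmorph1 subst_uinv1 !divr1. Qed.

Lemma barK_u : barK uK = v.
Proof. by rewrite barK_toK /subst_uinv map_polyX hornerX. Qed.

Lemma barK_v : barK v = uK.
Proof. by rewrite fmorphV /= barK_u invrK. Qed.

Lemma barK_two : barK two = two.
Proof. by rewrite /two rmorphD /= barK_u barK_v addrC. Qed.

(** Elements of [Z[u^-1]] are handled as integer polynomials in the variable [u^-1]: coefficient 0
    is what congruence modulo [u^-1 Z[u^-1]] looks at, coefficient 1 is what [mu] reads. *)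
Definition ev (p : {poly int}) : K := (map_poly intr p).[v].

Lemma ev_is_zmod_morphism : zmod_morphism ev.
Proof. by move=> p q; rewrite /ev rmorphB hornerD hornerN. Qed.
Lemma ev_is_monoid_morphism : monoid_morphism ev.
Proof. by split=> [|p q]; rewrite /ev ?rmorph1 ?hornerC // rmorphM hornerM. Qed.
HB.instance Definition _ := GRing.isZmodMorphism.Build {poly int} K ev ev_is_zmod_morphism.
HB.instance Definition _ := GRing.isMonoidMorphism.Build {poly int} K ev ev_is_monoid_morphism.

Lemma evalZE p (y : K) : evalZ p y = (map_poly intr p).[y].
Proof.
rewrite (@horner_coef_wide _ (size p)) ?size_poly //.
by apply: eq_bigr => i _; rewrite coef_map.
Qed.

Lemma evalZ_uK (p : {poly int}) : evalZ p uK = toK (map_poly intr p).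
Proof.
rewrite evalZE toK_horner -map_poly_comp.
congr (_.[_]); apply: eq_map_poly => c /=.
by rewrite rmorph_int.
Qed.

Lemma evX : ev 'X = v.
Proof. by rewrite /ev map_polyX hornerX. Qed.
Lemma evC c : ev c%:P = c%:~R.
Proof. by rewrite /ev map_polyC hornerC. Qed.

Lemma barK_ev p : barK (ev p) = toK (map_poly intr p).
Proof.
rewrite /ev -evalZ_uK evalZE !horner_coef rmorph_sum.
by apply: eq_bigr => i _; rewrite rmorphM rmorphXn /= barK_v coef_map /= rmorph_int.
Qed.

Lemma map_intr_rat_inj : injective (map_poly intr : {poly int} -> {poly rat}).
Proof.
move=> p q /polyP epq; apply/polyP => i; have := epq i.
by rewrite !coef_map /= => /eqP; rewrite eqr_int => /eqP.
Qed.

Lemma ev_inj : injective ev.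
Proof. by move=> p q /(congr1 barK); rewrite !barK_ev => /toK_inj /map_intr_rat_inj. Qed.

Lemma rev_polyK p : ev p * uK ^+ size p = evalZ (rev_poly (size p) p) uK.
Proof.
rewrite evalZE mulrC /ev (@horner_coef_wide _ (size p).+1); last first.
  by rewrite (leq_trans (size_poly _ _)) // leqW.
rewrite (@horner_coef_wide _ (size p).+1 _ uK); last first.
  by rewrite (leq_trans (size_poly _ _)) // size_poly.
rewrite mulr_sumr [RHS](reindex_inj rev_ord_inj) /=; apply: eq_bigr => i _.
rewrite !coef_map /= subSS coef_poly ltnS leq_subr subKn ?(ltnSE (ltn_ord i)) // mulrCA; congr (_ * _).
by rewrite uK_expB // (ltnSE (ltn_ord i)).
Qed.

Lemma coef_uinv_ev p : coef_uinv (ev p) = p`_1.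
Proof.
have [sp|sp] := posnP (size p).
  move/eqP: sp; rewrite size_poly_eq0 => /eqP ->; rewrite rmorph0 coef0; apply: the_eq.
    exists 0, 0%N; rewrite coef0; split => //.
    by rewrite evalZE rmorph0 horner0 mul0r.
  move=> _ [q [m [q0 ->]]]; move/eqP: q0.
  rewrite eq_sym mulf_eq0 invr_eq0 expf_eq0 (negbTE uK_neq0) andbF orbF evalZ_uK toK_eq0.
  by rewrite -(rmorph0 (map_poly intr)) => /eqP /map_intr_rat_inj ->; rewrite coef0.
apply: the_eq.
  (* [u^(size p) * ev p] is the reversed polynomial, in which the coefficient of [u^-1] has index
     [size p - 1]; hence the separate treatment of [p = 0]. *)
  exists (rev_poly (size p) p), (size p).-1; rewrite prednK // -rev_polyK mulfK ?expf_neq0 //.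
  split => //; rewrite coef_poly; case: (size p) sp => // n _ /=.
  by rewrite ltnS leqnSn subSnn.
move=> _ [q [m [eqq ->]]].
have : evalZ (rev_poly (size p) p * 'X^(m.+1)) uK = evalZ (q * 'X^(size p)) uK.
  rewrite !evalZE !rmorphM /= !map_polyXn !hornerM !hornerXn -!evalZE -rev_polyK eqq.
  by rewrite mulrAC divfK ?expf_neq0.
rewrite !evalZ_uK => /toK_inj /map_intr_rat_inj /polyP /(_ (m + size p)%N).
rewrite !coefMXn.
have -> : (m + size p < size p)%N = false by lia.
have -> : (m + size p < m.+1)%N = false by lia.
rewrite addnK coef_poly => <-.
have -> : (m + size p - m.+1)%N = (size p).-1 by lia.
rewrite ltnS leq_pred; congr (_`__); lia.
Qed.

(** [Z[u]] and [Z[u^-1]] meet in the constants. The uniqueness of the canonical basis comes down to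
    this. *)
Lemma bar_ev_eq0 p : barK (ev p) = ev p -> p`_0 = 0 -> p = 0.
Proof.
rewrite barK_ev => eqp p0.
have : evalZ (p * 'X^(size p)) uK = evalZ (rev_poly (size p) p) uK.
  by rewrite -rev_polyK -eqp -evalZ_uK !evalZE rmorphM /= map_polyXn hornerM hornerXn.
rewrite !evalZ_uK => /toK_inj /map_intr_rat_inj /polyP eqc.
apply/polyP => i; rewrite coef0; case: (posnP i) => [->//|i0].
have := eqc (i + size p)%N; rewrite coefMXn ltnNge leq_addl /= addnK => ->.
by rewrite coef_poly ltnS -{2}[size p]add0n leq_add2r leqNgt i0.
Qed.

Lemma in_uinvZuinvE y : in_uinvZuinv y <-> exists p : {poly int}, p`_0 = 0 /\ y = ev p.
Proof. by split=> -[p [p0 ->]]; exists p; rewrite ?evalZE. Qed.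
Lemma common_denom (I : finType) (a : I -> K) :
  exists (d : {poly rat}) (n : I -> {poly rat}), d != 0 /\ forall i, a i = toK (n i) / toK d.
Proof.
have /fin_all_exists [pq apq] : forall i, exists x : {poly rat} * {poly rat},
    x.2 != 0 /\ a i = toK x.1 / toK x.2.
  by move=> i; have [p [q [q0 ->]]] := K_frac (a i); exists (p, q).
exists (\prod_i (pq i).2), (fun i => (pq i).1 * \prod_(j | j != i) (pq j).2); split.
  by apply/prodf_neq0 => i _; case: (apq i).
move=> i; have [q0 ->] := apq i.
have rest0 : \prod_(j | j != i) (pq j).2 != 0 by apply/prodf_neq0 => j _; case: (apq j).
have -> : \prod_j (pq j).2 = (pq i).2 * \prod_(j | j != i) (pq j).2 by rewrite (bigD1 i).
by rewrite !toKM -mulf_div divff ?toK_eq0 // mulr1.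
Qed.

Lemma poly_eq0_nat (p : {poly rat}) : (forall k : nat, p.[k%:R] = 0) -> p = 0.
Proof.
move=> p0; apply: (@roots_geq_poly_eq0 _ _ [seq k%:R | k <- iota 0 (size p)]).
- by apply/allP => _ /mapP[k _ ->]; rewrite rootE p0.
- by rewrite map_inj_uniq ?iota_uniq // => i j /eqP; rewrite eqr_nat => /eqP.
- by rewrite size_map size_iota.
Qed.

(** After clearing denominators, evaluate at every natural number: a vanishing sum of rational
    squares has vanishing terms, and a polynomial vanishing at all naturals is zero. *)
Lemma sum_sqr_eq0 (I : finType) (a : I -> K) :
  \sum_i a i ^+ 2 = 0 -> forall i, a i = 0.
Proof.
have [d [n [d0 an]]] := common_denom a.
under eq_bigr do rewrite an expr_div_n -!rmorphXn /=.
rewrite -mulr_suml -rmorph_sum => /eqP.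
rewrite mulf_eq0 invr_eq0 !toK_eq0 expf_eq0 (negbTE d0) andbF orbF => /eqP n0 i.
rewrite an [n i]poly_eq0_nat ?rmorph0 ?mul0r // => k.
have /eqP : (\sum_i n i ^+ 2).[k%:R] = 0 by rewrite n0 horner0.
rewrite horner_sum; under eq_bigr do rewrite horner_exp.
rewrite psumr_eq0 => [/allP /(_ i)|j _]; last exact: sqr_ge0.
by rewrite mem_index_enum sqrf_eq0 => /(_ isT) /eqP.
Qed.
End Field.

(** * Length and Bruhat order on permutations *)

Section Perm.
Variable r : nat.
Local Notation perm_r := (perm_r r).
Implicit Types w x y : perm_r.

Definition adj (i j : 'I_r) := j == i.+1 :> nat.
Definition desc w (i j : 'I_r) := (w j < w i)%N.

Definition invset (w : perm_r) : {set 'I_r * 'I_r} := [set p : 'I_r * 'I_r | (p.1 < p.2)%N && (w p.2 < w p.1)%N].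
Definition ninv w := #|invset w|.

Lemma pmulE v w i : pmul v w i = v (w i).
Proof. by rewrite permM. Qed.

Lemma pmulsK i j : involutive (fun w => pmul w (tperm i j)).
Proof. by move=> w; rewrite /pmul mulgA tperm2 mul1g. Qed.

Lemma adj_tperm_lt (i j a b : 'I_r) : adj i j -> (a, b) != (i, j) -> (a < b)%N ->
  (tperm i j a < tperm i j b)%N.
Proof.
rewrite /adj xpair_eqE => /eqP ij abij ab.
have ord_neq (x y : 'I_r) : x != y -> nat_of_ord x <> nat_of_ord y by move=> /eqP nxy /val_inj.
case: tpermP => [ai|aj|/eqP /ord_neq ai /eqP /ord_neq aj];
  case: tpermP => [bi|bj|/eqP /ord_neq bi /eqP /ord_neq bj];
  subst; move: abij; rewrite ?eqxx //= => _; lia.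
Qed.

Lemma adj_neq i j : adj i j -> i != j.
Proof. by rewrite /adj -val_eqE /=; lia. Qed.

Lemma ndescE w i j : adj i j -> ~~ desc w i j = (w i < w j)%N.
Proof.
move=> /adj_neq nij; rewrite /desc -leqNgt leq_eqVlt -[(_ == _ :> nat)]/(w i == w j).
by rewrite (inj_eq perm_inj) (negbTE nij).
Qed.

(** Applying [tperm i j] to both positions carries the inversions of [w] onto those of the product
    other than [(i, j)]. *)
Lemma ninv_asc w i j : adj i j -> ~~ desc w i j -> ninv (pmul w (tperm i j)) = (ninv w).+1.
Proof.
move=> ij asc; have neij := adj_neq ij.
have wij : (w i < w j)%N by rewrite -ndescE.
pose f (p : 'I_r * 'I_r) := (tperm i j p.1, tperm i j p.2).
have fK : involutive f by case=> a b; rewrite /f /= !tpermK.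
have mf p : (p \in f @: invset w) = (f p \in invset w).
  by rewrite -{1}[p]fK mem_imset //; exact: inv_inj.
rewrite /ninv; have -> : invset (pmul w (tperm i j)) = (i, j) |: (f @: invset w).
  apply/setP => -[a b]; rewrite in_setU1 mf /f !inE /= !pmulE.
  have [[-> ->]|abij] := altP ((a, b) =P (i, j)).
    by rewrite !tpermL !tpermR wij andbT; move: ij; rewrite /adj; lia.
  rewrite orFb; have [[-> ->]|abij'] := altP ((tperm i j a, tperm i j b) =P (i, j)).
    by rewrite [(w j < w i)%N]ltnNge (ltnW wij) !andbF.
  congr (_ && _); apply/idP/idP => [|ab]; first exact: adj_tperm_lt.
  by have := adj_tperm_lt ij abij' ab; rewrite !tpermK.
rewrite cardsU1 card_imset; last exact: inv_inj.
suff -> : (i, j) \notin f @: invset w by [].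
by rewrite mf /f inE /= tpermL tpermR; move: ij; rewrite /adj; lia.
Qed.

Lemma desc_mul w i j : adj i j -> desc (pmul w (tperm i j)) i j = ~~ desc w i j.
Proof.
by move=> ij; rewrite ndescE // /desc !pmulE tpermL tpermR.
Qed.

Lemma ninv_desc w i j : adj i j -> desc w i j -> ninv w = (ninv (pmul w (tperm i j))).+1.
Proof.
by move=> ij dw; rewrite -(ninv_asc ij) ?pmulsK // desc_mul // dw.
Qed.

Lemma simple_reflP s : reflect (exists i j, adj i j /\ s = tperm i j) (s \in simple_refl r).
Proof.
rewrite inE; apply: (iffP existsP) => [[i /existsP[j /andP[ij /eqP ->]]]|[i [j [ij ->]]]].
  by exists i, j.
by exists i; apply/existsP; exists j; apply/andP; split; [exact: ij|exact: eqxx].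
Qed.

Lemma no_desc1 w : (forall i j, adj i j -> ~~ desc w i j) -> w = 1%g.
Proof.
move=> nd; have mono : forall k (i j : 'I_r), nat_of_ord j = (i + k)%N -> (w i <= w j)%N.
  elim=> [|k IH] i j eij; first by rewrite addn0 in eij; rewrite (val_inj eij).
  have kr : (i + k < r)%N by have := ltn_ord j; rewrite eij; lia.
  rewrite (leq_trans (IH i (Ordinal kr) _)) // leqNgt nd // /adj eij /=; lia.
have smono (i j : 'I_r) : (i < j)%N -> (w i < w j)%N.
  move=> ij; rewrite ltn_neqAle (mono (j - i)%N) ?subnKC ?andbT //; last exact: ltnW.
  by rewrite (inj_eq val_inj) (inj_eq perm_inj) -val_eqE neq_ltn ij.
have ge : forall k (i : 'I_r), nat_of_ord i = k -> (i <= w i)%N.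
  elim=> [|k IH] i ik; first by rewrite ik.
  have kr : (k < r)%N by have := ltn_ord i; rewrite ik; lia.
  have := IH (Ordinal kr) erefl; have := smono (Ordinal kr) i; rewrite /= ik; lia.
have le : forall k (i : 'I_r), (i + k)%N = r.-1 -> (w i <= i)%N.
  elim=> [|k IH] i ik; first by have := ltn_ord (w i); have := ltn_ord i; lia.
  have kr : (i.+1 < r)%N by have := ltn_ord i; lia.
  have := IH (Ordinal kr); have := smono i (Ordinal kr); rewrite /=; lia.
apply/permP => i; rewrite perm1; apply/val_inj/anti_leq.
by rewrite (ge i) // (le (r.-1 - i)%N) // subnKC //; have := ltn_ord i; lia.
Qed.

Lemma ninv1 : ninv 1%g = 0%N.
Proof.
apply/eqP; rewrite cards_eq0; apply/eqP/setP => -[a b]; rewrite !inE /= !perm1; lia.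
Qed.

Lemma desc_ex w : w != 1%g -> exists i j, adj i j /\ desc w i j.
Proof.
move=> w1; have [/existsP[i /existsP[j /andP[ij d]]]|] := boolP [exists i, exists j, adj i j && desc w i j].
  by exists i, j.
rewrite negb_exists => /forallP nd; case/eqP: w1; apply: no_desc1 => i j ij.
by have := nd i; rewrite negb_exists => /forallP /(_ j); rewrite ij.
Qed.

Lemma ninv_prods n w : w \in prods r n -> (ninv w <= n)%N.
Proof.
elim: n w => [|n IH] w /=; first by rewrite inE => /eqP ->; rewrite ninv1.
case/imset2P => x _ xn /simple_reflP[i [j [ij ->]]] ->.
have := IH x xn; have [d|a] := boolP (desc x i j).
  by have := ninv_desc ij d; lia.
by have := ninv_asc ij a; lia.
Qed.

Lemma prods_ninv w : w \in prods r (ninv w).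
Proof.
move: {2}(ninv w) (erefl (ninv w)) => n; elim: n w => [|n IH] w en.
  rewrite en inE; apply/eqP; apply: no_desc1 => i j ij; apply/negP => d.
  by have := ninv_desc ij d; rewrite en.
have [w1|/desc_ex [i [j [ij d]]]] := eqVneq w 1%g; first by move: en; rewrite w1 ninv1.
have e := ninv_desc ij d; rewrite e /=; apply/imset2P.
exists (pmul w (tperm i j)) (tperm i j); last by rewrite pmulsK.
  by apply: IH; rewrite e in en; case: en.
by apply/simple_reflP; exists i, j.
Qed.

Lemma ninv_bound w : (ninv w <= r ^ 2)%N.
Proof. by rewrite /ninv (leq_trans (max_card _)) // card_prod card_ord expnS expn1. Qed.

Lemma lenE w : len w = ninv w.
Proof.
rewrite /len; set a := fun n => _; have nb := ninv_bound w.
have hasw : has a (iota 0 (r ^ 2).+1).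
  by apply/hasP; exists (ninv w); [rewrite mem_iota /= add0n ltnS | exact: prods_ninv].
apply/eqP; rewrite eqn_leq; apply/andP; split.
  rewrite leqNgt; apply/negP => lt; have := before_find 0%N lt.
  by rewrite nth_iota ?ltnS // add0n /a prods_ninv.
have := nth_find 0%N hasw; rewrite nth_iota; first by rewrite add0n => /ninv_prods.
by move: hasw; rewrite has_find size_iota.
Qed.

Lemma len_asc w i j : adj i j -> ~~ desc w i j -> len (pmul w (tperm i j)) = (len w).+1.
Proof. by rewrite !lenE; apply: ninv_asc. Qed.

Lemma len_desc w i j : adj i j -> desc w i j -> len w = (len (pmul w (tperm i j))).+1.
Proof. by rewrite !lenE; apply: ninv_desc. Qed.

Lemma len_ltE w i j : adj i j -> (len w < len (pmul w (tperm i j)))%N = ~~ desc w i j.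
Proof.
move=> ij; have [d|a] := boolP (desc w i j); first by rewrite (len_desc ij d) ltnNge leqnSn.
by rewrite len_asc // ltnSn.
Qed.

Lemma len_gtE w i j : adj i j -> (len (pmul w (tperm i j)) < len w)%N = desc w i j.
Proof.
move=> ij; have [d|a] := boolP (desc w i j); first by rewrite (len_desc ij d) ltnSn.
by rewrite len_asc // ltnNge leqnSn.
Qed.

Lemma len1 : len (1%g : perm_r) = 0%N.
Proof. by rewrite lenE ninv1. Qed.

Lemma len_bound w : (len w <= r ^ 2)%N.
Proof. by rewrite lenE ninv_bound. Qed.

Lemma perm_ind (P : perm_r -> Prop) : P 1%g ->
  (forall w i j, adj i j -> ~~ desc w i j -> P w -> P (pmul w (tperm i j))) -> forall w, P w.
Proof.
move=> P1 PS w; move: {2}(len w) (erefl (len w)) => n; elim: n w => [|n IH] w en.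
  have [->//|/desc_ex [i [j [ij d]]]] := eqVneq w 1%g.
  by have := len_desc ij d; rewrite en.
have [->//|/desc_ex [i [j [ij d]]]] := eqVneq w 1%g.
rewrite -(pmulsK i j w); apply: PS => //; first by rewrite desc_mul // d.
by apply: IH; have := len_desc ij d; rewrite en => -[].
Qed.

Lemma len_inv w : len w^-1%g = len w.
Proof.
rewrite !lenE /ninv; pose f (p : 'I_r * 'I_r) := (w p.2, w p.1).
have -> : invset w^-1%g = f @: invset w; last first.
  by rewrite card_imset // => -[a b] [c d] [/perm_inj -> /perm_inj ->].
apply/setP => -[a b]; apply/idP/imsetP => [|[[c d]]]; rewrite inE /=.
  move=> /andP[ab iab]; exists (w^-1 b, w^-1 a)%g; last by rewrite /f /= !permKV.
  by rewrite inE /= !permKV ab iab.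
by move=> /andP[cd wcd] [-> ->]; rewrite inE /= !permK cd wcd.
Qed.

(* A conjugation argument: [t_ab = s_c t_ac s_c] with [c = b - 1], by induction on [b - a]. *)
Lemma len_tperm_lt x (a b : 'I_r) : (a < b)%N -> (x a < x b)%N -> (len x < len (pmul x (tperm a b)))%N.
Proof.
move: {2}(b - a)%N (erefl (b - a)%N) => n; elim: n x a b => [|n IH] x a b eab ab xab; first by lia.
have cr : (b.-1 < r)%N by have := ltn_ord b; lia.
pose c := Ordinal cr; have cb : adj c b by rewrite /adj /=; lia.
have [eac|nac] := eqVneq a c.
  by rewrite eac len_ltE // /desc -eac -leqNgt ltnW.
have ac : (a < c)%N by move: nac; rewrite -val_eqE /=; lia.
have nab : a != b by rewrite neq_ltn ab.
have ncb : c != b by rewrite -val_eqE /=; lia.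
pose y := pmul x (tperm c b).
have ya : y a = x a by rewrite pmulE tpermD 1?eq_sym.
have yc : y c = x b by rewrite pmulE tpermL.
have yb : y b = x c by rewrite pmulE tpermR.
have := IH y a c; rewrite ya yc => /(_ _ ac xab).
have -> : (c - a = n)%N by move: eab => /=; lia.
move=> /(_ erefl); set z := pmul y _ => yz.
have za : z a = x b by rewrite pmulE tpermL yc.
have zc : z c = x a by rewrite pmulE tpermR ya.
have zb : z b = x c by rewrite pmulE tpermD ?yb // eq_sym.
have -> : pmul x (tperm a b) = pmul z (tperm c b).
  apply/permP => k; rewrite pmulE [RHS]pmulE.
  case: (tpermP c b k) => [->|->|/eqP kc /eqP kb].
  - by rewrite zb tpermD // eq_sym.
  - by rewrite zc tpermR.
  rewrite pmulE; case: (tpermP a c k) => [->|/eqP|/eqP ka _]; last first.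
  - by rewrite pmulE !tpermD // eq_sym.
  - by rewrite (negbTE kc).
  by rewrite yc tpermL.
have ex : pmul y (tperm c b) = x by rewrite /y pmulsK.
have [dz|az] := boolP (desc z c b).
  have := len_desc cb dz; have [dy|ay] := boolP (desc y c b).
    by have := len_desc cb dy; rewrite ex; lia.
  by move: dz ay; rewrite /desc zb zc yb yc; lia.
have := len_asc cb az; have [dy|ay] := boolP (desc y c b).
  by have := len_desc cb dy; rewrite ex; lia.
by have := len_asc cb ay; rewrite ex; lia.
Qed.

Lemma reflsP t : reflect (exists a b : 'I_r, (a < b)%N /\ t = tperm a b) (t \in refls r).
Proof.
apply: (iffP imset2P) => [[g s _ /simple_reflP[i [j [ij ->]]] ->]|[a [b [ab ->]]]].
  have -> : pmul (pmul g (tperm i j)) g^-1%g = tperm (g i) (g j).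
    by rewrite -tpermJ conjgE.
  have := ltn_neqAle (g i) (g j); rewrite -[(_ == _ :> nat)]/(g i == g j) (inj_eq perm_inj).
  have [gij|gij] := leqP (g i) (g j); last by exists (g j), (g i); rewrite tpermC.
  suff -> : i != j by move=> e; exists (g i), (g j); rewrite e.
  exact: adj_neq.
have cr : (a.+1 < r)%N by have := ltn_ord b; lia.
have nab : a != b by rewrite neq_ltn ab.
exists (tperm (Ordinal cr) b) (tperm a (Ordinal cr)) => //.
  by apply/simple_reflP; exists a, (Ordinal cr); rewrite /adj eqxx.
rewrite /pmul -conjgE tpermJ tpermL tpermD //; first by rewrite -val_eqE /= neq_ltn ltnSn orbT.
by rewrite eq_sym.
Qed.

Lemma bruhat_stepP x y :
  reflect (exists a b : 'I_r, [/\ (a < b)%N, (x a < x b)%N & y = pmul x (tperm a b)]) (bruhat_step x y).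
Proof.
apply: (iffP existsP) => [[t /and3P[/reflsP[a [b [ab ->]]] /eqP -> lt]]|[a [b [ab xab ->]]]].
  exists a, b; split => //; rewrite ltnNge; apply/negP; rewrite leq_eqVlt => /orP[/eqP /val_inj /perm_inj e|ba].
    by rewrite e ltnn in ab.
  have := @len_tperm_lt (pmul x (tperm a b)) a b ab.
  by rewrite !pmulE tpermL tpermR pmulsK => /(_ ba); lia.
exists (tperm a b); rewrite eqxx len_tperm_lt // andbT andbT.
by apply/reflsP; exists a, b.
Qed.

Lemma bruhat_step_mul x y i j : adj i j -> bruhat_step x y ->
  pmul x (tperm i j) = y \/ bruhat_step (pmul x (tperm i j)) (pmul y (tperm i j)).
Proof.
move=> ij /bruhat_stepP[a [b [ab xab ->]]].
have [[-> ->]|abij] := altP ((a, b) =P (i, j)); first by left.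
right; apply/bruhat_stepP; exists (tperm i j a), (tperm i j b); split.
- exact: adj_tperm_lt.
- by rewrite !pmulE !tpermK.
rewrite /pmul !mulgA; congr (_ * _)%g.
by rewrite -tpermJ conjgE tpermV -!mulgA tperm2 mulg1.
Qed.

(** A weak lifting property: multiply a chain from [x] to [w] by [s] step by step. The only step
    that does not survive has the form [x s = y], and there the old chain is joined unchanged. *)
Lemma bruhat_mul x w i j : adj i j -> bruhat_le x w ->
  bruhat_le (pmul x (tperm i j)) w \/ bruhat_le (pmul x (tperm i j)) (pmul w (tperm i j)).
Proof.
move=> ij /connectP[p xp ->]; elim: p x xp => [|y p IH] x /=; first by right; apply: connect0.
case/andP => xy yp; have [->|st] := bruhat_step_mul ij xy.
  by left; apply/connectP; exists p.
by case: (IH _ yp) => ?; [left|right]; apply: connect_trans (connect1 st) _.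
Qed.

End Perm.

(** * The Hecke algebra and the bar involution *)

Section Hecke.
Variable r : nat.
Local Notation perm_r := (perm_r r).
Local Notation hecke := (hecke r).
Implicit Types (w x y : perm_r) (h a b c : hecke) (i j k l : 'I_r).
Local Notation q := (uK - uK^-1).

Lemma hscaleE z h x : hscale z h x = z * h x. Proof. by rewrite ffunE. Qed.

Lemma hsumE (F : perm_r -> hecke) : hsum F = \sum_w F w.
Proof. by apply/ffunP => x; rewrite ffunE sum_ffunE. Qed.

Lemma hscaleDr z : {morph @hscale r z : a b / a + b}.
Proof. by move=> a b; apply/ffunP => x; rewrite !ffunE mulrDr. Qed.
Lemma hscale0r z : hscale z 0 = 0 :> hecke.
Proof. by apply/ffunP => x; rewrite !ffunE mulr0. Qed.
Lemma hscale0l h : hscale 0 h = 0.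
Proof. by apply/ffunP => x; rewrite !ffunE mul0r. Qed.
Lemma hscale1 h : hscale 1 h = h.
Proof. by apply/ffunP => x; rewrite !ffunE mul1r. Qed.
Lemma hscaleA z z' h : hscale z (hscale z' h) = hscale (z * z') h.
Proof. by apply/ffunP => x; rewrite !ffunE mulrA. Qed.
Lemma hscaleDl z z' h : hscale (z + z') h = hscale z h + hscale z' h.
Proof. by apply/ffunP => x; rewrite !ffunE mulrDl. Qed.
Lemma hscaleN z h : hscale (- z) h = - hscale z h.
Proof. by apply/ffunP => x; rewrite !ffunE mulNr. Qed.
Lemma hscale_sumr z (F : perm_r -> hecke) P : hscale z (\sum_(w | P w) F w) = \sum_(w | P w) hscale z (F w).
Proof. exact: (big_morph _ (hscaleDr z) (hscale0r z)). Qed.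

Lemma hecke_sum h : h = \sum_w hscale (h w) (Tb w).
Proof.
apply/ffunP => x; rewrite sum_ffunE (bigD1 x) //= big1 => [|w wx]; rewrite !ffunE.
  by rewrite eqxx mulr1 addr0.
by rewrite eq_sym (negbTE wx) mulr0.
Qed.

Definition hlinear (f : hecke -> hecke) :=
  (forall a b, f (a + b) = f a + f b) /\ (forall z a, f (hscale z a) = hscale z (f a)).

Lemma hlinear0 f : hlinear f -> f 0 = 0.
Proof. by move=> [_ fZ]; rewrite -{1}(hscale0l 0) fZ hscale0l. Qed.

Lemma hlinear_sum f (P : pred perm_r) (F : perm_r -> hecke) : hlinear f ->
  f (\sum_(w | P w) F w) = \sum_(w | P w) f (F w).
Proof. by move=> lf; apply: (big_morph f _ (hlinear0 lf)); case: lf. Qed.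

Lemma hlinear_ext f g : hlinear f -> hlinear g -> (forall w, f (Tb w) = g (Tb w)) -> f =1 g.
Proof.
move=> lf lg fg h; rewrite [h]hecke_sum !hlinear_sum //; apply: eq_bigr => w _.
by rewrite (proj2 lf) (proj2 lg) fg.
Qed.

(** Right multiplication by [T_s] on coefficients. Below it, [hfl] is the anti-automorphism
    [T_w -> T_{w^-1}], and [lam], the conjugate of [rho] by it, is left multiplication by [T_s]. *)
Definition rho i j h : hecke :=
  [ffun x => h (pmul x (tperm i j)) + (desc x i j)%:R * q * h x].
Definition hfl h : hecke := [ffun x => h x^-1%g].
Definition lam i j h := hfl (rho i j (hfl h)).

Lemma mulTsE i j h : adj i j -> mulTs h (tperm i j) = rho i j h.
Proof.
move=> ij; rewrite /mulTs hsumE; apply/ffunP => x; rewrite sum_ffunE ffunE.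
have -> : h (pmul x (tperm i j)) = \sum_w h w * (x == pmul w (tperm i j))%:R.
  rewrite (bigD1 (pmul x (tperm i j))) //= pmulsK eqxx mulr1 big1 ?addr0 // => w wx.
  have -> : (x == pmul w (tperm i j)) = false; last by rewrite mulr0.
  by apply/eqP => e; case/eqP: wx; rewrite e pmulsK.
have -> : (desc x i j)%:R * q * h x = \sum_w h w * ((desc w i j)%:R * q * (x == w)%:R).
  rewrite (bigD1 x) //= eqxx big1 ?addr0 => [|w wx]; first by rewrite mulr1 mulrC.
  by rewrite eq_sym (negbTE wx) !mulr0.
rewrite -big_split /=; apply: eq_bigr => w _; rewrite hscaleE -mulrDr; congr (_ * _).
rewrite /TwTs len_ltE //; case: (desc w i j); rewrite !ffunE ?mul1r ?mul0r ?addr0 //.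
by rewrite addrC.
Qed.

Lemma rho_linear i j : hlinear (rho i j).
Proof. by split=> [a b|z a]; apply/ffunP => x; rewrite !ffunE; ring. Qed.
Lemma hfl_linear : hlinear hfl.
Proof. by split=> [a b|z a]; apply/ffunP => x; rewrite !ffunE. Qed.
Lemma hflK : involutive hfl.
Proof. by move=> h; apply/ffunP => x; rewrite !ffunE invgK. Qed.
Lemma lam_linear i j : hlinear (lam i j).
Proof.
have [hD hZ] := hfl_linear; have [rD rZ] := rho_linear i j.
by split=> [a b|z a]; rewrite /lam ?hD ?rD ?hD // ?hZ ?rZ ?hZ.
Qed.

Lemma pmul_inv x y : (pmul x y)^-1%g = pmul y^-1%g x^-1%g.
Proof. by rewrite /pmul invMg. Qed.

Lemma lamE i j h x : lam i j h x =
  h (pmul (tperm i j) x) + (desc x^-1%g i j)%:R * q * h x.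
Proof. by rewrite !ffunE pmul_inv invgK tpermV. Qed.

Lemma desc_lmul x i j k l : adj i j -> adj k l -> pmul (tperm k l) x != pmul x (tperm i j) ->
  desc (pmul (tperm k l) x) i j = desc x i j.
Proof.
move=> ij kl ne; have nij := adj_neq ij; rewrite /desc !pmulE.
have nkl : (x i, x j) != (k, l) /\ (x j, x i) != (k, l).
  split; apply: contra ne => /eqP [ek el]; apply/eqP; rewrite -ek -el ?[tperm (x j) _]tpermC.
    by rewrite /pmul -[in LHS]tpermJ conjgE mulKVg.
  by rewrite /pmul -[in LHS]tpermJ conjgE mulKVg.
apply/idP/idP => [|lt]; last by apply: adj_tperm_lt; case: nkl.
apply: contraLR; rewrite -!leqNgt leq_eqVlt => /orP[/eqP/val_inj/perm_inj eij|lt].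
  by rewrite eij eqxx in nij.
by rewrite ltnW //; apply: adj_tperm_lt; case: nkl.
Qed.

Lemma desc_lr x i j k l : adj i j -> adj k l -> pmul (tperm k l) x = pmul x (tperm i j) ->
  desc x^-1%g k l = desc x i j.
Proof.
move=> ij kl e; rewrite -len_gtE // -len_gtE // len_inv -[len (pmul x^-1%g _)]len_inv.
by rewrite pmul_inv invgK tpermV e.
Qed.

(** The germ of associativity. Unless [s x = x s'], the left factor does not affect the descent seen
    by the right one; in the exceptional case the left and right descents coincide and flip
    together. *)
Lemma rho_lamC i j k l h : adj i j -> adj k l -> rho i j (lam k l h) = lam k l (rho i j h).
Proof.
move=> ij kl; apply/ffunP => x.
rewrite [LHS]ffunE !lamE [rho i j h x]ffunE [rho i j h _]ffunE.
have -> : pmul (pmul (tperm k l) x) (tperm i j) = pmul (tperm k l) (pmul x (tperm i j)).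
  by rewrite /pmul mulgA.
have [e|ne] := eqVneq (pmul (tperm k l) x) (pmul x (tperm i j)).
  rewrite !e [desc (pmul x _) i j]desc_mul // (desc_lr ij kl e) -e pmul_inv tpermV desc_mul //.
  by rewrite (desc_lr ij kl e); case: (desc x i j) => /=; ring.
rewrite (desc_lmul ij kl ne) pmul_inv tpermV desc_lmul //; first by ring.
apply: contra ne => /eqP e; apply/eqP; apply: invg_inj.
by rewrite !pmul_inv !tpermV.
Qed.


Lemma rho_Tb w i j : adj i j -> rho i j (Tb w) =
  Tb (pmul w (tperm i j)) + hscale ((desc w i j)%:R * q) (Tb w).
Proof.
move=> ij; apply/ffunP => x; rewrite !ffunE.
rewrite (can2_eq (pmulsK i j) (pmulsK i j)); congr (_ + _).
by have [->|] := eqVneq x w; rewrite ?mulr0.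
Qed.

Lemma rho_Tb_asc w i j : adj i j -> ~~ desc w i j -> rho i j (Tb w) = Tb (pmul w (tperm i j)).
Proof. by move=> ij /negbTE a; rewrite rho_Tb // a mul0r hscale0l addr0. Qed.

Lemma hfl_Tb w : hfl (Tb w) = Tb w^-1%g.
Proof. by apply/ffunP => x; rewrite !ffunE -{1}[w]invgK (inj_eq invg_inj). Qed.

Lemma lam_Tb w i j : adj i j -> lam i j (Tb w) =
  Tb (pmul (tperm i j) w) + hscale ((desc w^-1%g i j)%:R * q) (Tb w).
Proof.
by move=> ij; rewrite /lam hfl_Tb rho_Tb // (proj1 hfl_linear) (proj2 hfl_linear) !hfl_Tb pmul_inv !invgK tpermV.
Qed.

Lemma lam_rho1 i j : adj i j -> lam i j (Tb 1%g) = rho i j (Tb 1%g).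
Proof. by move=> ij; rewrite lam_Tb // rho_Tb // invg1 /pmul mulg1 mul1g. Qed.

Lemma mulTw1 n a : mulTw n a 1%g = a.
Proof.
case: n => //= n; case: pickP => // s /andP[/simple_reflP[i [j [ij ->]]]].
by rewrite len1.
Qed.

Lemma mulTwS n a w : w != 1%g -> exists i j, [/\ adj i j, desc w i j &
  mulTw n.+1 a w = rho i j (mulTw n a (pmul w (tperm i j)))].
Proof.
move=> w1; have [k [l [kl d]]] := desc_ex w1; rewrite /=.
case: pickP => [s /andP[/simple_reflP[i [j [ij ->]]] lt]|/(_ (tperm k l))].
  by exists i, j; rewrite mulTsE // -len_gtE.
by rewrite len_gtE // d andbT => /simple_reflP []; exists k, l.
Qed.

Lemma mulTw_linear n w : hlinear (fun a => mulTw n a w).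
Proof.
elim: n w => [|n IH] w; first by split.
split=> [a b|z a] /=; case: pickP => // s /andP[/simple_reflP[i [j [ij ->]]] _];
by rewrite !mulTsE // ?(proj1 (IH _)) ?(proj2 (IH _)) ?(proj1 (rho_linear _ _)) ?(proj2 (rho_linear _ _)).
Qed.

Lemma mulTw_lam n a w i j : adj i j -> mulTw n (lam i j a) w = lam i j (mulTw n a w).
Proof.
move=> ij; elim: n w => //= n IH w.
case: pickP => // s /andP[/simple_reflP[k [l [kl ->]]] _].
by rewrite !mulTsE // IH rho_lamC.
Qed.

Lemma mulTw_Tb1 n w : (len w <= n)%N -> mulTw n (Tb 1%g) w = Tb w.
Proof.
elim: n w => [|n IH] w lw.
  have [->//|/desc_ex [i [j [ij d]]]] := eqVneq w 1%g.
  by have := len_desc ij d; move: lw; rewrite leqn0 => /eqP ->.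
have [->|w1] := eqVneq w 1%g; first exact: mulTw1.
have [i [j [ij d ->]]] := mulTwS n (Tb 1%g) w1.
rewrite IH; first by rewrite rho_Tb_asc ?pmulsK // desc_mul // d.
by have := len_desc ij d; lia.
Qed.

Lemma hmulE a b : hmul a b = \sum_w hscale (b w) (mulTw (r ^ 2) a w).
Proof. exact: hsumE. Qed.

Lemma hmul_linear_l b : hlinear (fun a => hmul a b).
Proof.
split=> [a a'|z a]; rewrite !hmulE; last rewrite hscale_sumr.
  rewrite -big_split; apply: eq_bigr => w _.
  by rewrite (proj1 (mulTw_linear _ _)) hscaleDr.
by apply: eq_bigr => w _; rewrite (proj2 (mulTw_linear _ _)) !hscaleA mulrC.
Qed.

Lemma hmul_linear_r a : hlinear (hmul a).
Proof.
split=> [b b'|z b]; rewrite !hmulE; last rewrite hscale_sumr.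
  by rewrite -big_split; apply: eq_bigr => w _; rewrite ffunE hscaleDl.
by apply: eq_bigr => w _; rewrite ffunE !hscaleA.
Qed.

Lemma hmul_Tb a w : hmul a (Tb w) = mulTw (r ^ 2) a w.
Proof.
rewrite hmulE (bigD1 w) //= big1 ?addr0 => [|x xw]; first by rewrite ffunE eqxx hscale1.
by rewrite ffunE (negbTE xw) hscale0l.
Qed.

Lemma hmul1 a : hmul a (Tb 1%g) = a.
Proof. by rewrite hmul_Tb mulTw1. Qed.

Lemma hmul1l a : hmul (Tb 1%g) a = a.
Proof.
rewrite hmulE [RHS]hecke_sum; apply: eq_bigr => w _.
by rewrite mulTw_Tb1 ?len_bound.
Qed.

Lemma hmul_lam a b i j : adj i j -> hmul (lam i j a) b = lam i j (hmul a b).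
Proof.
move=> ij; rewrite !hmulE (hlinear_sum _ _ (lam_linear i j)).
by apply: eq_bigr => w _; rewrite mulTw_lam // (proj2 (lam_linear i j)).
Qed.

Lemma hlinear_comp f g : hlinear f -> hlinear g -> hlinear (f \o g).
Proof. by move=> [fD fZ] [gD gZ]; split=> [a b|z a]; rewrite /= ?gD ?fD ?gZ ?fZ. Qed.

(* Left multiplication by [Tb v] is a composite of the operators [lam], which commute with right multiplication. *)
Lemma hmul_rho a b i j : adj i j -> hmul a (rho i j b) = rho i j (hmul a b).
Proof.
move=> ij; move: a; apply: hlinear_ext => [||v].
- exact: hmul_linear_l.
- exact: hlinear_comp (rho_linear _ _) (hmul_linear_l b).
have -> : v = (v^-1)^-1%g by rewrite invgK.
elim/perm_ind: (v^-1)%g => [|w k l kl nd IH]; first by rewrite invg1 !hmul1l.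
have -> : Tb (pmul w (tperm k l))^-1%g = lam k l (Tb w^-1%g).
  by rewrite lam_Tb // invgK (negbTE nd) mul0r hscale0l addr0 pmul_inv tpermV.
by rewrite !hmul_lam // IH rho_lamC.
Qed.

Lemma hmulA a b c : hmul a (hmul b c) = hmul (hmul a b) c.
Proof.
move: c; apply: hlinear_ext => [||w].
- exact: hlinear_comp (hmul_linear_r a) (hmul_linear_r b).
- exact: hmul_linear_r.
elim/perm_ind: w => [|w i j ij nd IH]; first by rewrite !hmul1.
by rewrite -rho_Tb_asc // !hmul_rho // IH.
Qed.

Lemma hmul_rho_lam a b i j : adj i j -> hmul (rho i j a) b = hmul a (lam i j b).
Proof.
move=> ij; rewrite -{2}[b]hmul1l -hmul_lam // lam_rho1 // hmulA.
by rewrite hmul_rho // hmul1.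
Qed.

Lemma hmul_hfl a b : hfl (hmul a b) = hmul (hfl b) (hfl a).
Proof.
move: b; apply: hlinear_ext => [||w].
- exact: hlinear_comp hfl_linear (hmul_linear_r _).
- exact: hlinear_comp (hmul_linear_l _) hfl_linear.
elim/perm_ind: w => [|w i j ij nd IH]; first by rewrite hmul1 hfl_Tb invg1 hmul1l.
rewrite -rho_Tb_asc // hmul_rho //.
have hr c : hfl (rho i j c) = lam i j (hfl c) by rewrite /lam hflK.
by rewrite !hr hmul_lam // IH.
Qed.

(** Right multiplication by [T_s^-1 = T_s - (u - u^-1)]. *)
Definition rhoV i j h := rho i j h - hscale q h.

Lemma rhoK i j : adj i j -> cancel (rho i j) (rhoV i j).
Proof.
move=> ij h; apply/ffunP => x; rewrite !ffunE pmulsK desc_mul //.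
case: (desc x i j) => /=; rewrite ?mul0r ?mul1r ?add0r ?addr0; ring.
Qed.

Lemma rhoVK i j : adj i j -> cancel (rhoV i j) (rho i j).
Proof.
move=> ij h; apply/ffunP => x; rewrite !ffunE pmulsK desc_mul //.
case: (desc x i j) => /=; rewrite ?mul0r ?mul1r ?add0r ?addr0; ring.
Qed.

Lemma rhoV_linear i j : hlinear (rhoV i j).
Proof. by split=> [a b|z a]; apply/ffunP => x; rewrite !ffunE; ring. Qed.

Definition is_inv a b := hmul a b = Tb 1%g /\ hmul b a = Tb 1%g.

Lemma is_inv_uniq a b b' : is_inv b a -> is_inv b' a -> b = b'.
Proof. by move=> [ba ab] [b'a ab']; rewrite -[b]hmul1 -ab' hmulA ba hmul1l. Qed.

Lemma is_inv_mul w i j b : adj i j -> ~~ desc w i j -> is_inv b (Tb w^-1%g) ->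
  is_inv (rhoV i j b) (Tb (pmul w (tperm i j))^-1%g).
Proof.
move=> ij nd [bw wb].
have -> : Tb (pmul w (tperm i j))^-1%g = lam i j (Tb w^-1%g).
  by rewrite lam_Tb // invgK (negbTE nd) mul0r hscale0l addr0 pmul_inv tpermV.
split; first by rewrite -hmul_rho_lam // rhoVK.
have -> : hmul (lam i j (Tb w^-1%g)) (rhoV i j b) = rhoV i j (hmul (lam i j (Tb w^-1%g)) b).
  by apply: (can_inj (rhoK ij)); rewrite -hmul_rho // !rhoVK.
by rewrite hmul_lam // wb lam_rho1 // rhoK.
Qed.

Lemma barT_inv w : is_inv (barT w) (Tb w^-1%g).
Proof.
apply: (@theP _ (Tb 1%g) (fun h => hmul h (Tb w^-1%g) = Tb 1%g /\ hmul (Tb w^-1%g) h = Tb 1%g)).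
elim/perm_ind: w => [|w i j ij nd [b bw]]; first by exists (Tb 1%g); rewrite invg1 hmul1.
by exists (rhoV i j b); apply: is_inv_mul.
Qed.

Lemma barT1 : barT 1%g = Tb 1%g :> hecke.
Proof.
apply: (@is_inv_uniq (Tb 1%g)); first by have := barT_inv 1%g; rewrite invg1.
by rewrite /is_inv hmul1.
Qed.

Lemma barT_asc w i j : adj i j -> ~~ desc w i j -> barT (pmul w (tperm i j)) = rhoV i j (barT w).
Proof.
move=> ij nd; apply: is_inv_uniq (barT_inv _) _.
by apply: is_inv_mul => //; apply: barT_inv.
Qed.

Lemma barT_hfl w : barT w^-1%g = hfl (barT w).
Proof.
apply: is_inv_uniq (barT_inv _) _; rewrite invgK.
have [bw wb] := barT_inv w; have Tw : Tb w = hfl (Tb w^-1%g) by rewrite hfl_Tb invgK.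
by split; rewrite Tw -hmul_hfl ?wb ?bw hfl_Tb invg1.
Qed.

Lemma hbarE h : hbar h = \sum_w hscale (barK (h w)) (barT w).
Proof. exact: hsumE. Qed.

Lemma hbarD : {morph @hbar r : a b / a + b}.
Proof.
move=> a b; rewrite !hbarE -big_split; apply: eq_bigr => w _.
by rewrite ffunE rmorphD hscaleDl.
Qed.

Lemma hbarZ z h : hbar (hscale z h) = hscale (barK z) (hbar h).
Proof.
rewrite !hbarE hscale_sumr; apply: eq_bigr => w _.
by rewrite ffunE rmorphM hscaleA.
Qed.

Lemma hbar0 : hbar 0 = 0 :> hecke.
Proof. by rewrite hbarE big1 // => w _; rewrite ffunE rmorph0 hscale0l. Qed.

Lemma hbar_sum P (F : perm_r -> hecke) : hbar (\sum_(w | P w) F w) = \sum_(w | P w) hbar (F w).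
Proof. exact: (big_morph _ hbarD hbar0). Qed.

Lemma hbar_Tb w : hbar (Tb w) = barT w.
Proof.
rewrite hbarE (bigD1 w) //= big1 ?addr0 => [|x xw]; first by rewrite ffunE eqxx rmorph1 hscale1.
by rewrite ffunE (negbTE xw) rmorph0 hscale0l.
Qed.

(** On [T_w] with [w s > w] this is the recursion for [barT]. If [w s < w], write [w = (w s) s]; the
    bar changes the sign of [u - u^-1], which produces the correction term of [rhoV]. *)
Lemma hbar_rho h i j : adj i j -> hbar (rho i j h) = rhoV i j (hbar h).
Proof.
move=> ij; rewrite [h]hecke_sum (hlinear_sum _ _ (rho_linear i j)) !hbar_sum.
rewrite (hlinear_sum _ _ (rhoV_linear i j)); apply: eq_bigr => w _.
rewrite (proj2 (rho_linear i j)) !hbarZ (proj2 (rhoV_linear i j)); congr hscale.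
have [d|nd] := boolP (desc w i j); last by rewrite rho_Tb_asc // !hbar_Tb barT_asc.
rewrite rho_Tb // d mul1r hbarD hbarZ !hbar_Tb.
have nd : ~~ desc (pmul w (tperm i j)) i j by rewrite desc_mul // d.
have eb : barT w = rhoV i j (barT (pmul w (tperm i j))) by rewrite -barT_asc // pmulsK.
rewrite eb; apply: (can_inj (rhoK ij)).
rewrite (proj1 (rho_linear i j)) (proj2 (rho_linear i j)) !rhoVK // /rhoV -hscaleN.
by rewrite rmorphB /= barK_u barK_v opprB.
Qed.

Lemma hbar_hfl h : hbar (hfl h) = hfl (hbar h).
Proof.
rewrite !hbarE (hlinear_sum _ _ hfl_linear) (reindex_inj invg_inj); apply: eq_bigr => w _ /=.
by rewrite ffunE invgK (proj2 hfl_linear) barT_hfl.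
Qed.

(** Each factor [rhoV] raises lengths by at most one. This unitriangularity by length suffices for
    the arguments at an element of maximal length. *)
Lemma barT_coef w x : (len w <= len x)%N -> barT w x = (x == w)%:R.
Proof.
elim/perm_ind: w x => [|w i j ij nd IH] x; first by rewrite barT1 ffunE.
rewrite (len_asc ij nd) barT_asc // !ffunE => lx.
have xw : x != w by apply/eqP => xw; rewrite xw ltnn in lx.
rewrite [barT w x]IH ?(ltnW lx) // (negbTE xw) !mulr0 subr0 addr0.
rewrite IH; first by rewrite (can2_eq (pmulsK i j) (pmulsK i j)).
have [d|nd'] := boolP (desc x i j); first by have := len_desc ij d; lia.
by rewrite (len_asc ij nd'); lia.
Qed.

End Hecke.

(** * The Kazhdan-Lusztig basis *)

Section KL.
Variable r : nat.
Local Notation perm_r := (perm_r r).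
Local Notation hecke := (hecke r).
Implicit Types (w x y : perm_r) (h a b c : hecke) (i j : 'I_r).
Local Notation v := (uK^-1).
Local Notation C := (@KLlow r).

(* [rhoC] and [lamC] below are the right and left multiplications by [C'_s = T_s + u^-1]. *)
Definition rhoC i j h := rho i j h + hscale v h.

Lemma rhoC_linear i j : hlinear (rhoC i j).
Proof.
have [rD rZ] := rho_linear i j.
split=> [a b|z a]; rewrite /rhoC ?rD ?rZ ?hscaleDr; first by rewrite addrACA.
by rewrite !hscaleA mulrC -hscaleA -hscaleDr.
Qed.

Lemma rhoCE i j h x : rhoC i j h x = h (pmul x (tperm i j)) + (if desc x i j then uK else v) * h x.
Proof. by rewrite !ffunE -addrA -mulrDl; case: desc; rewrite /= ?mul1r ?subrK ?mul0r ?add0r. Qed.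

Lemma hbar_rhoC i j h : adj i j -> hbar (rhoC i j h) = rhoC i j (hbar h).
Proof.
move=> ij; rewrite hbarD hbarZ hbar_rho // barK_v /rhoC /rhoV -hscaleN -addrA -hscaleDl.
by congr (_ + hscale _ _); rewrite opprB subrK.
Qed.

Lemma rhoC_sqr i j h : adj i j -> rhoC i j (rhoC i j h) = hscale two (rhoC i j h).
Proof.
move=> ij; apply/ffunP => x; rewrite hscaleE !rhoCE pmulsK desc_mul // /two.
have uv : uK * v = 1 by rewrite mulfV ?uK_neq0.
case: (desc x i j) => /=; set A := h x; set B := h _.
  transitivity ((uK * v) * A + (uK + v) * B + uK * uK * A); first by rewrite uv; ring.
  by ring.
transitivity ((uK * v) * A + (uK + v) * B + v * v * A); first by rewrite uv; ring.
by ring.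
Qed.

Definition evp (y : K) : {poly int} := the 0 (fun p => y = ev p).

Lemma evpE (p : {poly int}) : evp (ev p) = p.
Proof. by apply: the_eq => // p' /ev_inj. Qed.

(** Parity of Kazhdan-Lusztig polynomials. It forces [mu] to vanish on pairs of equal length parity,
    so that every sign met in the duality is -1. *)
Definition par (n : nat) (p : {poly int}) := forall k, p`_k != 0 -> odd k = odd n.

(** The induction that builds the basis must also carry parity and Bruhat support: [mu] is defined
    through [bruhat_le], and the duality depends on the signs. *)
Definition is_KL w h := hbar h = h /\ forall x, let p := evp (h x) in
  [/\ h x = ev p, p`_0 = (x == w)%:R, par (len x + len w) p & p != 0 -> bruhat_le x w].

(** At an element of maximal length in the support the bar acts on the coefficient by [barK] alone,
    and a [barK]-invariant element of [u^-1 Z[u^-1]] is zero. *)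
Lemma bar_invariant_eq0 h : hbar h = h ->
  (forall x, exists p : {poly int}, h x = ev p /\ p`_0 = 0) -> h = 0.
Proof.
move=> hh hp; apply/ffunP => x0; rewrite ffunE; apply/eqP; apply/negPn/negP => hx0.
have [x hx max] := @arg_maxnP _ x0 (fun x => h x != 0) (@len r) hx0.
have [p [hp_x p0]] := hp x.
have : barK (h x) = h x.
  rewrite -[in RHS]hh hbarE sum_ffunE (bigD1 x) //= big1 => [|w wx].
    by rewrite hscaleE barT_coef // eqxx mulr1 addr0.
  rewrite hscaleE; have [->|hw] := eqVneq (h w) 0; first by rewrite rmorph0 mul0r.
  by rewrite barT_coef; [rewrite eq_sym (negbTE wx) mulr0 | exact: max].
rewrite hp_x => /bar_ev_eq0 /(_ p0) p_eq0.
by rewrite hp_x p_eq0 rmorph0 eqxx in hx.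
Qed.

Lemma hbarB a b : hbar (a - b) = hbar a - hbar b.
Proof. by apply: (canRL (addrK _)); rewrite -hbarD subrK. Qed.

Lemma KLlow_uniq w h : hbar h = h ->
  (forall x, exists p : {poly int}, h x = ev p /\ p`_0 = (x == w)%:R) -> C w = h.
Proof.
move=> hh hp; apply: the_eq.
  split => // x; apply/in_uinvZuinvE; have [p [-> p0]] := hp x.
  exists (p - (x == w)%:R%:P); rewrite coefB coefC p0 subrr; split => //.
  by rewrite rmorphB /= evC; case: (x == w).
move=> h' [hh' hp']; apply/eqP; rewrite -subr_eq0; apply/eqP; apply: bar_invariant_eq0.
  by rewrite hbarB hh hh'.
move=> x; have /in_uinvZuinvE [p' [p'0 e']] := hp' x; have [p [e p0]] := hp x.
exists (p' + (x == w)%:R%:P - p); split; last by rewrite coefB coefD coefC p'0 p0 add0r subrr.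
rewrite rmorphB rmorphD /= evC -e' -e !ffunE; case: (x == w) => /=; ring.
Qed.

Lemma is_KL_uniq w h : is_KL w h -> C w = h.
Proof. by move=> [hh hp]; apply: KLlow_uniq => // x; have [e p0 _ _] := hp x; exists (evp (h x)). Qed.

(** Multiplication by [u], for polynomials in [u^-1] without constant term. *)
Definition shiftp (p : {poly int}) : {poly int} := \poly_(k < size p) p`_k.+1.

Lemma coef_shiftp (p : {poly int}) k : (shiftp p)`_k = p`_k.+1.
Proof. by rewrite coef_poly; case: ltnP => // /leqW /leq_sizeP ->. Qed.

Lemma shiftpK (p : {poly int}) : p`_0 = 0 -> p = shiftp p * 'X.
Proof.
move=> p0; apply/polyP => k; rewrite coefMX; case: k => [|k]; first by rewrite p0.
by rewrite coef_shiftp.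
Qed.

Lemma ev_shiftp (p : {poly int}) : p`_0 = 0 -> uK * ev p = ev (shiftp p).
Proof. by move=> p0; rewrite {1}(shiftpK p0) rmorphM /= evX mulrCA mulfV ?uK_neq0 // mulr1. Qed.

Definition mulC_poly i j (p : perm_r -> {poly int}) x :=
  p (pmul x (tperm i j)) + if desc x i j then shiftp (p x) else 'X * p x.

Lemma rhoC_poly i j h (p : perm_r -> {poly int}) : (forall x, h x = ev (p x)) -> (forall x, desc x i j -> (p x)`_0 = 0) ->
  forall x, rhoC i j h x = ev (mulC_poly i j p x).
Proof.
move=> hp p0 x; rewrite rhoCE !hp rmorphD /=; congr (_ + _).
by case: ifP => d; rewrite ?ev_shiftp ?p0 // rmorphM /= evX.
Qed.

Lemma par0 n : par n 0. Proof. by move=> k; rewrite coef0 eqxx. Qed.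

Lemma parD n p p' : par n p -> par n p' -> par n (p + p').
Proof.
move=> hp hp' k; rewrite coefD; have [->|pk _] := eqVneq p`_k 0; last exact: hp.
by rewrite add0r; apply: hp'.
Qed.

Lemma parZ n m (p : {poly int}) : par n p -> par n (m%:P * p).
Proof. by move=> hp k; rewrite coefCM mulf_eq0 negb_or => /andP[_]; apply: hp. Qed.

Lemma len_parity x i j : adj i j -> odd (len (pmul x (tperm i j))) = ~~ odd (len x).
Proof.
move=> ij; have [d|nd] := boolP (desc x i j); last by rewrite len_asc.
by rewrite (len_desc ij d) /= negbK.
Qed.

Lemma bruhat_le_len x y : bruhat_le x y -> (len x <= len y)%N.
Proof.
case/connectP=> p xp ->; elim: p x xp => //= z p IH x /andP[/existsP[t /and3P[_ _ lt]]] /IH.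
by apply: leq_trans; apply: ltnW.
Qed.

Lemma bruhat_le_anti x y : bruhat_le x y -> bruhat_le y x -> x = y.
Proof.
case/connectP=> -[|z p] /= xp e yx; first by rewrite e.
move: xp => /andP[/existsP[t /and3P[_ _ lt]] zp].
have zy : bruhat_le z y by apply/connectP; exists p.
by have := bruhat_le_len zy; have := bruhat_le_len yx; lia.
Qed.

Lemma bruhat_asc w i j : adj i j -> ~~ desc w i j -> bruhat_le w (pmul w (tperm i j)).
Proof.
move=> ij nd; apply/connect1/existsP; exists (tperm i j); rewrite eqxx (len_ltE w ij) nd !andbT.
by apply/reflsP; exists i, j; split => //; move: ij; rewrite /adj => /eqP ->.
Qed.

Definition mu0 x w : int := (evp (C w x))`_1.

(** The Kazhdan-Lusztig recursion from [w' = w s < w]. In [C'_{w'} C'_s] the factor [u] at each [x]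
    with [x s < x] moves the coefficient of [u^-1] to order 0; subtracting [mu0 y w'] times [C'_y]
    removes these unwanted constant terms. *)
Lemma KL_exists w : is_KL w (C w).
Proof.
move: {2}(len w) (erefl (len w)) => n; elim/ltn_ind: n w => n IH w lw.
have [->|/desc_ex [i [j [ij d]]]] := eqVneq w 1%g.
  suff KL1 : is_KL 1%g (Tb 1%g) by rewrite (is_KL_uniq KL1).
  split; first by rewrite hbar_Tb barT1.
  move=> x; have -> : Tb 1%g x = ev (x == 1%g)%:R%:P.
    by rewrite evC ffunE; case: (x == _).
  cbv zeta; rewrite evpE coefC; split=> //.
    move=> k; rewrite coefC; case: k => [|k]; last by rewrite eqxx.
    by have [->|] := eqVneq x 1%g; rewrite ?oddD ?addbb.
  by have [-> _|] := eqVneq x 1%g; [exact: connect0 | rewrite polyC0 eqxx].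
set w' := pmul w (tperm i j).
have ew : pmul w' (tperm i j) = w by rewrite /w' pmulsK.
have nd : ~~ desc w' i j by rewrite desc_mul // d.
have lww : len w = (len w').+1 by apply: len_desc.
have [hw' pw'] : is_KL w' (C w') by apply: IH erefl; rewrite -lw lww.
(* The length bound makes the induction hypothesis available; it loses nothing, because [mu0 y w']
   is nonzero only for [y] below [w']. *)
pose p x := evp (C w' x); pose P y := desc y i j && (len y < len w)%N.
pose hh := rhoC i j (C w') - \sum_(y | P y) hscale (mu0 y w')%:~R (C y).
pose q x := mulC_poly i j p x - \sum_(y | P y) (mu0 y w')%:P * evp (C y x).
have KLy y : P y -> is_KL y (C y) by case/andP=> _ ly; apply: IH erefl; rewrite -lw.
have p0 x : desc x i j -> (p x)`_0 = 0.
  move=> dx; have [_ -> _ _] := pw' x; case: eqP => // xw.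
  by rewrite xw (negbTE nd) in dx.
have hq x : hh x = ev (q x).
  rewrite /hh ffunE (@rhoC_poly _ _ _ p) //; last by move=> y; have [] := pw' y.
  rewrite ffunE rmorphB sum_ffunE rmorph_sum; congr (_ - _); apply: eq_bigr => y Py.
  by rewrite hscaleE rmorphM /= evC; have [_ /(_ x) [<-]] := KLy y Py.
have mub y : mu0 y w' != 0 -> bruhat_le y w'.
  by move=> m; have [_ _ _] := pw' y; apply; apply: contraNneq m; rewrite /mu0 => ->; rewrite coef0.
have w'w : bruhat_le w' w by rewrite -ew; apply: bruhat_asc.
suff KLh : is_KL w hh by rewrite (is_KL_uniq KLh).
split.
  rewrite hbarB hbar_rhoC // hw' hbar_sum; congr (_ - _); apply: eq_bigr => y Py.
  by rewrite hbarZ rmorph_int; have [-> _] := KLy y Py.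
move=> x; rewrite hq; cbv zeta; rewrite evpE; split => //.
- rewrite coefB coef_sum coefD.
  have -> : \sum_(y | P y) ((mu0 y w')%:P * evp (C y x))`_0 = if P x then mu0 x w' else 0.
    transitivity (\sum_(y | P y) (if y == x then mu0 y w' else 0)).
      apply: eq_bigr => y Py; rewrite coefCM; have [_ /(_ x) [_ -> _ _]] := KLy y Py.
      by rewrite eq_sym; case: eqP; rewrite ?mulr1 ?mulr0.
    case: ifP => Px; last by rewrite big1 // => y Py; case: eqP => // yx; rewrite yx Px in Py.
    by rewrite (bigD1 x) //= eqxx big1 ?addr0 // => y /andP[_ /negbTE ->].
  have [_ -> _ _] := pw' (pmul x (tperm i j)).
  rewrite (can2_eq (pmulsK i j) (pmulsK i j)) ew.
  rewrite /P; case: ifP => dx /=; last first.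
    by rewrite mulrC coefMX /= addr0 subr0.
  rewrite coef_shiftp -[(p x)`_1]/(mu0 x w'); case: ltnP => lx; first by rewrite addrK.
  suff -> : mu0 x w' = 0 by rewrite addr0 subr0.
  by apply/eqP; apply: contraTT lx => /mub /bruhat_le_len; rewrite -ltnNge; lia.
- have odd_w' : odd (len w') = ~~ odd (len w) by rewrite lww /= negbK.
  apply: parD; first apply: parD.
  + have [_ _ hp _] := pw' (pmul x (tperm i j)); move=> m /hp ->.
    by rewrite !oddD len_parity // odd_w' addNb addbN negbK.
  + have [_ _ hp _] := pw' x; case: ifP => dx m.
      rewrite coef_shiftp => /hp; rewrite !oddD odd_w' addbN /= => /(congr1 negb).
      by rewrite !negbK.
    rewrite mulrC coefMX; case: m => [|m] /=; rewrite ?eqxx // => /hp.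
    by rewrite !oddD odd_w' addbN => ->; rewrite negbK.
  rewrite -sumrN; apply: big_ind => [||y Py]; [exact: par0 | by move=> ? ?; apply: parD|].
  have [->|m] := eqVneq (mu0 y w') 0; first by rewrite mul0r oppr0; apply: par0.
  rewrite -mulNr -polyCN; apply: parZ => k.
  have [_ /(_ x) [_ _ hp _]] := KLy y Py; move=> /hp ->.
  have [_ _ /(_ _ m)] := pw' y; rewrite !oddD odd_w' => /=.
  by case: (odd (len y)); case: (odd (len w)); case: (odd (len x)).
move=> qx; have [pxs|pxs] := eqVneq (p (pmul x (tperm i j))) 0; last first.
  have [_ _ _ /(_ pxs) /(bruhat_mul ij)] := pw' (pmul x (tperm i j)).
  by rewrite pmulsK ew => -[/connect_trans|//]; apply.
have [px|px] := eqVneq (p x) 0; last first.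
  by have [_ _ _ /(_ px) xw'] := pw' x; apply: connect_trans xw' w'w.
have [/existsP[y /and3P[Py m ey]]|] := boolP [exists y, [&& P y, mu0 y w' != 0 & evp (C y x) != 0]].
  have [_ /(_ x) [_ _ _ /(_ ey) xy]] := KLy y Py.
  exact: connect_trans xy (connect_trans (mub y m) w'w).
rewrite negb_exists => /forallP none; case/eqP: qx; rewrite /q /mulC_poly pxs px add0r.
have -> : (if desc x i j then shiftp 0 else 'X * 0) = 0.
  case: ifP => _; last by rewrite mulr0.
  by apply/polyP => k; rewrite coef_shiftp !coef0.
rewrite big1 ?subrr // => y Py; have := none y; rewrite Py /= negb_and !negbK.
by case/orP => /eqP ->; rewrite ?mul0r ?mulr0.
Qed.

Lemma KL_ev w x : C w x = ev (evp (C w x)).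
Proof. by have [_ /(_ x) []] := KL_exists w. Qed.

Lemma KL_coef0 w x : (evp (C w x))`_0 = (x == w)%:R.
Proof. by have [_ /(_ x) []] := KL_exists w. Qed.

Lemma KL_par w x : par (len x + len w) (evp (C w x)).
Proof. by have [_ /(_ x) []] := KL_exists w. Qed.

Lemma hbar_KL w : hbar (C w) = C w.
Proof. by have [] := KL_exists w. Qed.

Lemma mu0_bruhat x w : mu0 x w != 0 -> bruhat_le x w.
Proof.
by move=> m; have [_ /(_ x) [_ _ _]] := KL_exists w; apply; apply: contraNneq m; rewrite /mu0 => ->; rewrite coef0.
Qed.

Lemma mu0_par x w : mu0 x w != 0 -> odd (len x + len w).
Proof. by move/KL_par => <-. Qed.

Lemma muE x w : mu x w = mu0 x w + mu0 w x.
Proof.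
have cu y z : coef_uinv (@Pp r y z) = mu0 y z by rewrite /Pp KL_ev coef_uinv_ev.
have mu0xx y : mu0 y y = 0.
  by apply/eqP; apply/negPn/negP => /mu0_par; rewrite oddD addbb.
rewrite /mu !cu; case: ifP => xw.
  suff -> : mu0 w x = 0 by rewrite addr0.
  apply/eqP; apply/negPn/negP => m; have ewx := bruhat_le_anti (mu0_bruhat m) xw.
  by rewrite ewx mu0xx eqxx in m.
have -> : mu0 x w = 0 by apply/eqP; apply/negPn/negP => /mu0_bruhat; rewrite xw.
rewrite add0r; case: ifP => // wx; symmetry.
by apply/eqP; apply/negPn/negP => /mu0_bruhat; rewrite wx.
Qed.

Lemma mu_par x w : mu x w != 0 -> odd (len x + len w).
Proof.
rewrite muE; have [->|m _] := eqVneq (mu0 x w) 0; last exact: mu0_par m.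
by rewrite add0r addnC => /mu0_par.
Qed.

Lemma muC x w : mu x w = mu w x.
Proof. by rewrite !muE addrC. Qed.

(** The difference of the two sides is bar-invariant with coefficients in [u^-1 Z[u^-1]], hence
    zero. Products can thus be expanded by reading constant terms. *)
Lemma KL_expand h (p : perm_r -> {poly int}) : hbar h = h -> (forall x, h x = ev (p x)) ->
  h = \sum_x hscale ((p x)`_0)%:~R (C x).
Proof.
move=> hh hp; apply/eqP; rewrite -subr_eq0; apply/eqP; apply: bar_invariant_eq0.
  rewrite hbarB hh hbar_sum; congr (_ - _); apply: eq_bigr => x _.
  by rewrite hbarZ rmorph_int hbar_KL.
move=> x; exists (p x - \sum_y ((p y)`_0)%:P * evp (C y x)); split.
  rewrite !ffunE hp rmorphB sum_ffunE rmorph_sum; congr (_ - _); apply: eq_bigr => y _.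
  by rewrite hscaleE rmorphM /= evC -KL_ev.
rewrite coefB coef_sum (bigD1 x) //= big1 => [|y yx]; rewrite coefCM KL_coef0.
  by rewrite eqxx mulr1 addr0 subrr.
by rewrite eq_sym (negbTE yx) mulr0.
Qed.

Lemma KL_mul_asc0 w i j : adj i j -> ~~ desc w i j ->
  rhoC i j (C w) = \sum_(x | desc x i j) hscale ((x == pmul w (tperm i j))%:R + mu0 x w)%:~R (C x).
Proof.
move=> ij nd; rewrite (@KL_expand (rhoC i j (C w)) (mulC_poly i j (fun x => evp (C w x)))); first last.
- apply: rhoC_poly => [x|x dx]; first exact: KL_ev.
  by rewrite KL_coef0; case: eqP => // xw; rewrite -xw dx in nd.
- by rewrite hbar_rhoC // hbar_KL.
rewrite [RHS]big_mkcond /=; apply: eq_bigr => x _.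
rewrite coefD KL_coef0 (can2_eq (pmulsK i j) (pmulsK i j)).
case: ifP => dx; first by rewrite coef_shiftp.
rewrite mulrC coefMX addr0; case: eqP => [xw|]; last by rewrite hscale0l.
by rewrite xw desc_mul // nd in dx.
Qed.

(** By the recursion [C'_w] is [C'_{w s} C'_s] minus shorter [C'_x] having [s] as a descent. The
    first term is an eigenvector since [C'_s] squares to [[2] C'_s], the others by induction. *)
Lemma KL_mul_desc w i j : adj i j -> desc w i j -> rhoC i j (C w) = hscale two (C w).
Proof.
move=> ij; move: {2}(len w) (erefl (len w)) => n; elim/ltn_ind: n w => n IH w lw d.
set w' := pmul w (tperm i j).
have nd : ~~ desc w' i j by rewrite desc_mul // d.
have lww : len w = (len w').+1 by apply: len_desc.
have := KL_mul_asc0 ij nd; rewrite /w' pmulsK -/w' (bigD1 w) //= eqxx.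
have -> : mu0 w w' = 0.
  by apply/eqP; apply/negPn/negP => /mu0_bruhat /bruhat_le_len; rewrite lww ltnn.
rewrite addr0 hscale1 => e.
have -> : C w = rhoC i j (C w') - \sum_(x | desc x i j && (x != w)) hscale ((x == w)%:R + mu0 x w')%:~R (C x).
  by rewrite e addrK.
set s := \sum_(_ | _) _.
have es : rhoC i j s = hscale two s.
  rewrite (hlinear_sum _ _ (rhoC_linear i j)) hscale_sumr; apply: eq_bigr => x /andP[dx xw].
  rewrite (proj2 (rhoC_linear i j)) hscaleA mulrC -hscaleA (negbTE xw) add0r.
  have [->|m] := eqVneq (mu0 x w') 0; first by rewrite !hscale0l.
  by rewrite (IH (len x)) // -lw lww ltnS; apply/bruhat_le_len/mu0_bruhat.
rewrite -[s in - s]hscale1 -hscaleN (proj1 (rhoC_linear i j)) (proj2 (rhoC_linear i j)).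
by rewrite rhoC_sqr // es hscaleDr !hscaleA mulrC.
Qed.

(* [P_{x,w} = u^-1 P_{xs,w}] when [ws < w] and [xs > x]. *)
Lemma mu0_desc x w i j : adj i j -> desc w i j -> ~~ desc x i j ->
  mu0 x w = (pmul x (tperm i j) == w)%:R.
Proof.
move=> ij dw nx; have := KL_mul_desc ij dw => /ffunP /(_ x).
rewrite rhoCE (negbTE nx) hscaleE /two mulrDl => /addIr e.
have : C w x = ev ('X * evp (C w (pmul x (tperm i j)))).
  by rewrite rmorphM /= evX -KL_ev e mulrA mulVf ?mul1r ?uK_neq0.
by rewrite /mu0 => ->; rewrite evpE mulrC coefMX /= KL_coef0.
Qed.

(** The coefficient of [C'_x] in [C'_w C'_s]. It has the same form as [Blow], with descents of
    permutations instead of tableau conditions. *)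
Definition bcoef i j x w : K :=
  if desc w i j then (x == w)%:R * two else if desc x i j then (mu x w)%:~R else 0.

Lemma KL_mul w i j : adj i j -> rhoC i j (C w) = \sum_x hscale (bcoef i j x w) (C x).
Proof.
move=> ij; rewrite /bcoef; have [d|nd] := boolP (desc w i j).
  rewrite KL_mul_desc // (bigD1 w) //= eqxx mul1r big1 ?addr0 // => x /negbTE ->.
  by rewrite mul0r hscale0l.
rewrite KL_mul_asc0 // big_mkcond; apply: eq_bigr => x _; case: ifP => dx; last by rewrite hscale0l.
(* The indicator of [x = w s] is [mu0 w x], since [s] is a descent of [x] but not of [w]. *)
by rewrite muE addrC eq_sym (mu0_desc ij dx nd).
Qed.

Lemma mu_star_cases x w i j (k l : 'I_r) : adj i j -> adj k l ->
  desc w i j -> ~~ desc x i j -> desc x k l -> ~~ desc w k l ->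
  mu x w = (pmul x (tperm i j) == w)%:R + (pmul w (tperm k l) == x)%:R.
Proof. by move=> ij kl dw nx dx nw; rewrite muE (mu0_desc ij) // (mu0_desc kl). Qed.

Lemma hfl_KL w : hfl (C w) = C w^-1%g.
Proof.
symmetry; apply: KLlow_uniq; first by rewrite hbar_hfl hbar_KL.
move=> x; exists (evp (C w x^-1%g)); rewrite ffunE -KL_ev KL_coef0; split => //.
by rewrite (can2_eq (@invgK _) (@invgK _)).
Qed.

Definition lamC i j h := lam i j h + hscale v h.

Lemma lamCE i j h : lamC i j h = hfl (rhoC i j (hfl h)).
Proof. by rewrite /lamC /rhoC (proj1 (@hfl_linear r)) (proj2 (@hfl_linear r)) hflK. Qed.

Lemma lamC_linear i j : hlinear (lamC i j).
Proof.
have [lD lZ] := lam_linear i j.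
split=> [a b|z a]; rewrite /lamC ?lD ?lZ ?hscaleDr; first by rewrite addrACA.
by rewrite !hscaleA mulrC -hscaleA -hscaleDr.
Qed.

Lemma KL_mull w i j : adj i j ->
  lamC i j (C w) = \sum_x hscale (bcoef i j x^-1%g w^-1%g) (C x).
Proof.
move=> ij; rewrite lamCE hfl_KL KL_mul // (hlinear_sum _ _ (@hfl_linear r)) (reindex_inj invg_inj).
by apply: eq_bigr => x _ /=; rewrite (proj2 (@hfl_linear r)) hfl_KL invgK.
Qed.

Lemma lamC_rhoC i j (k l : 'I_r) h : adj i j -> adj k l -> lamC i j (rhoC k l h) = rhoC k l (lamC i j h).
Proof.
move=> ij kl; rewrite /lamC /rhoC (proj1 (lam_linear _ _)) (proj2 (lam_linear _ _)).
rewrite (proj1 (rho_linear _ _)) (proj2 (rho_linear _ _)) rho_lamC // !hscaleDr.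
by rewrite addrACA.
Qed.

Lemma KL_indep (f : perm_r -> K) : \sum_x hscale (f x) (C x) = 0 -> forall x, f x = 0.
Proof.
move=> s0 x0; apply/eqP; apply/negPn/negP => fx0.
have [x fx max] := @arg_maxnP _ x0 (fun x => f x != 0) (@len r) fx0.
have /ffunP /(_ x) := s0; rewrite sum_ffunE (bigD1 x) //= big1 => [|y yx]; last first.
  rewrite hscaleE; have [->|fy] := eqVneq (f y) 0; first by rewrite mul0r.
  have [_ /(_ x) [_ _ _ ble]] := KL_exists y; have [e0|/ble xy] := eqVneq (evp (C y x)) 0.
    by rewrite KL_ev e0 rmorph0 mulr0.
  case/connectP: xy => -[|z p] /=; first by move=> _ e; rewrite e eqxx in yx.
  case/andP => /existsP[t /and3P[_ _ lt]] zp e.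
  have zy : bruhat_le z y by apply/connectP; exists p.
  have := bruhat_le_len zy; have := max _ fy; rewrite /=; lia.
rewrite hscaleE addr0 ffunE => /eqP; rewrite mulf_eq0 (negbTE fx) /= KL_ev => /eqP.
rewrite -(rmorph0 ev) => /ev_inj e0; have := KL_coef0 x x; rewrite e0 coef0 eqxx.
by move/eqP; rewrite eq_sym oner_eq0.
Qed.

Lemma KL_coord_inj (f g : perm_r -> K) :
  \sum_x hscale (f x) (C x) = \sum_x hscale (g x) (C x) -> f =1 g.
Proof.
move=> e x; apply/eqP; rewrite -subr_eq0; apply/eqP; move: x; apply: KL_indep.
under eq_bigr do rewrite hscaleDl hscaleN.
by rewrite sumrB e subrr.
Qed.
End KL.

(** * Duality under the longest element *)

Section Duality.
Variable r : nat.
Local Notation perm_r := (perm_r r).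
Local Notation hecke := (hecke r).
Implicit Types (w x y z : perm_r) (a b h : hecke) (i j : 'I_r).
Local Notation v := (uK^-1).
Local Notation C := (@KLlow r).

Definition hdot a b : K := \sum_x a x * b x.

Lemma hdot_linear a (F : perm_r -> hecke) : hdot a (\sum_x F x) = \sum_x hdot a (F x).
Proof.
rewrite /hdot exchange_big; apply: eq_bigr => x _ /=.
by rewrite sum_ffunE mulr_sumr.
Qed.

Lemma hdotZ a (e : K) h : hdot a (hscale e h) = e * hdot a h.
Proof. by rewrite /hdot mulr_sumr; apply: eq_bigr => x _; rewrite hscaleE mulrCA. Qed.

Lemma hdotC a b : hdot a b = hdot b a.
Proof. by apply: eq_bigr => x _; rewrite mulrC. Qed.

Lemma hdotBl a b h : hdot (a - b) h = hdot a h - hdot b h.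
Proof. by rewrite /hdot -sumrB; apply: eq_bigr => x _; rewrite !ffunE mulrBl. Qed.

Lemma hdot_Tb a w : hdot a (Tb w) = a w.
Proof.
rewrite /hdot (bigD1 w) //= ffunE eqxx mulr1 big1 ?addr0 // => x /negbTE xw.
by rewrite ffunE xw mulr0.
Qed.

(** In the basis of the [T_x] the operator is a symmetric matrix: a diagonal one plus the involution
    [x -> x s]. *)
Lemma hdot_rhoC a b i j : hdot (rhoC i j a) b = hdot a (rhoC i j b).
Proof.
rewrite /hdot; under eq_bigr do rewrite rhoCE mulrDl.
under [RHS]eq_bigr do rewrite rhoCE mulrDr.
rewrite !big_split; congr (_ + _).
  by rewrite (reindex_inj (inv_inj (pmulsK i j))); apply: eq_bigr => x _ /=; rewrite pmulsK.
by apply: eq_bigr => x _; rewrite mulrCA mulrA.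
Qed.

Lemma KL_support w x : C w x != 0 -> bruhat_le x w.
Proof.
have [_ /(_ x) [_ _ _ ble]] := KL_exists w => cw; apply: ble.
by apply: contraNneq cw => e0; rewrite KL_ev e0 rmorph0.
Qed.

Lemma bruhat_lt_len x y : bruhat_le x y -> x != y -> (len x < len y)%N.
Proof.
case/connectP => -[|z p] /= zp e xy; first by rewrite e eqxx in xy.
case/andP: zp => /existsP[t /and3P[_ _ lt]] zp.
by rewrite (leq_trans lt) //; apply: bruhat_le_len; apply/connectP; exists p.
Qed.

Lemma KL_diag w : C w w = 1.
Proof.
have : barK (C w w) = C w w.
  rewrite -[in RHS]hbar_KL hbarE sum_ffunE (bigD1 w) //= big1 => [|z zw].
    by rewrite hscaleE barT_coef // eqxx mulr1 addr0.
  rewrite hscaleE; have [->|/KL_support lez] := eqVneq (C w z) 0; first by rewrite rmorph0 mul0r.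
  by rewrite barT_coef ?bruhat_le_len // eq_sym (negbTE zw) mulr0.
rewrite KL_ev => e; have := @bar_ev_eq0 (evp (C w w) - 1).
have -> : ev (evp (C w w) - 1) = ev (evp (C w w)) - 1 by rewrite rmorphB rmorph1.
rewrite (rmorphB barK) rmorph1 /= e coefB KL_coef0 eqxx coefC subrr.
by move=> /(_ erefl erefl) /eqP; rewrite subr_eq0 => /eqP ->; rewrite rmorph1.
Qed.

(** Inversion of a unitriangular matrix by induction on length. Integrality, constant terms and
    support of the inverse are recorded because its entries are the coefficients of the dual basis
    in [mu_w0]. *)
Lemma Tb_KL w : exists d : perm_r -> {poly int}, [/\ Tb w = \sum_y hscale (ev (d y)) (C y),
  forall y, (d y)`_0 = (y == w)%:R, forall y, d y != 0 -> bruhat_le y w & d w = 1].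
Proof.
move: {2}(len w) (erefl (len w)) => n; elim/ltn_ind: n w => n IH w lw.
pose low x := (len x < len w)%N.
have /fin_all_exists [d hd] : forall x, exists d : perm_r -> {poly int}, low x ->
    [/\ Tb x = \sum_y hscale (ev (d y)) (C y),
        forall y, (d y)`_0 = (y == x)%:R & forall y, d y != 0 -> bruhat_le y x].
  move=> x; have [lx|nl] := boolP (low x); last by exists (fun=> 0).
  by rewrite /low lw in lx; have [d [? ? ? _]] := IH _ lx _ erefl; exists d.
pose p x := evp (C w x).
have plow x : x != w -> p x != 0 -> bruhat_le x w /\ low x.
  move=> xw px; have xlew : bruhat_le x w by have [_ /(_ x) [_ _ _]] := KL_exists w; apply.
  by split=> //; apply: bruhat_lt_len.
pose D y := (y == w)%:R%:P - \sum_(x | low x) p x * d x y.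
have dw x : low x -> d x w = 0.
  move=> lx; apply/eqP/negPn/negP; have [_ _ ble] := hd x lx => /ble /bruhat_le_len.
  by move=> le; have : (len x < len w)%N by []; rewrite ltnNge le.
exists D; split.
- have -> : Tb w = C w - \sum_(x | low x) hscale (C w x) (Tb x).
    apply: (canRL (addrK _)); rewrite [RHS]hecke_sum [RHS](bigD1 w) //= KL_diag hscale1; congr (_ + _).
    rewrite [RHS](bigID low) /= [X in _ = _ + X]big1 ?addr0 => [|x /andP[xw nl]].
      by apply: eq_bigl => x; rewrite /low; case: eqP => //= ->; rewrite ltnn.
    rewrite KL_ev -/(p x); have [->|/(plow _ xw) [_ lx]] := eqVneq (p x) 0.
      by rewrite rmorph0 hscale0l.
    by rewrite lx in nl.
  rewrite [RHS](eq_bigr (fun y => hscale (y == w)%:R (C y) - \sum_(x | low x) hscale (ev (p x * d x y)) (C y))).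
    rewrite sumrB; congr (_ - _).
      rewrite (bigD1 w) //= eqxx hscale1 big1 ?addr0 // => y /negbTE ->.
      by rewrite hscale0l.
    rewrite exchange_big; apply: eq_bigr => x lx /=.
    have [-> _ _] := hd x lx; rewrite hscale_sumr; apply: eq_bigr => y _.
    by rewrite hscaleA rmorphM /= -KL_ev.
  move=> y _; rewrite /D rmorphB rmorph_sum hscaleDl hscaleN /= evC; congr (_ - _).
    by case: (y == w).
  by apply/ffunP => z; rewrite sum_ffunE hscaleE mulr_suml; apply: eq_bigr => x _; rewrite hscaleE.
- move=> y; rewrite coefB coefC coef_sum big1 ?subr0 // => x lx; rewrite coef0M KL_coef0.
  have -> : x == w = false by apply/eqP => xw; rewrite xw /low ltnn in lx.
  by rewrite mul0r.
- move=> y; rewrite /D; have [->|yw] := eqVneq y w; first by move=> _; apply: connect0.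
  rewrite polyC0 sub0r oppr_eq0 => s0.
  have [/existsP[x /and3P[lx px dx]]|] := boolP [exists x, [&& low x, p x != 0 & d x y != 0]].
    have [_ _ /(_ y dx) yx] := hd x lx; apply: connect_trans yx _.
    by apply: (proj1 (plow x _ px)); apply: contraTneq lx => ->; rewrite /low ltnn.
  rewrite negb_exists => /forallP none; case/eqP: s0; apply: big1 => x lx.
  by have := none x; rewrite lx /= negb_and !negbK => /orP[] /eqP ->; rewrite ?mul0r ?mulr0.
- by rewrite /D eqxx big1 ?subr0 // => x lx; rewrite dw // mulr0.
Qed.

Definition w0 : perm_r := perm (@rev_ord_inj r).
Definition wz w := pmul w0 w.

Lemma wzE w i : wz w i = rev_ord (w i).
Proof. by rewrite pmulE permE. Qed.

Lemma wzK : involutive wz.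
Proof. by move=> w; apply/permP => i; rewrite !wzE rev_ordK. Qed.

Lemma wz_mul w s : wz (pmul w s) = pmul (wz w) s.
Proof. by rewrite /wz /pmul mulgA. Qed.

Lemma desc_wz w i j : adj i j -> desc (wz w) i j = ~~ desc w i j.
Proof.
move=> ij; rewrite ndescE // /desc !wzE /=; have := ltn_ord (w i); have := ltn_ord (w j); lia.
Qed.

Lemma wz_no_asc w : (forall i j, adj i j -> desc w i j) -> wz w = 1%g.
Proof. by move=> dw; apply: no_desc1 => i j ij; rewrite desc_wz // negbK dw. Qed.

Lemma w0_max w : bruhat_le w0 w -> w = w0.
Proof.
case/connectP => -[|x p] //= /andP[/bruhat_stepP[a [b [ab lt _]]] _] _.
by move: lt; rewrite !permE /=; have := ltn_ord b; lia.
Qed.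

Lemma intK_inj : injective (fun m : int => m%:~R : K).
Proof. by move=> m n; rewrite -!evC => /ev_inj /polyC_inj. Qed.

(* The dual basis of [C] for [hdot], twisted by [T_x |-> (-1)^l(x) T_(w0 x)], is again bar-invariant. *)
Lemma mu_w0 : forall y w i j, adj i j -> desc w i j -> ~~ desc y i j -> mu (wz y) (wz w) = mu w y.
Proof.
have /fin_all_exists [d hd] := @Tb_KL.
pose D w : hecke := [ffun x => ev (d x w)].
have dual w x : hdot (D w) (C x) = (x == w)%:R.
  have : \sum_y hscale (hdot (D y) (C x)) (C y) = \sum_y hscale (x == y)%:R (C y).
    rewrite [RHS](bigD1 x) //= eqxx hscale1 [X in _ + X]big1 ?addr0; last first.
      by move=> y; rewrite eq_sym => /negbTE ->; rewrite hscale0l.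
    rewrite [RHS]hecke_sum.
    have e t : hscale (C x t) (Tb t) = \sum_y hscale (C x t * ev (d t y)) (C y).
      by have [-> _ _ _] := hd t; rewrite hscale_sumr; apply: eq_bigr => y _; rewrite hscaleA.
    rewrite [RHS](eq_bigr _ (fun t _ => e t)) [RHS]exchange_big; apply: eq_bigr => y _ /=.
    rewrite hdotC /hdot; apply/ffunP => t; rewrite sum_ffunE hscaleE mulr_suml.
    by apply: eq_bigr => u _; rewrite hscaleE ffunE.
  by move/KL_coord_inj => /(_ w).
have hdot_ext a b : (forall x, hdot a (C x) = hdot b (C x)) -> a = b.
  move=> e; apply/ffunP => x; rewrite -!hdot_Tb; have [-> _ _ _] := hd x.
  by rewrite !hdot_linear; apply: eq_bigr => t _; rewrite !hdotZ e.
have D_mul w i j : adj i j -> rhoC i j (D w) = \sum_y hscale (bcoef i j w y) (D y).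
  move=> ij; apply: hdot_ext => x; rewrite hdot_rhoC KL_mul // hdot_linear hdotC hdot_linear.
  rewrite (bigD1 w) //= hdotZ dual eqxx mulr1 big1 ?addr0 => [|y /negbTE yw]; last first.
    by rewrite hdotZ dual yw mulr0.
  rewrite (bigD1 x) //= hdotZ hdotC dual eqxx mulr1 big1 ?addr0 // => y /negbTE yw.
  by rewrite hdotZ hdotC dual eq_sym yw mulr0.
pose sg x y : K := (-1) ^+ odd (len x + len y).
pose E w : hecke := [ffun x => sg (wz x) w * D w (wz x)].
have sgM x y z : sg x y * sg y z = sg x z.
  rewrite /sg !oddD; case: (odd (len x)); case: (odd (len y)); case: (odd (len z));
  by rewrite /= ?expr0 ?expr1 ?mulrNN ?mulr1 ?mul1r.
have sgxx x : sg x x = 1 by rewrite /sg oddD addbb.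
have sgC x y : sg x y * sg x y = 1 by rewrite {2}/sg addnC sgM sgxx.
(* The twist exchanges [u] and [u^-1] on the diagonal and negates the off-diagonal part, so [C'_s]
   turns into [[2] - C'_s]. *)
have E_mul w i j : adj i j ->
    rhoC i j (E w) = hscale two (E w) - \sum_y hscale (bcoef i j w y * sg w y) (E y).
  move=> ij; apply/ffunP => x.
  have := D_mul w i j ij => /ffunP /(_ (wz x)); rewrite rhoCE sum_ffunE => e.
  rewrite rhoCE [RHS]ffunE [in RHS]ffunE [(- _ : hecke) x]ffunE sum_ffunE.
  have -> : \sum_y hscale (bcoef i j w y * sg w y) (E y) x =
      sg (wz x) w * \sum_y hscale (bcoef i j w y) (D y) (wz x).
    rewrite mulr_sumr; apply: eq_bigr => y _; rewrite !hscaleE [E y x]ffunE.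
    rewrite -(sgM (wz x) w y).
    transitivity ((sg w y * sg w y) * (sg (wz x) w * (bcoef i j w y * D y (wz x)))); first by ring.
    by rewrite sgC mul1r.
  rewrite -e !ffunE wz_mul desc_wz //.
  have -> : sg (pmul (wz x) (tperm i j)) w = - sg (wz x) w.
    by rewrite /sg !oddD len_parity // addNb signrN.
  by rewrite /two; case: (desc x i j) => /=; ring.
(* Downward induction on length, from [E w0 = T_1]. If [w' = w s > w], then [E_mul] at [w']
   expresses [E w] by [E w' C'_s] and by terms [E y] with [y] longer than [w']. *)
have Ebar w : hbar (E w) = E w.
  move: {2}(r ^ 2 - len w)%N (erefl (r ^ 2 - len w)%N) => n.
  elim/ltn_ind: n w => n IH w lw; have lb := len_bound w.
  have [/existsP[i /existsP[j /andP[ij nd]]]|] := boolP [exists i, exists j, adj i j && ~~ desc w i j].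
    set w' := pmul w (tperm i j); have d' : desc w' i j by rewrite desc_mul.
    have lw' : len w' = (len w).+1 by apply: len_asc.
    have lb' := len_bound w'.
    have e := E_mul w' i j ij.
    have : E w = rhoC i j (E w') - \sum_(y | ~~ desc y i j && (y != w)) hscale (mu w' y)%:~R (E y).
      rewrite e (bigID (fun y => desc y i j)) /= (bigD1 w') //= big1 ?addr0 => [|y /andP[dy yw']]; last first.
        by rewrite /bcoef dy eq_sym (negbTE yw') !mul0r hscale0l.
      rewrite /bcoef d' eqxx mul1r sgxx mulr1.
      rewrite opprD addrA subrr add0r (bigD1 w) //= (negbTE nd).
      have -> : mu w' w = 1.
        rewrite muE (mu0_desc ij d' nd) eqxx; suff -> : mu0 w' w = 0 by rewrite add0r.
        by apply/eqP/negPn/negP => /mu0_bruhat /bruhat_le_len; rewrite lw' ltnn.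
      have -> : sg w' w = -1 by rewrite /sg lw' addSn /= oddD addbb.
      rewrite opprD !mul1r hscaleN hscale1 opprK -addrA -sumrN -sumrB big1 ?addr0 // => y /andP[ny yw].
      rewrite (negbTE ny); have [->|m] := eqVneq (mu w' y) 0; first by rewrite mulr0z mul0r !hscale0l subr0 oppr0.
      rewrite /sg (mu_par m) expr1 mulrN mulr1 hscaleN opprK subrr //.
    move=> ->; rewrite hbarB hbar_rhoC // (IH (r ^ 2 - len w')%N) //; last by lia.
    rewrite hbar_sum; congr (_ - _); apply: eq_bigr => y /andP[ny yw].
    rewrite hbarZ rmorph_int; have [->|m] := eqVneq (mu w' y) 0; first by rewrite !hscale0l.
    suff ly : (len w' < len y)%N by rewrite (IH (r ^ 2 - len y)%N) //; have := len_bound y; lia.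
    have m0 : mu0 w' y != 0.
      move: m; rewrite muE (mu0_desc ij d' ny) (can2_eq (pmulsK i j) (pmulsK i j)) /w' pmulsK.
      by rewrite (negbTE yw) addr0.
    apply: bruhat_lt_len (mu0_bruhat m0) _; apply/eqP => e'; by rewrite -e' d' in ny.
  rewrite negb_exists => /forallP na; have w1 : wz w = 1%g.
    apply: wz_no_asc => i j ij; have := na i; rewrite negb_exists => /forallP /(_ j).
    by rewrite ij /= negbK.
  have ew : w = w0 by rewrite -[w]wzK w1 /wz /pmul mul1g.
  suff -> : E w = Tb 1%g by rewrite hbar_Tb barT1.
  apply/ffunP => x; rewrite !ffunE; have [->|x1] := eqVneq x 1%g.
    have -> : wz 1%g = w by rewrite -w1 wzK.
    have [_ _ _ ->] := hd w; by rewrite rmorph1 mulr1 sgxx.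
  suff -> : d (wz x) w = 0 by rewrite rmorph0 mulr0.
  apply/eqP/negPn/negP => dx; have [_ _ /(_ _ dx)] := hd (wz x).
  rewrite ew => /w0_max /(congr1 wz); rewrite wzK -ew w1 => e; by rewrite e eqxx in x1.
have EC w : E w = C (wz w).
  symmetry; apply: KLlow_uniq => // x.
  exists ((-1) ^+ odd (len (wz x) + len w) * d (wz x) w); split.
    by rewrite !ffunE rmorphM rmorphXn rmorphN1.
  have [_ d0 _ _] := hd (wz x); have -> : (x == wz w) = (w == wz x) by rewrite [LHS]eq_sym (can2_eq wzK wzK).
  rewrite coef0M d0 eq_sym.
  have [e|] := eqVneq (wz x) w; last by rewrite mulr0.
  by rewrite e oddD addbb expr0 coefC mulr1.
(* Compare the coefficients of [C (wz y)]. When [s] separates [w] and [y], both structure constants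
   are in their [mu] branch, and parity makes the two minus signs cancel. *)
move=> y w i j ij dw ny; have := E_mul w i j ij; rewrite EC KL_mul //.
have -> : hscale two (C (wz w)) - \sum_z hscale (bcoef i j w z * sg w z) (E z) =
    \sum_x hscale ((x == wz w)%:R * two - bcoef i j w (wz x) * sg w (wz x)) (C x).
  under [RHS]eq_bigr do rewrite hscaleDl hscaleN.
  rewrite sumrB; congr (_ - _).
    rewrite (bigD1 (wz w)) //= eqxx mul1r big1 ?addr0 // => x /negbTE ->.
    by rewrite mul0r hscale0l.
  rewrite (reindex_inj (inv_inj wzK)); apply: eq_bigr => x _ /=.
  by rewrite EC wzK.
move/KL_coord_inj => /(_ (wz y)).
rewrite /bcoef !desc_wz // dw (negbTE ny) /= wzK (inj_eq (inv_inj wzK)).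
have [e|_] := eqVneq y w; first by rewrite e dw in ny.
rewrite mul0r sub0r => e; apply: intK_inj; rewrite /= e.
have [->|m] := eqVneq (mu w y) 0; first by rewrite mulr0z mul0r oppr0.
by rewrite /sg (mu_par m) expr1 mulrN mulr1 opprK.
Qed.
End Duality.

(** * Star operations *)

Section Stars.
Variable r : nat.
Local Notation perm_r := (perm_r r).
Local Notation hecke := (hecke r).
Implicit Types (w x y z : perm_r) (i j k l a b c d : 'I_r).
Local Notation C := (@KLlow r).

Definition nbr i j k l := [&& adj i j, adj k l & (j == k) || (l == i)].
Definition star_dom i j k l w := desc w i j && ~~ desc w k l.
(** The star operation of Kazhdan and Lusztig for neighbouring [s = (i j)] and [t = (k l)]: exactly
    one of [w s] and [w t] has [t] and not [s] as a descent. *)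
Definition rstar i j k l w :=
  if desc (pmul w (tperm i j)) k l then pmul w (tperm i j) else pmul w (tperm k l).

Lemma nbr_sym i j k l : nbr i j k l = nbr k l i j.
Proof. by rewrite /nbr andbCA orbC. Qed.

(** Both sides compare the values of [w] at the two outer positions of the three involved. *)
Lemma star_aux i j k l w : nbr i j k l ->
  desc (pmul w (tperm i j)) k l = desc (pmul w (tperm k l)) i j.
Proof.
case/and3P => ij kl /orP[/eqP e|/eqP e]; subst; rewrite /desc !pmulE !tpermL !tpermR.
  have kl' := adj_neq kl; have ki : k != i by rewrite eq_sym adj_neq.
  have li : l != i by move: ij kl; rewrite /adj -val_eqE /=; lia.
  by rewrite !tpermD // eq_sym.
have jk : j != k by move: ij kl; rewrite /adj -val_eqE /=; lia.
have ji : j != i by rewrite eq_sym adj_neq.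
have ik : i != k by rewrite eq_sym adj_neq.
by rewrite !tpermD // eq_sym.
Qed.

Lemma rstar_dom i j k l w : nbr i j k l -> star_dom i j k l w -> star_dom k l i j (rstar i j k l w).
Proof.
move=> nb /andP[d nd]; have /and3P[ij kl _] := nb.
rewrite /star_dom /rstar; case: ifP => e; first by rewrite e desc_mul // d.
by rewrite desc_mul // nd -(star_aux _ nb) e.
Qed.

Lemma rstarK i j k l w : nbr i j k l -> star_dom i j k l w -> rstar k l i j (rstar i j k l w) = w.
Proof.
move=> nb /andP[d nd]; have /and3P[ij kl _] := nb.
rewrite /(rstar i j); case: ifP => e; rewrite /rstar.
  by rewrite -(star_aux _ nb) pmulsK (negbTE nd).
by rewrite pmulsK d.
Qed.

(** When the descents are crossed, [mu] is the sum of the indicators of [x s = w] and [x = w t].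
    Only the product that lies in the opposite domain can occur, and this is the star partner. *)
Lemma mu_rstar i j k l x w : nbr i j k l -> star_dom i j k l w -> star_dom k l i j x ->
  mu x w = (x == rstar i j k l w)%:R.
Proof.
move=> nb /andP[dw nw] /andP[dx nx]; have /and3P[ij kl _] := nb.
rewrite (mu_star_cases ij kl) // (can2_eq (pmulsK i j) (pmulsK i j)) [pmul w _ == x]eq_sym /rstar.
case: ifP => e.
  have -> : x == pmul w (tperm k l) = false; last by rewrite addr0.
  by apply/eqP => xw; rewrite xw -(star_aux _ nb) e in nx.
have -> : x == pmul w (tperm i j) = false; last by rewrite add0r.
by apply/eqP => xw; rewrite xw e in dx.
Qed.

Lemma two_neq0 : two != 0.
Proof.
have -> : two = toK ('X^2 + 1) / uK.
  by rewrite /two (rmorphD toK) rmorph1 /= toKX -uK_X mulrDl expr2 mulfK ?mul1r ?uK_neq0.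
apply: mulf_neq0; last by rewrite invr_eq0 uK_neq0.
rewrite toK_eq0; apply/eqP => /(congr1 (fun p : {poly rat} => p`_0)).
by rewrite coefD coefXn coefC coef0.
Qed.

Definition lcoef i j x w := bcoef i j x^-1%g w^-1%g.

Lemma lcoefE i j x w : lcoef i j x w = if desc w^-1%g i j then (x == w)%:R * two
  else if desc x^-1%g i j then (mu x^-1%g w^-1%g)%:~R else 0.
Proof. by rewrite /lcoef /bcoef (inj_eq invg_inj). Qed.

Lemma bcoef_refl i j w : (bcoef i j w w != 0) = desc w i j.
Proof. by rewrite /bcoef; case: (desc w i j); rewrite eqxx // mul1r two_neq0. Qed.

Lemma bcoef_comm i j a b x w : adj i j -> adj a b ->
  \sum_z bcoef a b z w * lcoef i j x z = \sum_y lcoef i j y w * bcoef a b x y.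
Proof.
move=> ij ab; move: x; apply: KL_coord_inj.
have expand (f : perm_r -> K) (g : perm_r -> perm_r -> K) :
    \sum_x hscale (\sum_z f z * g x z) (C x) = \sum_z hscale (f z) (\sum_x hscale (g x z) (C x)).
  under [RHS]eq_bigr do rewrite hscale_sumr.
  rewrite exchange_big /=; apply: eq_bigr => x _; apply/ffunP => t.
  by rewrite sum_ffunE hscaleE mulr_suml; apply: eq_bigr => z _; rewrite !hscaleE mulrA.
rewrite (expand (fun z => bcoef a b z w) (lcoef i j)) (expand (fun y => lcoef i j y w) (bcoef a b)).
transitivity (lamC i j (rhoC a b (C w))).
  rewrite KL_mul // (hlinear_sum _ _ (lamC_linear i j)); apply: eq_bigr => z _.
  by rewrite (proj2 (lamC_linear i j)) KL_mull.
rewrite lamC_rhoC // KL_mull // (hlinear_sum _ _ (rhoC_linear a b)); apply: eq_bigr => z _.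
by rewrite (proj2 (rhoC_linear a b)) KL_mul.
Qed.

(** Compare the coefficients of [C'_x] in [C'_s C'_w C'_t], computed in the two orders. If [s] is a
    left descent of [w] but not of [x], one is [[2]] times the structure constant and the other is
    zero. *)
Lemma ldesc_mono i j a b x w : adj i j -> adj a b ->
  bcoef a b x w != 0 -> desc w^-1%g i j -> desc x^-1%g i j.
Proof.
move=> ij ab bx dw; apply/negPn/negP => nx; case/eqP: bx.
have := bcoef_comm x w ij ab; rewrite (bigD1 w) //= big1 ?addr0 => [|z zw]; last first.
  rewrite lcoefE (negbTE nx); case: ifP => dz; last by rewrite mulr0.
  have [e|_] := eqVneq x z; first by rewrite e dz in nx.
  by rewrite mul0r mulr0.
have -> : lcoef i j x w = 0.
  rewrite lcoefE dw; have [e|_] := eqVneq x w; first by rewrite e dw in nx.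
  by rewrite mul0r.
rewrite mulr0 (bigD1 w) //= big1 ?addr0 => [|z zw]; last first.
  by rewrite lcoefE dw (negbTE zw) !mul0r.
rewrite lcoefE dw eqxx mul1r => /eqP; rewrite eq_sym mulf_eq0 (negbTE two_neq0).
by move/eqP.
Qed.

Definition lstar i j k l w := (rstar i j k l w^-1%g)^-1%g.

(* Left and right multiplications commute: compare the coefficients of [C (lstar x)] in [C'_s C'_w C'_t]. *)
Lemma lstar_bcoef i j k l a b x w : nbr i j k l -> adj a b ->
  star_dom i j k l w^-1%g -> star_dom i j k l x^-1%g ->
  bcoef a b (lstar i j k l x) (lstar i j k l w) = bcoef a b x w.
Proof.
move=> nb ab dw dx; have /and3P[ij kl _] := nb.
have /andP[dw1 nw1] := dw; have /andP[dx1 nx1] := dx.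
have := rstar_dom nb dx; set X := rstar i j k l x^-1%g => /andP[dX nX].
have lX : lstar i j k l x = X^-1%g by [].
have := bcoef_comm (lstar i j k l x) w kl ab.
rewrite (bigD1 x) //= big1 ?addr0 => [|z zx]; last first.
  have [->|bz] := eqVneq (bcoef a b z w) 0; first by rewrite mul0r.
  have dz := ldesc_mono ij ab bz dw1.
  rewrite lcoefE lX invgK; case: ifP => dz'.
    have [e|_] := eqVneq X^-1%g z; last by rewrite mul0r mulr0.
    by rewrite -e invgK (negbTE nX) in dz.
  rewrite dX (mu_rstar nb) ?/star_dom ?dz ?dz' ?dX ?nX //.
  have [e|_] := eqVneq X _; last by rewrite mulr0z mulr0.
  have ddz : star_dom i j k l z^-1%g by rewrite /star_dom dz dz'.
  have : x^-1%g = z^-1%g by rewrite -(rstarK nb dx) -/X e rstarK.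
  by move/invg_inj => e'; rewrite e' eqxx in zx.
have -> : lcoef k l (lstar i j k l x) x = 1.
  rewrite lcoefE lX invgK (negbTE nx1) dX (mu_rstar nb) ?eqxx //.
  by rewrite /star_dom dX nX.
rewrite mulr1 => ->; rewrite (bigD1 (lstar i j k l w)) //= big1 ?addr0 => [|y yw]; last first.
  rewrite lcoefE (negbTE nw1); case: ifP => dy; last by rewrite mul0r.
  have [->|bz] := eqVneq (bcoef a b (lstar i j k l x) y) 0; first by rewrite mulr0.
  have [dy'|ny] := boolP (desc y^-1%g i j).
    by have := ldesc_mono ij ab bz dy'; rewrite lX invgK (negbTE nX).
  rewrite (mu_rstar nb) ?/star_dom ?dy //.
  by rewrite (can2_eq (@invgK _) (@invgK _)) (negbTE yw) mulr0z mul0r.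
have /andP[dW nW] := rstar_dom nb dw.
rewrite lcoefE /lstar invgK (negbTE nw1) dW (mu_rstar nb) ?eqxx ?mul1r //.
by rewrite /star_dom dW nW.
Qed.

Lemma lstar_desc i j k l a b w : nbr i j k l -> adj a b -> star_dom i j k l w^-1%g ->
  desc (lstar i j k l w) a b = desc w a b.
Proof. by move=> nb ab dw; rewrite -!bcoef_refl lstar_bcoef. Qed.

(** Generates the right Kazhdan-Lusztig preorder; its strongly connected components are the right
    cells. *)
Definition redge w x := [exists a, exists b, adj a b && (bcoef a b x w != 0)].

Lemma redgeP w x : reflect (exists a b, adj a b /\ bcoef a b x w != 0) (redge w x).
Proof.
apply: (iffP existsP) => [[a /existsP[b /andP[ab e]]]|[a [b [ab e]]]]; first by exists a, b.
by exists a; apply/existsP; exists b; rewrite ab.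
Qed.

Lemma bcoef_rstar i j k l w : nbr i j k l -> star_dom i j k l w ->
  bcoef k l (rstar i j k l w) w != 0.
Proof.
move=> nb dw; have /andP[d nd] := dw; have dr := rstar_dom nb dw; have /andP[d' _] := dr.
by rewrite /bcoef (negbTE nd) d' (mu_rstar nb) // eqxx oner_eq0.
Qed.

Lemma redge_rstar i j k l w : nbr i j k l -> star_dom i j k l w ->
  redge w (rstar i j k l w) /\ redge (rstar i j k l w) w.
Proof.
move=> nb dw; have /and3P[ij kl _] := nb; split.
  by apply/redgeP; exists k, l; rewrite bcoef_rstar.
apply/redgeP; exists i, j; split=> //; rewrite -{1}(rstarK nb dw).
by apply: bcoef_rstar; rewrite 1?nbr_sym // rstar_dom.
Qed.

Lemma redge_ldesc i j w x : adj i j -> redge w x -> desc w^-1%g i j -> desc x^-1%g i j.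
Proof. by move=> ij /redgeP[a [b [ab e]]]; apply: ldesc_mono ij ab e. Qed.

Lemma rstar_ldesc i j k l a b w : nbr i j k l -> star_dom i j k l w -> adj a b ->
  desc (rstar i j k l w)^-1%g a b = desc w^-1%g a b.
Proof.
move=> nb dw ab; have [e1 e2] := redge_rstar nb dw.
by apply/idP/idP; apply: redge_ldesc.
Qed.

(** [lstar] preserves the nonzero structure constant from [w] to [rstar w], and between opposite
    star domains a nonzero constant singles out the star partner. *)
Lemma star_comm i j k l a b c d w : nbr i j k l -> star_dom i j k l w ->
  nbr a b c d -> star_dom a b c d w^-1%g ->
  lstar a b c d (rstar i j k l w) = rstar i j k l (lstar a b c d w).
Proof.
move=> nb dw nb' dw'; have /and3P[ij kl _] := nb; have /and3P[ab cd _] := nb'.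
have drw' : star_dom a b c d (rstar i j k l w)^-1%g by rewrite /star_dom !rstar_ldesc.
have := bcoef_rstar nb dw; rewrite -(lstar_bcoef nb' kl dw' drw').
have dlw : star_dom i j k l (lstar a b c d w) by rewrite /star_dom !lstar_desc.
have dlr : star_dom k l i j (lstar a b c d (rstar i j k l w)).
  by rewrite /star_dom !lstar_desc //; apply: rstar_dom.
have /andP[_ nd] := dlw; have /andP[d' _] := dlr.
rewrite /bcoef (negbTE nd) d' (mu_rstar nb) //.
by have [//|_] := eqVneq (lstar a b c d _) _; rewrite mulr0z eqxx.
Qed.

Definition rstep w x := [exists i, exists j, exists k, exists l,
  [&& nbr i j k l, star_dom i j k l w & x == rstar i j k l w]].

Lemma rstepP w x : reflect
  (exists i j k l, [/\ nbr i j k l, star_dom i j k l w & x = rstar i j k l w]) (rstep w x).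
Proof.
apply: (iffP existsP) => [[i /existsP[j /existsP[k /existsP[l /and3P[nb d /eqP ->]]]]]|].
  by exists i, j, k, l.
case=> i [j [k [l [nb d ->]]]]; exists i; apply/existsP; exists j; apply/existsP; exists k.
by apply/existsP; exists l; rewrite nb d eqxx.
Qed.

Lemma rstep_sym w x : rstep w x = rstep x w.
Proof.
suff imp w' x' : rstep w' x' -> rstep x' w' by apply/idP/idP; apply: imp.
case/rstepP => i [j [k [l [nb d ->]]]]; apply/rstepP; exists k, l, i, j.
by rewrite nbr_sym rstarK //; split=> //; apply: rstar_dom.
Qed.

End Stars.

(** * Knuth equivalence *)

Section Words.
Local Open Scope nat_scope.
Implicit Types (row t u : seq nat) (T : seq (seq nat)) (x y z h n : nat).

Definition ins T x := (tinsert T x).1.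
Definition insw := foldl ins.

(** A whole word passes through a single row; the second component is the word of bumped letters,
    which enters the next row. Knuth invariance is thereby reduced to one row. *)
Fixpoint brow row u : seq nat * seq nat :=
  match u with
  | [::] => (row, [::])
  | x :: u' => let (r, b) := bumprow row x in let (r', o) := brow r u' in
               (r', if b is Some y then y :: o else o)
  end.

Lemma bump_cons h t x : bumprow (h :: t) x =
  if x < h then (x :: t, Some h) else (h :: (bumprow t x).1, (bumprow t x).2).
Proof. by rewrite /=; case: ifP => // _; case: (bumprow t x). Qed.

Lemma insw_cons row T u : insw (row :: T) u = (brow row u).1 :: insw T (brow row u).2.
Proof.
elim: u row T => //= x u IH row T; rewrite /ins /=.
case: (bumprow row x) => r [y|] /=; last by rewrite IH; case: (brow r u).
case ety : (tinsert T y) => [T' i] /=; rewrite IH; case eb: (brow r u) => [r' o] /=.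
by rewrite /ins ety.
Qed.

Lemma bump_some t x t' y : bumprow t x = (t', Some y) -> x < y /\ y \in t.
Proof.
elim: t t' => //= h t IH t'; case: ifP => [xh [_ <-]|_]; first by rewrite mem_head.
case: (bumprow t x) IH => r b IH [_ eb]; subst; have [xy yt] := IH _ erefl.
by rewrite inE yt orbT.
Qed.

Lemma bump_sorted t x : sorted leq t -> sorted leq (bumprow t x).1 /\
  forall h, h <= x -> path leq h t -> path leq h (bumprow t x).1.
Proof.
elim: t => [|h t IH] s; first by split=> //= h ->.
rewrite bump_cons; case: ltnP => xh /=.
  have xt : path leq x t by apply: path_le s => //; [exact: leq_trans | exact: ltnW].
  by split=> // h' h'x /andP[_ _]; rewrite h'x.
have [st pt] := IH (path_sorted s).
by split=> [|h' _ /andP[-> ht]]; exact: pt.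
Qed.

Lemma bump_perm t x : perm_eq (x :: t) ((bumprow t x).1 ++ (if (bumprow t x).2 is Some y then [:: y] else [::])).
Proof.
elim: t => // h t IH; rewrite bump_cons; case: ifP => _ /=.
  by rewrite perm_cons -cat1s perm_catC.
apply: perm_trans (_ : perm_eq _ (h :: x :: t)) _; first by rewrite -(cat1s x) -(cat1s h) perm_catCA.
by rewrite perm_cons.
Qed.

(** Together with [bump_ge] this is the row bumping lemma for two successive insertions. *)
Lemma bump_lt t x y : sorted leq t -> y < x ->
  exists t2 y', [/\ bumprow (bumprow t x).1 y = (t2, Some y'), y < y' & y' <= x].
Proof.
move=> + yx; elim: t => [|h t IH] s; first by rewrite /= yx; exists [:: y], x.
rewrite bump_cons; case: ltnP => xh /=; first by rewrite yx; exists (y :: t), x.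
case: ifP => yh; first by exists (y :: (bumprow t x).1), h.
have [t2 [y' [-> yy' y'x]]] := IH (path_sorted s).
by exists (h :: t2), y'.
Qed.

Lemma bump_ge t x y : sorted leq t -> x <= y ->
  match (bumprow t x).2, (bumprow (bumprow t x).1 y).2 with
  | None, None => True
  | None, Some _ => False
  | Some _, None => True
  | Some x', Some y' => is_true (x' <= y')
  end.
Proof.
move=> + xy; elim: t => [|h t IH] s; first by rewrite /= ltnNge xy.
rewrite bump_cons; case: ltnP => xh /=.
  rewrite ltnNge xy /=; case e: (bumprow t y) => [r [y'|]] //=.
  by have [_ /(allP (order_path_min leq_trans s))] := bump_some e.
rewrite ltnNge (leq_trans xh xy) /=; move: (IH (path_sorted s)).
by case: (bumprow t x) => r [x'|] /=; case: (bumprow r y) => r' [y'|].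
Qed.

Lemma brow_ge h t u : all (leq h) u -> brow (h :: t) u = (h :: (brow t u).1, (brow t u).2).
Proof.
elim: u t => //= x u IH t /andP[hx hu]; rewrite ltnNge hx /=.
by case: (bumprow t x) => r b; rewrite IH //; case: (brow r u).
Qed.

Inductive k3 : seq nat -> seq nat -> Prop :=
| K3a x y z : x <= y -> y < z -> k3 [:: x; z; y] [:: z; x; y]
| K3b x y z : x < y -> y <= z -> k3 [:: y; x; z] [:: y; z; x].

Lemma brow_k3_nil u1 u2 : k3 u1 u2 -> brow [::] u1 = brow [::] u2.
Proof.
case=> x y z xy yz.
  have xz : x < z by apply: leq_ltn_trans yz.
  have zx : (z < x) = false by lia.
  have yx : (y < x) = false by lia.
  by do 5 rewrite /= ?xz ?zx ?yx ?yz.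
have xz : x < z by apply: leq_trans yz.
have zx : (z < x) = false by lia.
have zy : (z < y) = false by lia.
by do 5 rewrite /= ?xz ?zx ?xy ?zy.
Qed.

(** The bumped words are related again, so the argument can pass to the next row. The relation may
    change direction, and it can become an equality when a letter stays in the row. *)
Lemma brow_k3 row u1 u2 : sorted leq row -> k3 u1 u2 ->
  (brow row u1).1 = (brow row u2).1 /\
  [\/ (brow row u1).2 = (brow row u2).2, k3 (brow row u1).2 (brow row u2).2 |
      k3 (brow row u2).2 (brow row u1).2].
Proof.
elim: row => [|h t IH] s ku; first by rewrite (brow_k3_nil ku); split=> //; constructor 1.
have st := path_sorted s; have hle := allP (order_path_min leq_trans s).
have hle' x y t' : bumprow t x = (t', Some y) -> h <= y by case/bump_some => _ /hle.
have {}IH := IH st ku.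
case: ku IH => x y z xy yz IH.
- have xz : x < z by apply: leq_ltn_trans yz.
  have [hx|xh] := leqP h x.
    have [a1 a2] : all (leq h) [:: x; z; y] /\ all (leq h) [:: z; x; y] by rewrite /=; lia.
    rewrite (brow_ge t a1) (brow_ge t a2); case: IH => e1 e2.
    by split; [congr (_ :: _) | exact: e2].
  have zx : (z < x) = false by lia.
  have yx : (y < x) = false by lia.
  have [zh|hz] := ltnP z h.
    case: t s st hle hle' IH => [|h2 t] s st hle hle' IH.
      by do 5 rewrite /= ?xh ?zh ?xz ?zx ?yx ?yz; split=> //; constructor 1.
    have hh2 : h <= h2 by apply: hle; rewrite mem_head.
    have zh2 : z < h2 by apply: leq_trans hh2.
    have yh2 := ltn_trans yz zh2.
    do 6 rewrite /= ?xh ?zh ?xz ?zx ?yx ?yz ?zh2 ?yh2.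
    by split=> //; constructor 3; constructor.
  have zh : (z < h) = false by lia.
  rewrite /= xh /= zx zh.
  have := bump_lt st yz; case ez: (bumprow t z) (hle' z) => [t1 bz] hle'' /= [t2 [y' [ey yy' y'z]]].
  do 3 rewrite /= ?xh ?yx ?ey.
  split=> //; case: bz ez hle'' => [z'|] ez hle''; last by constructor 1.
  constructor 2; constructor; last by apply: leq_ltn_trans y'z _; case: (bump_some ez).
  have : y' \in z :: t.
    have [_ y't1] := bump_some ey.
    by rewrite (perm_mem (bump_perm t z)) ez mem_cat y't1.
  by rewrite inE => /orP[/eqP -> //|/hle].
have [hx|xh] := leqP h x.
  have [a1 a2] : all (leq h) [:: y; x; z] /\ all (leq h) [:: y; z; x] by rewrite /=; lia.
    rewrite (brow_ge t a1) (brow_ge t a2); case: IH => e1 e2.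
    by split; [congr (_ :: _) | exact: e2].
have xz : x < z by apply: leq_trans yz.
have zx : (z < x) = false by lia.
have zy : (z < y) = false by lia.
have [yh|hy] := ltnP y h.
  do 3 rewrite /= ?yh ?xy ?zx ?zy.
  case ez: (bumprow t z) (hle' z) => [t1 bz] hle''; rewrite /= xy /=.
  split=> //; case: bz ez hle'' => [z'|] ez hle''; last by constructor 1.
  by constructor 2; constructor => //; apply: hle'' erefl.
have yh : (y < h) = false by lia.
have zh : (z < h) = false by lia.
rewrite /= yh; have := bump_ge st yz; case ey: (bumprow t y) (hle' y) => [t1 bY] hle'' /=.
rewrite xh /= zx zh.
case ez: (bumprow t1 z) => [t2 bz] /=; rewrite xh /=.
case: bY ey hle'' => [y'|] ey hle'' /=; case: bz ez => [z'|] ez //= le; split=> //; try by constructor 1.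
constructor 2; constructor => //; apply: leq_ltn_trans hy _.
by case: (bump_some ey).
Qed.

Lemma ins_sorted T x : all (sorted leq) T -> all (sorted leq) (ins T x).
Proof.
elim: T x => //= row T IH x /andP[srow sT]; rewrite /ins /=.
have [s _] := bump_sorted x srow; case: (bumprow row x) s => r [y|] /= s; last by rewrite s.
by case e: (tinsert T y) => [T' i] /=; rewrite s; have := IH y sT; rewrite /ins e.
Qed.

Lemma insw_sorted T u : all (sorted leq) T -> all (sorted leq) (insw T u).
Proof. by elim: u T => //= x u IH T sT; apply/IH/ins_sorted. Qed.

Lemma insw_k3 T u1 u2 : all (sorted leq) T -> k3 u1 u2 -> insw T u1 = insw T u2.
Proof.
elim: T u1 u2 => [|row T IH] u1 u2 /=.
  move=> _ ku; have [-> ->] : insw [::] u1 = insw [:: [::]] u1 /\ insw [::] u2 = insw [:: [::]] u2.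
    by case: ku.
  by rewrite !insw_cons (brow_k3_nil ku).
case/andP => srow sT ku; have [e1 e2] := brow_k3 srow ku.
rewrite !insw_cons e1; congr (_ :: _).
by case: e2 => [-> //|/IH -> //|/IH ->].
Qed.

Inductive kn : seq nat -> seq nat -> Prop :=
| kn_step t1 t2 u1 u2 : k3 u1 u2 -> kn (t1 ++ u1 ++ t2) (t1 ++ u2 ++ t2)
| kn_refl u : kn u u
| kn_sym u1 u2 : kn u1 u2 -> kn u2 u1
| kn_trans u1 u2 u3 : kn u1 u2 -> kn u2 u3 -> kn u1 u3.

Lemma kn_insw u1 u2 : kn u1 u2 -> insw [::] u1 = insw [::] u2.
Proof.
elim=> // [t1 t2 v1 v2 kv|v1 v2 v3 _ -> _ -> //].
by rewrite /insw !foldl_cat -!/insw (@insw_k3 _ v1 v2) //; apply: insw_sorted.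
Qed.

Lemma kn_cat t1 t2 u1 u2 : kn u1 u2 -> kn (t1 ++ u1 ++ t2) (t1 ++ u2 ++ t2).
Proof.
elim=> [s1 s2 v1 v2 kv|v|v1 v2 _ k|v1 v2 v3 _ k _ k'].
- by rewrite !catA -!(catA (t1 ++ s1)) -!catA !(catA t1); apply: kn_step.
- exact: kn_refl.
- exact: kn_sym.
- exact: kn_trans k k'.
Qed.

Definition rowread T := flatten (rev T).

Lemma rowread_cons row T : rowread (row :: T) = rowread T ++ row.
Proof. by rewrite /rowread rev_cons -cats1 flatten_cat /= cats0. Qed.

Lemma path_last_leq h t : path leq h t -> h <= last h t.
Proof. by elim: t h => //= a t IH h /andP[ha /IH]; apply: leq_trans. Qed.

Lemma kn_row_start h t x : path leq h t -> x < h -> kn (h :: t ++ [:: x]) [:: h, x & t].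
Proof.
elim/last_ind: t => [|t y IH] /=; first by move=> *; apply: kn_refl.
rewrite rcons_path => /andP[pt ly] xh.
have xl : x < last h t by apply: leq_trans xh (path_last_leq pt).
rewrite -cats1 -!catA /=.
apply: kn_trans (_ : kn _ (h :: t ++ [:: x; y])) _.
  have -> : h :: t ++ [:: y; x] = belast h t ++ [:: last h t; y; x] ++ [::].
    by rewrite cats0 -cat1s catA cat1s lastI -cats1 -catA.
  have -> : h :: t ++ [:: x; y] = belast h t ++ [:: last h t; x; y] ++ [::].
    by rewrite cats0 -cat1s catA cat1s lastI -cats1 -catA.
  apply: kn_sym; apply: kn_step; constructor => //.
have := kn_cat [::] [:: y] (IH pt xh); rewrite /= -!catA /=.
by [].
Qed.

(** By induction from the left: the letter bumped out of the tail passes the head by one elementary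
    relation, with the new first letter of the tail as its intermediate value. *)
Lemma kn_bump row x : sorted leq row ->
  kn (row ++ [:: x]) ((if (bumprow row x).2 is Some y then [:: y] else [::]) ++ (bumprow row x).1).
Proof.
elim: row => [|h t IH] s; first exact: kn_refl.
rewrite bump_cons; case: ltnP => xh /=; first exact: kn_row_start.
have := kn_cat [:: h] [::] (IH (path_sorted s)); rewrite !cats0 /=.
have [st /(_ h xh s) pt] := bump_sorted x (path_sorted s).
have := bump_perm t x; case e: (bumprow t x) st pt => [t' [y|]] //= st pt pe kt.
have [xy yt] := bump_some e.
have xt' : x \in t'.
  have : x \in x :: t by rewrite mem_head.
  by rewrite (perm_mem pe) mem_cat inE => /orP[//|/eqP xy']; rewrite xy' ltnn in xy.
case: t' st pt xt' {pe e} kt => [|t0 t'] //= st /andP[ht0 _] xt' kt.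
apply: kn_trans kt _; apply: (@kn_step [::] t' [:: h; y; t0] [:: y; h; t0]); apply: K3a => //.
apply: leq_ltn_trans xy; move: xt'; rewrite inE => /orP[/eqP -> //|].
by apply: (allP (order_path_min leq_trans st)).
Qed.

Lemma kn_ins T x : all (sorted leq) T -> kn (rowread T ++ [:: x]) (rowread (ins T x)).
Proof.
elim: T x => [|row T IH] x /=; first by move=> _; apply: kn_refl.
case/andP => srow sT; rewrite rowread_cons -catA.
have := kn_cat (rowread T) [::] (kn_bump x srow); rewrite !cats0 => k.
apply: kn_trans k _; rewrite /ins /=; case: (bumprow row x) => r [y|] /=; last first.
  by rewrite rowread_cons; apply: kn_refl.
have := kn_cat [::] r (IH y sT); rewrite /= -!catA /ins.
by case: (tinsert T y) => T' i /=; rewrite rowread_cons.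
Qed.

Lemma kn_rowread u : kn u (rowread (insw [::] u)).
Proof.
elim/last_ind: u => [|u x IH]; first exact: kn_refl.
rewrite /insw -cats1 foldl_cat -/insw /=.
have sT : all (sorted leq) (insw [::] u) by apply: insw_sorted.
apply: kn_trans (kn_ins x sT).
by have := kn_cat [::] [:: x] IH.
Qed.

Lemma insw_kn u1 u2 : insw [::] u1 = insw [::] u2 -> kn u1 u2.
Proof.
move=> e; apply: kn_trans (kn_rowread u1) _; rewrite e.
exact: kn_sym (kn_rowread u2).
Qed.

Lemma kn_perm u1 u2 : kn u1 u2 -> perm_eq u1 u2.
Proof.
elim=> // [t1 t2 v1 v2 kv|v1 v2 _|v1 v2 v3 _ k _ k']; last exact: perm_trans k k'.
  rewrite perm_cat2l perm_cat2r; case: kv => x y z _ _; first exact: (permEl (perm_catCA [:: x] [:: z] [:: y])).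
  by rewrite perm_cons; exact: (permEl (perm_catC [:: x] [:: z])).
by rewrite perm_sym.
Qed.
End Words.

(** * Cells added by row insertion *)

Section Tableaux.
Local Open Scope nat_scope.
Implicit Types (row t u v : seq nat) (T U : seq (seq nat)) (x y z h n i j c : nat).

Definition rsz T i := size (nth [::] T i).

Lemma tinsert_cons row T x : tinsert (row :: T) x =
  if (bumprow row x).2 is Some y then ((bumprow row x).1 :: ins T y, (tinsert T y).2.+1)
  else ((bumprow row x).1 :: T, 0).
Proof. by rewrite /= /ins; case: (bumprow row x) => r [y|] //=; case: (tinsert T y). Qed.

Lemma tinsert_le T x y : all (sorted leq) T -> x <= y -> (tinsert (ins T x) y).2 <= (tinsert T x).2.
Proof.
elim: T x y => [|row T IH] x y /=; first by move=> _ xy; rewrite /ins /= ltnNge xy.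
case/andP => sr sT xy; rewrite /ins -/(tinsert (row :: T) x) tinsert_cons.
have := bump_ge sr xy; case: (bumprow row x) => r [x'|] /=.
  rewrite -/(tinsert (r :: ins T x') y) tinsert_cons.
  by case: (bumprow r y) => r' [y'|] //= x'y'; rewrite ltnS; apply: IH.
by rewrite -/(tinsert (r :: T) y) tinsert_cons; case: (bumprow r y) => r' [y'|].
Qed.

Lemma tinsert_gt T x y : all (sorted leq) T -> y < x -> (tinsert T x).2 < (tinsert (ins T x) y).2.
Proof.
elim: T x y => [|row T IH] x y /=; first by move=> _ xy; rewrite /ins /= xy.
case/andP => sr sT yx; rewrite /ins -/(tinsert (row :: T) x) tinsert_cons.
have [t2 [y' [e _ y'x]]] := bump_lt sr yx; have := @bump_some row x.
case: (bumprow row x) e => r [x'|] /= e bs; last first.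
  by rewrite -/(tinsert (r :: T) y) tinsert_cons e.
rewrite -/(tinsert (r :: ins T x') y) tinsert_cons e /= ltnS; apply: IH => //.
by have [xx' _] := bs _ _ erefl; apply: leq_ltn_trans xx'.
Qed.

Lemma size_bump row x : size (bumprow row x).1 = size row + ((bumprow row x).2 == None).
Proof.
have /perm_size := bump_perm row x; rewrite size_cat /=.
by case: (bumprow row x).2 => [y|] /=; rewrite ?addn1 ?addn0 // => -[].
Qed.

Lemma rsz_ins T x k : rsz (ins T x) k = rsz T k + (k == (tinsert T x).2).
Proof.
rewrite /rsz /ins; elim: T x k => [|row T IH] x [|k]; rewrite ?nth_nil //=; first by case: k.
  by rewrite -/(tinsert (row :: T) x) tinsert_cons; have := size_bump row x;
     case: (bumprow row x) => r [y|].
rewrite -/(tinsert (row :: T) x) tinsert_cons; case: (bumprow row x).2 => [y|] /=; last by rewrite addn0.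
exact: IH.
Qed.

Fixpoint row_dom (r1 r2 : seq nat) :=
  match r1, r2 with
  | _, [::] => true
  | [::], _ => false
  | a :: r1', b :: r2' => (a < b) && row_dom r1' r2'
  end.

Definition is_tab T := [&& all (sorted leq) T, sorted row_dom T & all (fun row => row != [::]) T].

Lemma dom_nil r : row_dom r [::]. Proof. by case: r. Qed.

Lemma dom_nth r1 r2 c : row_dom r1 r2 -> c < size r2 -> c < size r1 /\ nth 0 r1 c < nth 0 r2 c.
Proof.
elim: r1 r2 c => [|a r1 IH] [|b r2] [|c] //= /andP[ab d]; rewrite ltnS => lt; first by rewrite ab.
exact: IH.
Qed.

Lemma dom_size r1 r2 : row_dom r1 r2 -> size r2 <= size r1.
Proof. by elim: r1 r2 => [|a r1 IH] [|b r2] //= /andP[_ /IH]. Qed.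

Lemma dom_bump_le r1 r2 x : row_dom r1 r2 -> row_dom (bumprow r1 x).1 r2.
Proof.
elim: r1 r2 => [|a r1 IH] [|b r2] //; rewrite ?dom_nil //= => /andP[ab d].
rewrite -/(bumprow (a :: r1) x) bump_cons; case: ifP => [xa|_] /=; first by rewrite (ltn_trans xa ab).
by rewrite ab IH.
Qed.

(** The bumped letter comes to rest weakly to the left of the place it left, hence below an entry at
    most [x], which is smaller than [y]. *)
Lemma dom_bump r1 r2 x y : sorted leq r1 -> row_dom r1 r2 -> (bumprow r1 x).2 = Some y ->
  row_dom (bumprow r1 x).1 (bumprow r2 y).1.
Proof.
elim: r1 r2 => [|a r1 IH] r2 s //; rewrite bump_cons; case: ltnP => [xa|ax] /=.
  move=> d [<-]; case: r2 d => [|b r2] /=; first by rewrite xa dom_nil.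
  by case/andP => ab d; rewrite ab /= xa.
move=> d e; have ay : a < y.
  by case eb : (bumprow r1 x) e => [r b] /= e; subst; apply: leq_ltn_trans ax _; case: (bump_some eb).
case: r2 d => [|b r2] /=; first by rewrite ay dom_nil.
case/andP => ab d; rewrite -/(bumprow (b :: r2) y) bump_cons; case: ifP => yb /=.
  by rewrite ay dom_bump_le.
by rewrite ab IH // (path_sorted s).
Qed.

Lemma ins_tab T x : is_tab T -> is_tab (ins T x).
Proof.
case/and3P => sT dT nT; apply/and3P; split; first exact: ins_sorted.
  elim: T x sT dT {nT} => [|row T IH] x //= /andP[sr sT] dT.
  rewrite /ins -/(tinsert (row :: T) x) tinsert_cons.
  case e : (bumprow row x).2 => [y|] /=; last by case: T dT {sT IH} => //= t T /andP[/dom_bump_le -> ].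
  have := IH y sT (path_sorted dT); case: T sT dT {IH} => [|t T] /=.
    by move=> _ _ _; rewrite /ins /= andbT; apply: (dom_bump (r2 := [::])); rewrite ?dom_nil.
  move=> /andP[st sT] /andP[d dT]; rewrite /ins -/(tinsert (t :: T) y) tinsert_cons.
  have dd := dom_bump sr d e.
  by case: (bumprow t y).2 => [y'|] /= ->; rewrite dd.
elim: T x nT {sT dT} => [|row T IH] x //= /andP[nr nT].
rewrite /ins -/(tinsert (row :: T) x) tinsert_cons.
have nb : (bumprow row x).1 != [::] by rewrite -size_eq0 size_bump; case: row nr.
by case: (bumprow row x).2 => [y|] /=; rewrite nb // -/(ins T y) IH.
Qed.

Lemma insw_tab u : is_tab (insw [::] u).
Proof.
elim/last_ind: u => // u x IH; rewrite /insw -cats1 foldl_cat /= -/insw.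
exact: ins_tab.
Qed.

Lemma insw_rcons T u x : insw T (rcons u x) = ins (insw T u) x.
Proof. by rewrite /insw -cats1 foldl_cat. Qed.

Lemma rsz_mono T i j : is_tab T -> i <= j -> rsz T j <= rsz T i.
Proof.
case/and3P => _ dT _ /subnK <-; elim: (j - i) => // k IH; apply: leq_trans IH.
rewrite addSn; set m := k + i; have [lt|le] := ltnP m.+1 (size T).
  by apply: dom_size; apply: (sortedP [::] dT).
by rewrite /rsz nth_default.
Qed.

(** The result of the insertion is again a tableau, so its row lengths weakly decrease and the new
    cell is a corner. *)
Lemma added_cell_corner T x p c : is_tab T -> p <= (tinsert T x).2 -> c <= rsz T (tinsert T x).2 ->
  (p, c) != ((tinsert T x).2, rsz T (tinsert T x).2) -> c < rsz T p.
Proof.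
set i := (tinsert T x).2 => tT pi ci ne; have [epi|npi] := eqVneq p i.
  by move: ne ci; rewrite epi xpair_eqE eqxx /= ltn_neqAle => -> ->.
have := rsz_mono (ins_tab x tT) pi; rewrite !rsz_ins -/i eqxx (negbTE npi); lia.
Qed.

(** The recording tableau in list form: at index [k], the row and column of the cell added by the
    letter number [k]. *)
Fixpoint cellsT T u : seq (nat * nat) :=
  if u is x :: u' then ((tinsert T x).2, rsz T (tinsert T x).2) :: cellsT (ins T x) u' else [::].
Definition cells := cellsT [::].

Lemma cellsT_cat T u v : cellsT T (u ++ v) = cellsT T u ++ cellsT (insw T u) v.
Proof. by elim: u T => //= x u IH T; rewrite IH. Qed.

Lemma cells_rcons u x : cells (rcons u x) =
  rcons (cells u) ((tinsert (insw [::] u) x).2, rsz (insw [::] u) (tinsert (insw [::] u) x).2).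
Proof. by rewrite /cells -cats1 cellsT_cat /= cats1. Qed.

Lemma size_cellsT T u : size (cellsT T u) = size u.
Proof. by elim: u T => //= x u IH T; rewrite IH. Qed.

Lemma mem_cells u i c : ((i, c) \in cells u) = (c < rsz (insw [::] u) i).
Proof.
elim/last_ind: u => [|u x IH]; first by rewrite /rsz nth_nil.
rewrite cells_rcons mem_rcons inE IH insw_rcons rsz_ins xpair_eqE.
case: eqP => [<-|_] /=; last by rewrite addn0.
by rewrite addn1 ltnS [RHS]leq_eqVlt.
Qed.

Lemma cells_uniq u : uniq (cells u).
Proof.
elim/last_ind: u => // u x IH; rewrite cells_rcons rcons_uniq IH andbT mem_cells.
by rewrite ltnn.
Qed.

Lemma cells_perm u v : insw [::] u = insw [::] v -> perm_eq (cells u) (cells v).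
Proof.
by move=> e; apply: uniq_perm; rewrite ?cells_uniq // => -[i c]; rewrite !mem_cells e.
Qed.

Lemma cellsT_asc T x y : is_tab T -> x <= y ->
  rsz T (tinsert T x).2 < rsz (ins T x) (tinsert (ins T x) y).2.
Proof.
move=> tT xy; have /and3P[sT _ _] := tT; have le := tinsert_le sT xy.
by apply: leq_trans (rsz_mono (ins_tab x tT) le); rewrite rsz_ins eqxx addn1.
Qed.

Lemma cellsT_desc T x y : is_tab T -> y < x ->
  rsz (ins T x) (tinsert (ins T x) y).2 <= rsz T (tinsert T x).2.
Proof.
move=> tT xy; have /and3P[sT _ _] := tT; have lt := tinsert_gt sT xy.
have := rsz_mono (ins_tab y (ins_tab x tT)) (ltnW lt).
rewrite [rsz (ins (ins T x) y) (tinsert (ins T x) y).2]rsz_ins eqxx.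
by rewrite [rsz (ins (ins T x) y) _]rsz_ins (ltn_eqF lt) [rsz (ins T x) (tinsert T x).2]rsz_ins eqxx; lia.
Qed.

Lemma cells_asc u x y v : x < y -> let k := size u in let cs := cells (u ++ [:: x, y & v]) in
  (nth (0, 0) cs k).2 < (nth (0, 0) cs k.+1).2 /\ (nth (0, 0) cs k.+1).1 <= (nth (0, 0) cs k).1.
Proof.
move=> xy k cs; have tT := insw_tab u; have /and3P[sT _ _] := tT.
have lts : (k.+1 < k) = false by rewrite ltnNge leqnSn.
rewrite /cs /cells cellsT_cat !nth_cat size_cellsT -/k ltnn subnn lts subSnn /=.
by split; [apply: cellsT_asc | apply: tinsert_le]; rewrite // ltnW.
Qed.

Lemma cells_desc u x y v : y < x -> let k := size u in let cs := cells (u ++ [:: x, y & v]) in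
  (nth (0, 0) cs k).1 < (nth (0, 0) cs k.+1).1 /\ (nth (0, 0) cs k.+1).2 <= (nth (0, 0) cs k).2.
Proof.
move=> xy k cs; have tT := insw_tab u; have /and3P[sT _ _] := tT.
have lts : (k.+1 < k) = false by rewrite ltnNge leqnSn.
rewrite /cs /cells cellsT_cat !nth_cat size_cellsT -/k ltnn subnn lts subSnn /=.
by split; [apply: tinsert_gt | apply: cellsT_desc].
Qed.

(** A new cell has above it exactly the earlier cells of its column. So the sequence of columns
    alone determines all cells. *)
Lemma cell_row u x (i := (tinsert (insw [::] u) x).2) :
  i = count_mem (rsz (insw [::] u) i) (map snd (cells u)).
Proof.
set T := insw [::] u; set c := rsz T i; have tT : is_tab T by apply: insw_tab.
rewrite count_map -size_filter -(size_iota 0 i) -(size_map (fun p => (p, c))).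
apply/perm_size/uniq_perm.
- by rewrite map_inj_uniq ?iota_uniq // => p p' [].
- by rewrite filter_uniq // cells_uniq.
move=> [p d]; rewrite mem_filter mem_cells -/T /=; apply/mapP/andP.
  case=> p'; rewrite mem_iota /= add0n => lt [-> ->]; split=> //.
  apply: (added_cell_corner tT (ltnW lt) (leqnn _)).
  by rewrite xpair_eqE negb_and (ltn_eqF lt).
case=> /eqP -> lt; exists p => //; rewrite mem_iota /= add0n ltnNge; apply/negP => le.
by have := rsz_mono tT le; rewrite leqNgt lt.
Qed.

Lemma cells_snd_inj u v : size u = size v -> map snd (cells u) = map snd (cells v) -> cells u = cells v.
Proof.
elim/last_ind: u v => [|u x IH] v; first by move=> /esym/size0nil ->.
case/lastP: v => [|v y]; rewrite !size_rcons // => -[suv].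
rewrite !cells_rcons !map_rcons => /eqP; rewrite eqseq_rcons => /andP[/eqP e /eqP ec].
rewrite (IH _ suv e); congr rcons; rewrite /= in ec.
by rewrite ec; congr (_, _); rewrite cell_row (cell_row v) ec e.
Qed.

Lemma bump_inj t s x y : sorted leq t -> sorted leq s -> bumprow t x = bumprow s y -> t = s /\ x = y.
Proof.
elim: t s => [|a t IH] [|b s] st ss.
- by case.
- rewrite bump_cons; case: ifP => //= _; case: (bumprow s y) (size_bump s y) => r o /= sz [_ er eo].
  by move: sz; rewrite -er -eo /= addn1.
- rewrite bump_cons; case: ifP => //= _; case: (bumprow t x) (size_bump t x) => r o /= sz [_ er eo].
  by move: sz; rewrite er eo /= addn1.
rewrite !bump_cons.
have aux (a' b' x' y' : nat) t' s' : path leq a' t' -> x' < a' -> b' <= y' ->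
    (x' :: t', Some a') <> (b' :: (bumprow s' y').1, (bumprow s' y').2).
  move=> pt xa bY; case e: (bumprow s' y') => [r o] [_ et eo]; subst.
  have [ya _] := bump_some e; have : y' \in y' :: s' by rewrite mem_head.
  rewrite (perm_mem (bump_perm s' y')) e mem_cat inE => /orP[yr|/eqP ey]; last by rewrite ey ltnn in ya.
  by have := allP (order_path_min leq_trans pt) _ yr; rewrite leqNgt ya.
case: ltnP => xa; case: ltnP => yb.
- by case=> -> -> ->.
- by move/aux => /(_ st xa yb).
- by move/esym/aux => /(_ ss yb xa).
case=> -> et eo; have [|-> ->//] := IH s (path_sorted st) (path_sorted ss).
by rewrite [LHS]surjective_pairing et eo -surjective_pairing.
Qed.

(** Insertion can be reversed once the row of the added cell is known: it tells how many bumps to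
    undo. *)
Lemma tinsert_inj T U x y : is_tab T -> is_tab U -> tinsert T x = tinsert U y -> T = U /\ x = y.
Proof.
move=> /and3P[sT _ nT] /and3P[sU _ nU].
elim: T U x y sT nT sU nU => [|t T IH] [|s U] x y //.
- by move=> _ _ _ _ [].
- move=> _ _ /= /andP[ss sU] /andP[ns nU].
  rewrite -/(tinsert (s :: U) y) tinsert_cons.
  have := size_bump s y; case: (bumprow s y) => r [o|] //= sz [er _].
  by move: sz; rewrite -er /= addn1; case: s ns {ss}.
- move=> /= /andP[ss sU] /andP[ns nU] _ _.
  rewrite -/(tinsert (t :: T) x) tinsert_cons.
  have := size_bump t x; case: (bumprow t x) => r [o|] //= sz [er _].
  by move: sz; rewrite er /= addn1; case: t ns {ss}.
move=> /= /andP[st sT] /andP[_ nT] /andP[ss sU] /andP[_ nU].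
rewrite -/(tinsert (t :: T) x) -/(tinsert (s :: U) y) !tinsert_cons.
have := @bump_inj t s x y st ss; case: (bumprow t x) => r [o|]; case: (bumprow s y) => r' [o'|] //= inj.
  case=> er eT ei; have [|eTU eo] := IH U o o' sT nT sU nU.
    by rewrite [LHS]surjective_pairing [RHS]surjective_pairing ei -/(ins T o) eT.
  by rewrite er eo in inj; have [-> ->] := inj erefl; rewrite eTU.
by case=> er ->; rewrite er in inj; have [-> ->] := inj erefl.
Qed.

Lemma cells_insw_inj u v : insw [::] u = insw [::] v -> cells u = cells v -> u = v.
Proof.
elim/last_ind: u v => [|u x IH] v e ec.
  by have := size_cellsT [::] v; rewrite -/cells -ec => /esym/size0nil ->.
case/lastP: v e ec => [|v y]; first by move=> _; rewrite cells_rcons; case: (cells u).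
rewrite !insw_rcons !cells_rcons => e /eqP; rewrite eqseq_rcons => /andP[/eqP ec /eqP [ei _]].
have [|eT ->] := @tinsert_inj (insw [::] u) (insw [::] v) x y (insw_tab u) (insw_tab v).
  by rewrite [LHS]surjective_pairing [RHS]surjective_pairing ei -/(ins _ _) e.
by rewrite (IH v).
Qed.
End Tableaux.

(** * Counting cells by runs, and the transpose under complementation *)

Section Runs.
Local Open Scope nat_scope.
Implicit Types (row t u v : seq nat) (T U runs : seq (seq nat)) (x y z h n i j c : nat).

Lemma cells_run_cols T u : is_tab T -> sorted ltn u -> sorted ltn (map snd (cellsT T u)).
Proof.
elim: u T => // x [//|y u] IH T tT /= /andP[xy su].
by rewrite (cellsT_asc tT (ltnW xy)) /=; apply: (IH (ins T x)) => //; apply: ins_tab.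
Qed.

Lemma cells_run_rows T u : is_tab T -> sorted gtn u -> sorted ltn (map fst (cellsT T u)).
Proof.
elim: u T => // x [//|y u] IH T tT /= /andP[xy su]; have /and3P[sT _ _] := tT.
by rewrite (tinsert_gt sT xy) /=; apply: (IH (ins T x)) => //; apply: ins_tab.
Qed.

Lemma count_lt_sorted t j : sorted ltn t -> count (fun c => c < j) t <= minn j (size t).
Proof.
move=> st; rewrite leq_min count_size andbT -size_filter -{2}(size_iota 0 j).
apply: uniq_leq_size; first by rewrite filter_uniq // (sorted_uniq ltn_trans ltnn).
by move=> c; rewrite mem_filter mem_iota => /andP[].
Qed.

(** The easy half of a theorem of Greene: the cells of one run have distinct values of [f]. Taking
    [f] to be the column serves increasing runs, taking it to be the row serves decreasing ones. *)
Lemma runs_bound (f : nat * nat -> nat) runs j T : is_tab T ->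
  (forall T run, is_tab T -> run \in runs -> sorted ltn (map f (cellsT T run))) ->
  count (fun p => f p < j) (cellsT T (flatten runs)) <= \sum_(run <- runs) minn j (size run).
Proof.
elim: runs T => [|run runs IH] T tT hf; first by rewrite big_nil.
rewrite /= cellsT_cat count_cat big_cons leq_add //.
  have := @count_lt_sorted _ j (hf T run tT (mem_head _ _)).
  by rewrite count_map size_map size_cellsT.
apply: IH; last by move=> T' r tT' hr; apply: hf => //; rewrite inE hr orbT.
by elim: run {hf} T tT => //= x run IHr T tT; apply/IHr/ins_tab.
Qed.

Definition colsz T c := count (fun row => c < size row) T.

Lemma is_tab_tail row T : is_tab (row :: T) -> is_tab T.
Proof.
case/and3P => /= /andP[_ sT] dT /andP[_ nT]; apply/and3P; split=> //.
exact: path_sorted dT.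
Qed.

Lemma lt_colsz T i c : is_tab T -> (i < colsz T c) = (c < rsz T i).
Proof.
elim: T i => [|row T IH] i tT; first by rewrite /rsz nth_nil.
have tT' := is_tab_tail tT; rewrite /colsz /= -/(colsz T c).
have [lt|le] := ltnP c (size row); first by case: i => [|i]; rewrite /= add1n // ltnS IH.
rewrite add0n; have -> : c < rsz (row :: T) i = false.
  by apply/negbTE; rewrite -leqNgt; apply: leq_trans (rsz_mono tT (leq0n i)) le.
by rewrite IH //; apply/negbTE; rewrite -leqNgt; apply: leq_trans (rsz_mono tT (leq0n i.+1)) le.
Qed.

Lemma count_lt_iota j n : count (fun c => c < j) (iota 0 n) = minn j n.
Proof.
elim: n => [|n IH]; first by rewrite minn0.
by rewrite -addn1 iotaD count_cat IH /= add0n addn0; lia.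
Qed.

Lemma count_cols u j :
  count (fun p => p.2 < j) (cells u) = \sum_(row <- insw [::] u) minn j (size row).
Proof.
set T := insw [::] u.
have /seq.permP -> : perm_eq (cells u) [seq (i, c) | i <- iota 0 (size T), c <- iota 0 (rsz T i)].
  apply: uniq_perm; first exact: cells_uniq.
    by apply: allpairs_uniq_dep => [|i _|[i c] [i' c'] _ _ [-> ->]]; rewrite ?iota_uniq.
  move=> [i c]; rewrite mem_cells -/T; apply/idP/allpairsPdep => [lt|[i' [c' [_ + [-> ->]]]]]; last first.
    by rewrite mem_iota.
  exists i, c; rewrite !mem_iota /= !add0n lt; split=> //.
  by rewrite ltnNge; apply: contraTN lt => le; rewrite /rsz nth_default.
rewrite count_flatten -map_comp sumnE big_map (big_nth [::]) /index_iota subn0.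
by apply: eq_bigr => i _ /=; rewrite count_map -count_lt_iota.
Qed.

Lemma count_rows u j n : size (head [::] (insw [::] u)) <= n ->
  count (fun p => p.1 < j) (cells u) = \sum_(c <- iota 0 n) minn j (colsz (insw [::] u) c).
Proof.
set T := insw [::] u => le_n; have tT : is_tab T by apply: insw_tab.
have /seq.permP -> : perm_eq (cells u) [seq (i, c) | c <- iota 0 n, i <- iota 0 (colsz T c)].
  apply: uniq_perm; first exact: cells_uniq.
    by apply: allpairs_uniq_dep => [|i _|[i c] [i' c'] _ _ [-> ->]]; rewrite ?iota_uniq.
  move=> [i c]; rewrite mem_cells -/T -lt_colsz //.
  apply/idP/allpairsPdep => [lt|[c' [i' [_ + [-> ->]]]]]; last by rewrite mem_iota.
  exists c, i; rewrite !mem_iota /= !add0n lt; split=> //; apply: leq_trans le_n.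
  by rewrite lt_colsz // in lt; apply: leq_trans lt _; have := rsz_mono tT (leq0n i); rewrite {2}/rsz nth0.
rewrite count_flatten -map_comp sumnE big_map.
by apply: eq_bigr => c _ /=; rewrite count_map -count_lt_iota.
Qed.

Definition colT T c := rev [seq nth 0 row c | row <- T & c < size row].
Definition colread n T := flatten [seq colT T c | c <- iota 0 n].

Lemma size_colT T c : size (colT T c) = colsz T c.
Proof. by rewrite size_rev size_map size_filter. Qed.

Lemma colT_cons row T c : is_tab (row :: T) ->
  colT (row :: T) c = if c < size row then rcons (colT T c) (nth 0 row c) else [::].
Proof.
move=> tT; rewrite /colT /=; case: ltnP => [_|le]; first by rewrite /= rev_cons.
apply/size0nil; rewrite -/(colT T c) size_colT; apply/eqP; rewrite -leqn0 leqNgt.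
rewrite lt_colsz ?(is_tab_tail tT) // -leqNgt.
exact: leq_trans (rsz_mono tT (leq0n 1)) le.
Qed.

Lemma colT_sorted T c : is_tab T -> sorted gtn (colT T c).
Proof.
elim: T => // row T IH tT; rewrite colT_cons //; case: ifP => // lt.
have := IH (is_tab_tail tT); case: T {IH} tT => //= row' T tT.
rewrite colT_cons ?(is_tab_tail tT) //; case: ifP => // lt' s.
have : nth 0 row c < nth 0 row' c.
  have /and3P[_ /= /andP[d _] _] := tT.
  by have [] := dom_nth d lt'.
rewrite -2!cats1 -catA /=; case: (colT T c) s => [|a s] /=; first by rewrite andbT.
by rewrite cat_path rcons_path /= => /andP[-> ->] /= ->.
Qed.

Lemma bump_append row x : all (leq^~ x) row -> bumprow row x = (rcons row x, None).
Proof. by elim: row => //= a row IH /andP[ax /IH ->]; rewrite ltnNge ax. Qed.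

Lemma bump_last row x y : all (leq^~ y) row -> y < x -> bumprow (rcons row x) y = (rcons row y, Some x).
Proof.
move=> + yx; elim: row => /= [_|a row IH /andP[ay /IH ->]]; first by rewrite yx.
by rewrite ltnNge ay.
Qed.

Lemma brow_rcons_dec row x t : path gtn x t -> all (leq^~ (last x t)) row ->
  brow (rcons row x) t = (rcons row (last x t), belast x t).
Proof.
elim: t x => //= y t IH x /andP[yx pt] ar; rewrite bump_last // ?IH //.
have ly : last y t <= y.
  by elim: t y {IH ar yx} pt => //= a t IH y /andP[ay /IH]; move/leq_trans; apply; apply: ltnW.
by apply: sub_all ar => a /leq_trans; apply.
Qed.

Lemma brow_dec row t a : sorted gtn (rcons t a) -> all (leq^~ a) row ->
  brow row (rcons t a) = (rcons row a, t).
Proof.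
case: t => [|x t] /= st ar; first by rewrite bump_append.
have := brow_rcons_dec st; rewrite last_rcons belast_rcons => /(_ row ar) e.
have ax : a <= x.
  move: st; rewrite (path_sortedE (rev_trans ltn_trans)) => /andP[/allP /(_ a)].
  by rewrite mem_rcons mem_head => /(_ isT) /ltnW.
rewrite bump_append ?e //.
by apply: sub_all ar => b /leq_trans; apply.
Qed.

Lemma brow_cat row u v : brow row (u ++ v) =
  ((brow (brow row u).1 v).1, (brow row u).2 ++ (brow (brow row u).1 v).2).
Proof.
elim: u row => /= [|x u IH] row; first by case: (brow row v).
case: (bumprow row x) => r [y|]; rewrite IH; case: (brow r u) => r' o //=.
Qed.

(** In a column read from bottom to top each letter bumps its predecessor; only the top entry stays,
    and the bumped letters form the column of the remaining tableau. *)
Lemma brow_colread n row T : is_tab (row :: T) ->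
  brow [::] (colread n (row :: T)) = (take n row, colread n T).
Proof.
move=> tT; elim: n => [|n IH]; first by rewrite take0.
have split_last U : colread n.+1 U = colread n U ++ colT U n.
  by rewrite /colread -addn1 iotaD map_cat flatten_cat /= add0n cats0.
rewrite !split_last brow_cat IH /= colT_cons //; case: ltnP => [lt|le].
  have := colT_sorted n tT; rewrite colT_cons // lt => s.
  rewrite brow_dec //; first by rewrite -take_nth.
  have /and3P[/= /andP[sr _] _ _] := tT.
  apply/(all_nthP 0) => i; rewrite size_takel ?(ltnW lt) // => li.
  by rewrite nth_take //; apply: (sorted_leq_nth leq_trans leqnn 0 sr); rewrite ?inE // ?(ltn_trans li) // ltnW.
have -> : colT T n = [::].
  by apply/size0nil; have := size_colT (row :: T) n; rewrite colT_cons // ltnNge le /=;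
     rewrite size_colT /colsz /= ltnNge le.
by rewrite /= !take_oversize ?(leq_trans le).
Qed.

Lemma insw_colread n T : is_tab T -> size (head [::] T) <= n -> insw [::] (colread n T) = T.
Proof.
elim: T n => [|row T IH] n tT /= le.
  have -> : colread n [::] = [::]; last by [].
  by rewrite /colread; elim: (iota 0 n).
have n0 : colread n (row :: T) != [::].
  have /and3P[_ _ /= /andP[nr _]] := tT; case: n le => [|n le]; first by rewrite leqn0 size_eq0 (negbTE nr).
  rewrite /colread /= colT_cons // lt0n size_eq0 nr -size_eq0 size_cat size_rcons //.
have -> : insw [::] (colread n (row :: T)) = insw [:: [::]] (colread n (row :: T)).
  by case: (colread n (row :: T)) n0.
rewrite insw_cons brow_colread //= take_oversize // IH //; first exact: is_tab_tail tT.
by apply: leq_trans le; have := rsz_mono tT (leq0n 1); rewrite /rsz /= nth0.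
Qed.

Definition compl_word n u := [seq n - x | x <- u].

(** Reversing the order exchanges the two elementary relations. Weak and strict inequalities trade
    places, hence distinct letters; the bound [n] keeps truncated subtraction faithful. *)
Lemma kn_comp n u v : kn u v -> uniq u -> all (leq^~ n) u -> kn (compl_word n u) (compl_word n v).
Proof.
elim=> [t1 t2 u1 u2 ku|w|u1 u2 k IH|u1 u2 u3 k IH k' IH'] uu au.
- rewrite /compl_word !map_cat; move: uu au; rewrite !cat_uniq !all_cat => /and3P[_ _ /andP[uu _]] /and3P[_ au _].
  case: ku uu au => x y z xy yz /=; rewrite !inE => uu au.
    apply: kn_sym; apply: (@kn_step _ _ [:: n - z; n - x; n - y] [:: n - x; n - z; n - y]).
    by constructor; lia.
  apply: kn_sym; apply: (@kn_step _ _ [:: n - y; n - z; n - x] [:: n - y; n - x; n - z]).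
  by constructor; lia.
- exact: kn_refl.
- have p := kn_perm k; apply/kn_sym/IH; first by rewrite (perm_uniq p).
  by rewrite (perm_all _ p).
have p := kn_perm k; apply: kn_trans (IH uu au) (IH' _ _).
  by rewrite -(perm_uniq p).
by rewrite -(perm_all _ p).
Qed.

Lemma insw_perm u : perm_eq u (rowread (insw [::] u)).
Proof. exact/kn_perm/kn_rowread. Qed.

(** Replace [u] by its row reading word: complementing turns the rows into decreasing runs, whose
    cells lie in distinct rows. *)
Lemma comp_rows_bound n u j : uniq u -> all (leq^~ n) u ->
  count (fun p => p.1 < j) (cells (compl_word n u)) <= count (fun p => p.2 < j) (cells u).
Proof.
move=> uu au; set T := insw [::] u.
have /cells_perm /seq.permP -> : insw [::] (compl_word n u) = insw [::] (compl_word n (rowread T)).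
  by apply/kn_insw/kn_comp => //; apply: kn_rowread.
have -> : compl_word n (rowread T) = flatten [seq compl_word n row | row <- rev T].
  by rewrite /compl_word /rowread map_flatten.
rewrite count_cols -/T.
apply: leq_trans (runs_bound (f := fst) j (insw_tab [::]) _) _.
  move=> T' _ tT' /mapP[row rT ->]; apply: cells_run_rows => //.
  rewrite mem_rev in rT; have /and3P[/allP /(_ _ rT) sr _ _] := insw_tab u.
  have [ur ar] : uniq row /\ all (leq^~ n) row.
    have sub : {subset row <= u}.
      move=> x xr; rewrite (perm_mem (insw_perm u)); apply/flattenP; exists row => //.
      by rewrite mem_rev.
    split; last by apply/allP => x /sub; apply: (allP au).
    have : uniq (rowread T) by rewrite -(perm_uniq (insw_perm u)).
    rewrite /rowread; move: rT; rewrite -/T -mem_rev; elim: (rev T) => //= r rs IH.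
    by rewrite inE cat_uniq => /orP[/eqP -> /andP[]|/IH {}IH /and3P[_ _]].
  have : sorted ltn row by rewrite ltn_sorted_uniq_leq ur sr.
  elim: row ar {rT sr ur} => //= a [//|b row] IH /= /and3P[an bn ar] /andP[ab s].
  by apply/andP; split; [exact: ltn_sub2l (leq_trans ab bn) ab | apply: IH => //=; rewrite bn ar].
rewrite big_map (perm_big T) ?perm_rev //=.
by apply: leq_sum => row _; rewrite size_map.
Qed.

(** The companion bound through the column reading word, whose decreasing columns become increasing
    runs. *)
Lemma comp_cols_bound n u j : uniq u -> all (leq^~ n) u ->
  count (fun p => p.2 < j) (cells (compl_word n u)) <= count (fun p => p.1 < j) (cells u).
Proof.
move=> uu au; set T := insw [::] u; have tT : is_tab T := insw_tab u.
set m := size (head [::] T).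
have eT : insw [::] (colread m T) = T by apply: insw_colread.
have k : kn u (colread m T) by apply: insw_kn; rewrite eT.
have p := kn_perm k.
have /cells_perm /seq.permP -> : insw [::] (compl_word n u) = insw [::] (compl_word n (colread m T)).
  by apply/kn_insw/kn_comp.
have -> : compl_word n (colread m T) = flatten [seq compl_word n (colT T c) | c <- iota 0 m].
  by rewrite /compl_word /colread map_flatten -map_comp.
rewrite (@count_rows u j m) //.
apply: leq_trans (runs_bound (f := snd) j (insw_tab [::]) _) _.
  move=> T' _ tT' /mapP[c ci ->]; apply: cells_run_cols => //.
  have ac : all (leq^~ n) (colT T c).
    apply/allP => x xc; apply: (allP au); rewrite (perm_mem p); apply/flattenP.
    by exists (colT T c) => //; apply: map_f.
  elim: (colT T c) ac (colT_sorted c tT) => //= a [//|b s] IH /= /and3P[an bn ar] /andP[ab st].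
  by apply/andP; split; [exact: ltn_sub2l (leq_trans ab an) ab | apply: IH => //=; rewrite bn].
by rewrite big_map; apply: leq_sum => c _; rewrite size_map size_colT.
Qed.

(* By induction on prefixes only the last cell is at stake. Row counts on one side are bounded by column
   counts on the other, first through [rowread] and then through [colread], and this pins it down. *)
Lemma cells_comp n u : uniq u -> all (leq^~ n) u ->
  cells (compl_word n u) = [seq (p.2, p.1) | p <- cells u].
Proof.
elim/last_ind: u => // u x IH uu au.
have {}IH : cells (compl_word n u) = [seq (p.2, p.1) | p <- cells u].
  apply: IH; first by move: uu; rewrite rcons_uniq => /andP[].
  by move: au; rewrite all_rcons => /andP[].
have br j := comp_rows_bound j uu au; have bc j := comp_cols_bound j uu au.
move: br bc; rewrite /compl_word map_rcons -/(compl_word n u) !cells_rcons map_rcons IH.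
set T := insw [::] u; set T' := insw [::] (compl_word n u).
set i := (tinsert T x).2; set p := (tinsert T' (n - x)).2.
set c := rsz T i; set d := rsz T' p => br bc; congr rcons.
(* The prefixes contribute equally to both counts by induction. With [j = p + 1] the last cell of
   the complemented word is counted, so that of [u] must be counted too. *)
have cp : c <= p.
  have := br p.+1; rewrite -!cats1 !count_cat count_map /= ltnSn.
  by rewrite leq_add2l; case: (ltnP c p.+1).
have id : i <= d.
  have := bc d.+1; rewrite -!cats1 !count_cat count_map /= ltnSn.
  by rewrite leq_add2l; case: (ltnP i d.+1).
have [->//|ne] := eqVneq (p, d) (c, i).
have := @added_cell_corner T' (n - x) c i (insw_tab _) cp id; rewrite eq_sym => /(_ ne).
rewrite -mem_cells -/(compl_word n u) IH => /mapP[[a b] ab [e1 e2]]; rewrite /= in e1 e2; subst a b.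
by move: ab; rewrite mem_cells -/T -/c ltnn.
Qed.
Lemma sorted_ltn_iota t : sorted ltn t ->
  (forall j : nat, count (fun c => c < j) t = minn j (size t)) -> t = iota 0 (size t).
Proof.
move=> ss h; apply: (irr_sorted_eq ltn_trans ltnn ss (iota_ltn_sorted _ _)) => m.
rewrite mem_iota add0n; have := h m.+1; have := h m.
have -> : count (fun c => c < m.+1) t = count (fun c => c < m) t + (m \in t).
  have us : uniq t by rewrite (sorted_uniq ltn_trans ltnn).
  rewrite -(count_uniq_mem m us) -count_predUI -[LHS]addn0; congr (_ + _).
    by apply: eq_count => c /=; rewrite ltnS leq_eqVlt orbC.
  symmetry; apply/eqP; rewrite -leqn0 leqNgt -has_count; apply/hasPn => c _ /=.
  by rewrite andbC; case: eqP => // ->; rewrite ltnn.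
by move=> ->; case: (m \in t); clear; lia.
Qed.

(** Equality in [runs_bound] for all [j] forces equality for each run, and strictly increasing
    columns with these counts are [0, 1, 2, ...]. *)
Lemma canonical_cols runs T : is_tab T -> (forall run, run \in runs -> sorted ltn run) ->
  (forall j : nat, count (fun p => p.2 < j) (cellsT T (flatten runs)) = \sum_(run <- runs) minn j (size run)) ->
  map snd (cellsT T (flatten runs)) = flatten [seq iota 0 n | n <- map size runs].
Proof.
elim: runs T => // run runs IH T tT sr h; rewrite /= cellsT_cat map_cat.
have tT' : is_tab (insw T run) by elim: run T tT {h sr IH} => //= x s IHs T tT; apply/IHs/ins_tab.
have s1 : sorted ltn (map snd (cellsT T run)) by apply: cells_run_cols; rewrite // sr ?mem_head.
have sr' run' : run' \in runs -> sorted ltn run' by move=> h'; apply: sr; rewrite inE h' orbT.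
have hj (j : nat) : count (fun c => c < j) (map snd (cellsT T run)) = minn j (size run) /\
    count (fun p => p.2 < j) (cellsT (insw T run) (flatten runs)) = \sum_(run <- runs) minn j (size run).
  have := h j; rewrite /= cellsT_cat count_cat big_cons.
  have := count_lt_sorted j s1; rewrite size_map size_cellsT count_map.
  have : count (fun p => p.2 < j) (cellsT (insw T run) (flatten runs)) <= \sum_(run <- runs) minn j (size run).
    by apply: runs_bound => // T' run' tT'' /sr' s'; apply: cells_run_cols.
  set a := count _ _; set b := count _ _; set m := minn _ _; set n := \sum_(_ <- _) _.
  by rewrite /preim /= -/b; clear; lia.
congr (_ ++ _); last by apply: IH => // j; case: (hj j).
rewrite (sorted_ltn_iota s1) => [|j]; rewrite size_map size_cellsT //.
by case: (hj j).
Qed.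

(** Cut [u] at the same places: ascents inside a run of the model word are ascents of [u]. *)
Lemma runs_transfer runs u : size u = size (flatten runs) -> (forall run, run \in runs -> sorted ltn run) ->
  (forall k : nat, k.+1 < size u -> nth 0 (flatten runs) k < nth 0 (flatten runs) k.+1 -> nth 0 u k < nth 0 u k.+1) ->
  exists runs', [/\ u = flatten runs', map size runs' = map size runs & forall run, run \in runs' -> sorted ltn run].
Proof.
elim: runs u => [|run runs IH] u; first by move=> /size0nil -> _ _; exists [::].
rewrite /= size_cat => su sr asc.
have [||k lt|runs' [e1 e2 e3]] := IH (drop (size run) u).
- by rewrite size_drop su addKn.
- by move=> run' h; apply: sr; rewrite inE h orbT.
- rewrite !nth_drop addnS; move: lt; rewrite size_drop => lt h.
  apply: asc; first by move: lt; clear; lia.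
  have nc m : nth 0 (run ++ flatten runs) (size run + m) = nth 0 (flatten runs) m.
    by rewrite nth_cat ltnNge leq_addr addKn.
  by rewrite -addnS !nc.
exists (take (size run) u :: runs'); split.
- by rewrite /= -e1 cat_take_drop.
- by rewrite /= e2 size_takel // su leq_addr.
move=> run'; rewrite inE => /orP[/eqP ->|/e3 //].
apply/(sortedP 0) => k; rewrite size_takel ?su ?leq_addr // => lt.
have ltk := ltn_trans (ltnSn k) lt; rewrite (nth_take _ lt) (nth_take _ ltk); apply: asc.
  by rewrite su; apply: leq_trans lt (leq_addr _ _).
have := sr run (mem_head _ _) => /(sortedP 0) /(_ k lt).
by rewrite !nth_cat lt ltk.
Qed.
End Runs.

(** * Schensted's symmetry *)

Section Symmetry.
Local Open Scope nat_scope.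
Implicit Types (p q u v : seq nat) (P Q : seq (seq nat)) (X A B O : seq (nat * nat)) (x y z n i t : nat).

Definition rskstep (S : seq (seq nat) * seq (seq nat)) (a : nat * nat) :=
  (ins S.1 a.2, addbox S.2 (tinsert S.1 a.2).2 a.1).
Definition rskl := foldl rskstep.
Definition recQ X := (rskl ([::], [::]) X).2.

Lemma rsk_auxE u k S : rsk_aux u k S = rskl S (zip (iota k (size u)) u).
Proof.
elim: u k S => //= x u IH k S; rewrite -IH /rskstep /ins /=.
by case: (tinsert S.1 x).
Qed.

Lemma rskl_fst S X : (rskl S X).1 = insw S.1 (map snd X).
Proof. by elim: X S => //= a X IH S; rewrite IH. Qed.

(** The first rows of [P] and [Q], with the biword of bumped letters and the times of their bumping.
    That biword feeds the remaining rows, so the correspondence runs row by row. *)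
Fixpoint lrow p q X : seq nat * seq nat * seq (nat * nat) :=
  match X with
  | [::] => (p, q, [::])
  | a :: X' => if (bumprow p a.2).2 is Some y
     then let S := lrow (bumprow p a.2).1 q X' in (S.1, (a.1, y) :: S.2)
     else lrow (bumprow p a.2).1 (rcons q a.1) X'
  end.

Lemma rskl_cons p q P Q X : rskl (p :: P, q :: Q) X =
  let S := lrow p q X in let S' := rskl (P, Q) S.2 in (S.1.1 :: S'.1, S.1.2 :: S'.2).
Proof.
elim: X p q P Q => [|a X IH] p q P Q //; rewrite /rskl /= -/rskl.
rewrite /rskstep /= /ins -/(tinsert (p :: P) a.2) tinsert_cons.
case: (bumprow p a.2).2 => [y|] /=; last by rewrite IH.
have -> : addbox (q :: Q) (tinsert P y).2.+1 a.1 = q :: addbox Q (tinsert P y).2 a.1.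
  by rewrite /addbox /= ltnS; case: ifP.
by rewrite IH.
Qed.

Lemma recQ_cons a X : recQ (a :: X) =
  (lrow [::] [::] (a :: X)).1.2 :: recQ (lrow [::] [::] (a :: X)).2.
Proof.
rewrite /recQ; have -> : rskl ([::], [::]) (a :: X) = rskl ([:: [::]], [:: [::]]) (a :: X) by [].
by rewrite rskl_cons.
Qed.

Lemma lrow_cat p q A B : lrow p q (A ++ B) =
  let S := lrow p q A in let S' := lrow S.1.1 S.1.2 B in (S'.1, S.2 ++ S'.2).
Proof.
elim: A p q => [|a A IH] p q /=; first by case: (lrow p q B).
by case: (bumprow p a.2).2 => [y|]; rewrite IH.
Qed.

Lemma lrow_q p q X : lrow p q X = let S := lrow p [::] X in (S.1.1, q ++ S.1.2, S.2).
Proof.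
elim: X p q => [|a X IH] p q /=; first by rewrite cats0.
case: (bumprow p a.2).2 => [y|]; first by rewrite IH.
by rewrite IH [in RHS]IH /= -cats1 -catA.
Qed.

Lemma lrow_q_cat p q q' X : lrow p (q ++ q') X =
  let S := lrow p q' X in (S.1.1, q ++ S.1.2, S.2).
Proof. by rewrite lrow_q [lrow p q' X]lrow_q /= catA. Qed.

Lemma lrow_subseq p X : subseq (map fst (lrow p [::] X).2) (map fst X) /\
  subseq (lrow p [::] X).1.2 (map fst X).
Proof.
elim: X p => [|a X IH] p //; have [s1 s2] := IH (bumprow p a.2).1.
cbn [lrow]; case: (bumprow p a.2).2 => [y|].
  split; first by rewrite /= eqxx.
  exact: subseq_trans s2 (subseq_cons _ a.1).
rewrite lrow_q; split; last by rewrite /= eqxx.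
exact: subseq_trans s1 (subseq_cons _ a.1).
Qed.

Lemma size_lrow p X : size (lrow p [::] X).1.2 + size (lrow p [::] X).2 = size X.
Proof.
elim: X p => //= a X IH p; case: (bumprow p a.2).2 => [y|] /=.
  by rewrite addnS IH.
by rewrite lrow_q /= addSn IH.
Qed.

Lemma lrow_letters n p X : all (fun y => y < n) p -> all (fun y => y < n) (map snd X) ->
  all (fun y => y < n) (lrow p [::] X).1.1 /\ all (fun y => y < n) (map snd (lrow p [::] X).2).
Proof.
elim: X p => //= a X IH p pn /andP[an Xn].
have : all (fun y => y < n) (a.2 :: p) by rewrite /= an.
rewrite (perm_all _ (bump_perm p a.2)) all_cat; case: (bumprow p a.2).2 => [y|] /= /andP[bn yn].
  by rewrite andbT in yn; have [h1 h2] := IH _ bn Xn; rewrite yn.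
by rewrite lrow_q /=; apply: IH.
Qed.

Lemma bump_rcons_some p x y n : (bumprow p x).2 = Some y ->
  bumprow (rcons p n) x = (rcons (bumprow p x).1 n, Some y).
Proof.
elim: p => // a p IH; rewrite rcons_cons !bump_cons; case: ifP => _ /=; first by case=> ->.
by move=> /IH ->.
Qed.

Lemma bump_rcons_none p x n : (bumprow p x).2 = None -> x < n ->
  bumprow (rcons p n) x = ((bumprow p x).1, Some n).
Proof.
elim: p => [|a p IH] /=; first by move=> _ ->.
rewrite -/(bumprow (a :: p) x) -/(bumprow (a :: rcons p n) x) !bump_cons.
by case: ifP => //= _ e xn; rewrite IH.
Qed.

(* Either nothing gets appended to [p] and [n] stays last, or the first appended letter bumps [n] instead. *)
Lemma lrow_max p t n B : all (fun y => y < n) (map snd B) ->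
  (let S := lrow p [::] B in S.1.2 = [::] /\ lrow (rcons p n) [:: t] B = (rcons S.1.1 n, [:: t], S.2)) \/
  (exists p1 tb q' O1 O3, [/\ lrow p [::] B = (p1, tb :: q', O1 ++ O3),
     lrow (rcons p n) [:: t] B = (p1, t :: q', O1 ++ (tb, n) :: O3) & tb \in map fst B]).
Proof.
elim: B p => [|a B IH] p /=; first by left.
case/andP => an Bn; case e: (bumprow p a.2).2 => [y|].
  rewrite (bump_rcons_some _ e) /=; have [[q0 e2]|[p1 [tb [q' [O1 [O3 [e1 e2 tbB]]]]]]] := IH (bumprow p a.2).1 Bn.
    by left; rewrite e2.
  by right; exists p1, tb, q', ((a.1, y) :: O1), O3; rewrite e1 e2 inE tbB orbT.
right; rewrite (bump_rcons_none e an) /= (lrow_q _ [:: a.1]) /= (lrow_q _ [:: t]) /=.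
exists (lrow (bumprow p a.2).1 [::] B).1.1, a.1, (lrow (bumprow p a.2).1 [::] B).1.2, [::], (lrow (bumprow p a.2).1 [::] B).2.
by split; rewrite ?mem_head.
Qed.

(** In the first row, the next letter that would be appended without [n], at time [tb], now bumps
    [n]. Thus [t] replaces [tb] in the recording row and [(tb, n)], again with the largest value,
    goes on to the next row: this is row insertion of [t]. *)
Lemma recQ_max A B t n : sorted ltn (map fst (A ++ (t, n) :: B)) ->
  all (fun y => y < n) (map snd (A ++ B)) ->
  recQ (A ++ (t, n) :: B) = ins (recQ (A ++ B)) t.
Proof.
move: {2}(size (A ++ B)) (leqnn (size (A ++ B))) => m.
elim: m A B t n => [|m IH] A B t n szm st lt.
  by move: szm; rewrite leqn0 size_eq0; case: A st lt => //; case: B.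
have := lt; rewrite map_cat all_cat => /andP[An Bn].
have recE Y : Y != [::] -> recQ Y = (lrow [::] [::] Y).1.2 :: recQ (lrow [::] [::] Y).2.
  by case: Y => // a Y _; apply: recQ_cons.
rewrite recE; last by case: A {szm st lt An}.
rewrite lrow_cat /=; case eA : (lrow [::] [::] A) => [[pA qA] OA] /=.
have [] := @lrow_letters n [::] A isT An; rewrite eA /= => pAn OAn.
have := lrow_subseq [::] A; rewrite eA /= => -[sOA sqA].
rewrite bump_append /=; last by apply: sub_all pAn => y; apply: ltnW.
move: st; rewrite map_cat /= => st.
have stB : sorted ltn (map fst A ++ map fst B).
  by apply: subseq_sorted st; [exact: ltn_trans|apply: cat_subseq => //; apply: subseq_cons].
have [qlt tB] : all (fun s => s < t) qA /\ all (fun s => t < s) (map fst B).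
  move: st; rewrite (sorted_pairwise ltn_trans) pairwise_cat /= => /and3P[/allrelP ar _ /andP[tb _]].
  by split=> //; apply/allP => s sq; apply: ar; rewrite ?mem_head // (mem_subseq sqA).
have qle : all (leq^~ t) qA by apply: sub_all qlt => s; apply: ltnW.
have st' : subseq (map fst A ++ map fst B) (map fst A ++ t :: map fst B).
  by apply: cat_subseq => //; apply: subseq_cons.
have eAB : lrow [::] [::] (A ++ B) = ((lrow pA [::] B).1.1, qA ++ (lrow pA [::] B).1.2, OA ++ (lrow pA [::] B).2).
  by rewrite lrow_cat eA /= lrow_q.
rewrite -(cats1 qA) lrow_q_cat /=.
have [[q0 ->]|[p1 [tb [q' [O1 [O3 [e1 e2 tbB]]]]]]] := lrow_max pA t Bn.
  have [|] := eqVneq (A ++ B) [::] => eAB0.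
    case: A eAB0 eA {szm st lt An sOA sqA stB st' eAB} => //= -> [<- <- <-] /=.
    by rewrite /recQ.
  rewrite (recE _ eAB0) eAB /= q0 cats0 /ins -/(tinsert (qA :: _) t) tinsert_cons.
  by rewrite bump_append //= cats1.
have eAB0 : A ++ B != [::] by rewrite -size_eq0 size_cat -(size_map fst B); case: (map fst B) tbB => // b s _; rewrite addnS.
have eO2 : (lrow (rcons pA n) [::] B).2 = O1 ++ (tb, n) :: O3 by have := e2; rewrite lrow_q => -[].
have [sO _] := lrow_subseq (rcons pA n) B; rewrite eO2 in sO.
rewrite e2 (recE _ eAB0) eAB e1 /= /ins -/(tinsert (_ :: _) t) tinsert_cons.
have ttb : t < tb by apply: (allP tB).
have -> : bumprow (qA ++ tb :: q') t = (qA ++ t :: q', Some tb).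
  elim: (qA) qle => [|a s IHs] /=; first by rewrite ttb.
  by case/andP => at' /IHs ->; rewrite ltnNge at'.
rewrite /= catA -/(ins _ _); congr (_ :: _).
have := size_lrow pA B; rewrite e1 /= size_cat => sz.
have := size_lrow [::] A; rewrite eA /= => szA.
have [_] := @lrow_letters n pA B pAn Bn; rewrite e1 map_cat all_cat => /andP[O1n O3n].
rewrite [in RHS]catA; apply: IH.
- by move: szm sz szA; rewrite !size_cat; clear; lia.
- rewrite -catA map_cat; apply: subseq_sorted stB; first exact: ltn_trans.
  exact: cat_subseq.
by rewrite !map_cat !all_cat OAn O1n O3n.
Qed.

(* Schensted's symmetry [Q(w) = P(w^-1)] for biwords, by removing the pair with the largest value. *)
Lemma recQ_inv X Y : perm_eq X Y -> sorted ltn (map snd Y) -> sorted ltn (map fst X) ->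
  recQ X = insw [::] (map fst Y).
Proof.
elim/last_ind: Y X => [|Y [t n] IH] X; first by move/perm_size/size0nil ->.
move=> pXY; have tX : (t, n) \in X by rewrite (perm_mem pXY) mem_rcons mem_head.
case/splitPr: tX pXY => A B; rewrite perm_sym perm_rcons perm_sym => pXY.
have {}pXY : perm_eq (A ++ B) Y.
  by rewrite -(perm_cons (t, n)) (perm_trans _ pXY) // perm_sym -cat1s perm_catCA.
rewrite !map_rcons insw_rcons => sY sX.
have [sY' Yn] : sorted ltn (map snd Y) /\ all (fun y => y < n) (map snd Y).
  move: sY; rewrite -cats1 (sorted_pairwise ltn_trans) pairwise_cat /= => /and3P[/allrelP ar pY _].
  by rewrite (sorted_pairwise ltn_trans) pY; split=> //; apply/allP => y yY; apply: ar; rewrite ?mem_head.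
rewrite recQ_max // ?(perm_all _ (perm_map snd pXY)) //; congr ins.
apply: IH => //; apply: subseq_sorted sX; first exact: ltn_trans.
by apply: map_subseq; apply: cat_subseq => //; apply: subseq_cons.
Qed.
End Symmetry.

(** * Right cells and recording tableaux *)

Section PermRSK.
Local Open Scope nat_scope.
Variable r : nat.
Local Notation perm_r := (perm_r r).
Implicit Types (w x y z : perm_r) (i j k l a b c d : 'I_r) (u v t : seq nat) (T runs : seq (seq nat)).

Definition wd w : seq nat := [seq val (w i) | i <- enum 'I_r].

Lemma size_wd w : size (wd w) = r.
Proof. by rewrite size_map size_enum_ord. Qed.

Lemma nth_wd w i : nth 0 (wd w) i = w i.
Proof. by rewrite (nth_map i) ?size_enum_ord // nth_ord_enum. Qed.

Lemma wd_inj : injective wd.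
Proof. by move=> w x e; apply/permP => i; apply: val_inj; rewrite /= -!nth_wd e. Qed.

Lemma wd_uniq w : uniq (wd w).
Proof. by rewrite map_inj_uniq ?enum_uniq // => i j /val_inj /perm_inj. Qed.

Lemma wd_lt w : all (fun m => m < r) (wd w).
Proof. by apply/allP => _ /mapP[i _ ->]; apply: ltn_ord. Qed.

Lemma PtabE w : Ptab w = insw [::] (wd w).
Proof.
rewrite /Ptab /rsk rsk_auxE rskl_fst -/(wd w) /= -/unzip2 unzip2_zip //.
by rewrite size_iota.
Qed.

Lemma QtabE w : Qtab w = recQ (zip (iota 0 r) (wd w)).
Proof. by rewrite /Qtab /rsk rsk_auxE -/(wd w) size_wd. Qed.

Lemma Qtab_inv w : Qtab w = Ptab w^-1%g.
Proof.
rewrite QtabE PtabE.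
have -> : zip (iota 0 r) (wd w) = [seq (val i, val (w i)) | i <- enum 'I_r].
  by rewrite /wd -val_enum_ord zip_map.
rewrite (@recQ_inv _ [seq (val (w^-1%g j), val j) | j <- enum 'I_r]).
- by rewrite -map_comp.
- apply: uniq_perm.
  + by rewrite map_inj_uniq ?enum_uniq // => i j [/val_inj].
  + by rewrite map_inj_uniq ?enum_uniq // => i j [_ /val_inj].
  move=> p; apply/mapP/mapP => -[i _ ->].
    by exists (w i); rewrite ?mem_enum // permK.
  by exists (w^-1%g i); rewrite ?mem_enum // permKV.
- by rewrite -map_comp val_enum_ord iota_ltn_sorted.
by rewrite -map_comp val_enum_ord iota_ltn_sorted.
Qed.

(** * The recording tableau read from the list of added cells *)

Definition Qw u := recQ (zip (iota 0 (size u)) u).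

Lemma Qw_rcons u (x : nat) : Qw (rcons u x) = addbox (Qw u) (tinsert (insw [::] u) x).2 (size u).
Proof.
rewrite /Qw /recQ size_rcons -addn1 iotaD /= add0n -cats1 zip_cat ?size_iota // /rskl foldl_cat /=.
by rewrite -/rskl rskl_fst /= -/unzip2 unzip2_zip ?size_iota.
Qed.

Lemma Qw_cells u v : size u = size v -> map fst (cells u) = map fst (cells v) -> Qw u = Qw v.
Proof.
elim/last_ind: u v => [|u x IH] v; first by move=> /esym/size0nil ->.
case/lastP: v => [|v y]; rewrite !size_rcons // => -[suv].
rewrite !cells_rcons !map_rcons !Qw_rcons suv => /eqP; rewrite eqseq_rcons => /andP[/eqP e /eqP /= ->].
by rewrite (IH _ suv e).
Qed.

Lemma tinsert_size T (x : nat) : (tinsert T x).2 <= size T /\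
  size (ins T x) = (if (tinsert T x).2 < size T then size T else (size T).+1).
Proof.
elim: T x => // row T IH x; rewrite /ins -/(tinsert (row :: T) x) tinsert_cons.
case: (bumprow row x).2 => [y|] //=; have [h1 h2] := IH y.
by rewrite !ltnS h2; split=> //; case: ifP.
Qed.

Lemma nth_addbox T n m p : n <= size T ->
  nth [::] (addbox T n m) p = if p == n then rcons (nth [::] T n) m else nth [::] T p.
Proof.
move=> le; rewrite /addbox; case: ltnP => [lt|ge]; first by rewrite nth_set_nth /=.
have -> : n = size T by apply/eqP; rewrite eqn_leq le ge.
rewrite nth_rcons; case: ltngtP => [//|gt|e]; last by rewrite nth_default.
by rewrite nth_default // ltnW.
Qed.

Lemma Qw_spec u : [/\ size (Qw u) = size (insw [::] u),
  forall p, rsz (Qw u) p = rsz (insw [::] u) p,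
  forall m p, (m \in nth [::] (Qw u) p) = (m < size u) && (p == (nth (0, 0) (cells u) m).1) &
  forall m, m < size u -> index m (nth [::] (Qw u) (nth (0, 0) (cells u) m).1) = (nth (0, 0) (cells u) m).2].
Proof.
elim/last_ind: u => [|u x [s1 s2 s3 s4]]; first by split=> // m p; rewrite nth_nil.
rewrite Qw_rcons insw_rcons cells_rcons size_rcons.
set T := insw [::] u; set n := (tinsert T x).2; have [le sz] := tinsert_size T x.
rewrite -/n in le sz; have le' : n <= size (Qw u) by rewrite s1.
split.
- by rewrite sz /addbox s1; case: ifP => lt; rewrite ?size_set_nth ?size_rcons s1 ?(maxn_idPr lt).
- move=> p; rewrite rsz_ins -s2 /rsz nth_addbox // -/n; case: eqP => [->|_]; last by rewrite addn0.
  by rewrite size_rcons addn1.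
- move=> m p; rewrite nth_addbox // nth_rcons size_cellsT.
  have [lt|gt|->] := ltngtP m (size u); rewrite ?ltnSn ?(ltnW lt) //=.
  + rewrite (ltn_trans lt (ltnSn _)) /=; case: (p =P n) => [->|_]; last by rewrite s3 lt.
    by rewrite mem_rcons inE (ltn_eqF lt) s3 lt.
  + have -> : (m < (size u).+1) = false by rewrite ltnS leqNgt gt.
    case: (p =P n) => [->|_]; last by rewrite s3 ltnNge (ltnW gt).
    by rewrite mem_rcons inE (gtn_eqF gt) s3 ltnNge (ltnW gt).
  by case: (p =P n) => [e|ne] /=; rewrite ?mem_rcons ?mem_head // s3 ltnn.
move=> m; rewrite ltnS nth_rcons size_cellsT nth_addbox //.
have [lt _|gt|-> _] := ltngtP m (size u).
- case: eqP => [e|_]; last exact: s4.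
  rewrite -cats1 index_cat -{1}e s3 lt eqxx /= -e; exact: s4.
- by [].
by rewrite /= eqxx -cats1 index_cat s3 ltnn /= eqxx addn0 -/(rsz _ _) s2.
Qed.

Lemma pos_ofP T m p : m \in nth [::] T p -> (forall q, q < p -> m \notin nth [::] T q) ->
  pos_of T m = (p, index m (nth [::] T p)).
Proof.
move=> mp mq; have pT : p < size T.
  by rewrite ltnNge; apply: contraTN mp => le; rewrite nth_default.
suff e : find (fun row => m \in row) T = p by rewrite /pos_of e.
apply/eqP; rewrite eqn_leq; apply/andP; split; rewrite leqNgt; apply/negP => lt.
  by have := before_find [::] lt; rewrite mp.
have hT : has (fun row => m \in row) T by rewrite has_find (ltn_trans lt pT).
by have := nth_find [::] hT; apply/negP; apply: mq.
Qed.

Definition pcell w i := nth (0, 0) (cells (wd w)) i.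

Lemma pos_of_Qtab w i : pos_of (Qtab w) i = pcell w i.
Proof.
have -> : Qtab w = Qw (wd w) by rewrite QtabE /Qw size_wd.
have [_ _ s3 s4] := Qw_spec (wd w); have ir : i < size (wd w) by rewrite size_wd.
rewrite (@pos_ofP _ _ (pcell w i).1) ?s3 ?ir ?eqxx //.
  by rewrite s4 // -surjective_pairing.
by move=> q lt; rewrite s3 ir /= (ltn_eqF lt).
Qed.

Lemma Qtab_cells w x : cells (wd w) = cells (wd x) -> Qtab w = Qtab x.
Proof.
by move=> e; rewrite !QtabE -(size_wd w) -/(Qw _) size_wd -(size_wd x); apply: Qw_cells; rewrite ?size_wd // e.
Qed.

Lemma cells_eq w x : (forall i, pcell w i = pcell x i) -> cells (wd w) = cells (wd x).
Proof.
move=> e; apply: (@eq_from_nth _ (0, 0)); rewrite !size_cellsT !size_wd // => m lt.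
exact: (e (Ordinal lt)).
Qed.

Lemma Qtab_eqP w x : Qtab w = Qtab x <-> cells (wd w) = cells (wd x).
Proof.
split=> [e|]; last exact: Qtab_cells.
by apply: cells_eq => i; rewrite -!pos_of_Qtab e.
Qed.

Lemma PQ_inj w x : Ptab w = Ptab x -> Qtab w = Qtab x -> w = x.
Proof. by rewrite !PtabE => eP /Qtab_eqP eQ; apply/wd_inj/cells_insw_inj. Qed.

Lemma wd_split w i j : adj i j -> wd w = take i (wd w) ++ [:: val (w i), val (w j) & drop j.+1 (wd w)].
Proof.
move=> /eqP ij; rewrite -{1}(cat_take_drop i (wd w)); congr (_ ++ _).
rewrite (drop_nth 0) ?size_wd // nth_wd; congr (_ :: _).
by rewrite -ij (drop_nth 0) ?size_wd // nth_wd.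
Qed.

Lemma pcell_desc w i j : adj i j -> desc w i j ->
  (pcell w i).1 < (pcell w j).1 /\ (pcell w j).2 <= (pcell w i).2.
Proof.
move=> ij d; have := cells_desc (take i (wd w)) (drop j.+1 (wd w)) d.
rewrite -(wd_split w ij) size_takel ?size_wd ?(ltnW (ltn_ord i)) //=.
by rewrite -(eqP ij).
Qed.

Lemma pcell_asc w i j : adj i j -> ~~ desc w i j ->
  (pcell w i).2 < (pcell w j).2 /\ (pcell w j).1 <= (pcell w i).1.
Proof.
move=> ij; rewrite ndescE // => d; have := cells_asc (take i (wd w)) (drop j.+1 (wd w)) d.
rewrite -(wd_split w ij) size_takel ?size_wd ?(ltnW (ltn_ord i)) //=.
by rewrite -(eqP ij).
Qed.

Lemma wd_swap w i j t1 (m n : nat) t2 : adj i j -> size t1 = i -> wd w = t1 ++ [:: m, n & t2] ->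
  wd (pmul w (tperm i j)) = t1 ++ [:: n, m & t2].
Proof.
move=> ij st e; have eij := eqP ij.
have em : m = w i by rewrite -nth_wd e nth_cat st ltnn subnn.
have en : n = w j by rewrite -nth_wd e nth_cat st eij ltnNge leqnSn subSnn.
apply: (@eq_from_nth _ 0); first by rewrite size_wd -(size_wd w) e !size_cat.
move=> k; rewrite size_wd => kr; rewrite -[k]/(nat_of_ord (Ordinal kr)); set K := Ordinal kr.
rewrite nth_wd pmulE; case: tpermP => [->|->|Ki Kj].
- by rewrite nth_cat st ltnn subnn en.
- by rewrite nth_cat st eij ltnNge leqnSn subSnn em.
rewrite -nth_wd e !nth_cat st; case: ltnP => // le.
have {}Ki : nat_of_ord K <> i by move/val_inj.
have {}Kj : nat_of_ord K <> j by move/val_inj.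
have -> : (K - i)%N = (K - i - 2).+2 by move: Ki Kj le eij; clear; lia.
by [].
Qed.

Lemma wd_split3 w i j k : adj i j -> adj j k ->
  wd w = take i (wd w) ++ [:: val (w i), val (w j), val (w k) & drop k.+1 (wd w)].
Proof.
move=> ij jk; rewrite {1}(wd_split w ij); congr (_ ++ [:: _, _ & _]).
by rewrite -(eqP jk) (drop_nth 0) ?size_wd // nth_wd.
Qed.

(** A star operation swaps two neighbouring letters next to a third one of intermediate value, which
    is an elementary Knuth relation. *)
Lemma rstep_kn w x : rstep w x -> kn (wd w) (wd x).
Proof.
suff main w' i j k : adj i j -> adj j k -> star_dom i j j k w' -> kn (wd w') (wd (rstar i j j k w')).
  case/rstepP => i [j [k [l [nb d ->]]]]; have /and3P[ij kl /orP[/eqP e|/eqP e]] := nb; subst.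
    exact: main.
  rewrite -{1}(rstarK nb d); apply: kn_sym; apply: main => //.
  exact: rstar_dom.
move=> ij jk /andP[dij njk]; rewrite ndescE // in njk.
have st : size (take i (wd w')) = i by rewrite size_takel ?size_wd // ltnW.
have e := wd_split3 w' ij jk; set t2 := drop k.+1 (wd w') in e.
have st' : size (rcons (take i (wd w')) (val (w' i))) = j by rewrite size_rcons st (eqP ij).
have nik : i != k by move: ij jk; rewrite /adj -val_eqE /=; clear; lia.
have njk' := adj_neq jk.
move: (take i (wd w')) st st' e => t1 st st' e.
rewrite /rstar /desc !pmulE tpermR tpermD //; case: ifP => h.
  rewrite (wd_swap ij st e) e; apply: kn_sym.
  apply: (@kn_step _ t2 [:: val (w' j); val (w' i); val (w' k)] [:: val (w' i); val (w' j); val (w' k)]).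
  by constructor => //; apply: ltnW.
rewrite e (wd_swap jk st' (t2 := t2) (m := w' j) (n := w' k)); last by rewrite cat_rcons.
rewrite cat_rcons.
apply: (@kn_step _ t2 [:: val (w' i); val (w' j); val (w' k)] [:: val (w' i); val (w' k); val (w' j)]).
by constructor => //; rewrite leqNgt h.
Qed.

Lemma rstep_connect_kn w x : connect (@rstep r) w x -> Ptab w = Ptab x.
Proof.
case/connectP => p; elim: p w => [|y p IH] w /=; first by move=> _ ->.
case/andP => /rstep_kn k /IH e /e <-.
by rewrite !PtabE (kn_insw k).
Qed.

Lemma k3_rstep w t1 t2 u1 u2 : k3 u1 u2 -> wd w = t1 ++ u1 ++ t2 ->
  exists2 x, rstep w x & wd x = t1 ++ u2 ++ t2.
Proof.
move=> ku e; have uw := wd_uniq w.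
have su : size u1 = 3 by case: ku.
have szr : size t1 + 3 + size t2 = r by rewrite -(size_wd w) e !size_cat su addnA.
have ir : size t1 < r by move: szr; clear; lia.
have jr : (size t1).+1 < r by move: szr; clear; lia.
have kr : (size t1).+2 < r by move: szr; clear; lia.
pose i := Ordinal ir; pose j := Ordinal jr; pose k := Ordinal kr.
have ij : adj i j by rewrite /adj /=.
have jk : adj j k by rewrite /adj /=.
have nik : i != k by rewrite -val_eqE /=; clear; lia.
have njk := adj_neq jk.
have nb : nbr i j j k by rewrite /nbr ij jk eqxx.
have v0 : val (w i) = nth 0 u1 0 by rewrite -[LHS]nth_wd e !nth_cat ltnn subnn su.
have v1 : val (w j) = nth 0 u1 1 by rewrite -[LHS]nth_wd e !nth_cat /= ltnNge leqnSn /= subSnn su.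
have v2 : val (w k) = nth 0 u1 2.
  by rewrite -[LHS]nth_wd e !nth_cat /= ltnNge (leqW (leqnSn _)) /= subSn ?leqnSn // subSnn su.
rewrite /= in v0 v1 v2.
have uu : uniq u1 by move: uw; rewrite e !cat_uniq => /and3P[_ _ /andP[]].
case: ku e uu {su} v0 v1 v2 => m n p mn np e; rewrite /= !inE => uu v0 v1 v2.
  exists (pmul w (tperm i j)); last by apply: (wd_swap ij _ e).
  apply/rstepP; exists j, k, i, j; split.
  - by rewrite nbr_sym.
  - by rewrite /star_dom /desc v0 v1 v2; move: uu mn np; clear; lia.
  rewrite /rstar /desc !pmulE tpermL tpermD ?(eq_sym k) ?(eq_sym j) // v0 v2.
  by rewrite ltnNge mn.
exists (pmul w (tperm j k)); last first.
  have := @wd_swap w j k (rcons t1 n) m p t2 jk; rewrite size_rcons cat_rcons => /(_ erefl e) ->.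
  by rewrite cat_rcons.
apply/rstepP; exists i, j, j, k; split=> //.
  by rewrite /star_dom /desc v0 v1 v2; move: uu mn np; clear; lia.
rewrite /rstar /desc !pmulE tpermR tpermD // v0 v2.
by rewrite ltnNge np.
Qed.

Lemma wd_swap_ex w t1 (m n : nat) t2 : wd w = t1 ++ [:: m, n & t2] ->
  exists x, wd x = t1 ++ [:: n, m & t2].
Proof.
move=> e; have sz : size t1 + (size t2).+2 = r by rewrite -(size_wd w) e size_cat.
have ir : size t1 < r by move: sz; clear; lia.
have jr : (size t1).+1 < r by move: sz; clear; lia.
exists (pmul w (tperm (Ordinal ir) (Ordinal jr))).
by apply: (wd_swap _ _ e); rewrite /adj /=.
Qed.

Lemma k3_rstep_sym w t1 t2 u1 u2 : k3 u1 u2 -> wd w = t1 ++ u2 ++ t2 ->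
  exists2 x, rstep w x & wd x = t1 ++ u1 ++ t2.
Proof.
move=> ku e; have [x ex] : exists x, wd x = t1 ++ u1 ++ t2.
  case: ku e => m n p _ _ /= e; first exact: (wd_swap_ex e).
  by have := @wd_swap_ex w (rcons t1 n) p m t2; rewrite !cat_rcons; apply.
exists x => //; have [w' st ew] := k3_rstep ku ex.
by rewrite rstep_sym; have -> : w = w' by apply: wd_inj; rewrite e ew.
Qed.

Lemma kn_rstep u v : kn u v -> (forall w, wd w = u -> exists2 x, connect (@rstep r) w x & wd x = v) /\
   (forall w, wd w = v -> exists2 x, connect (@rstep r) w x & wd x = u).
Proof.
elim=> [t1 t2 u1 u2 ku|u1|u1 u2 _ [h1 h2]|u1 u2 u3 _ [h1 h1'] _ [h2 h2']] //.
- split=> w e.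
    by have [x st ex] := k3_rstep ku e; exists x => //; apply: connect1.
  by have [x st ex] := k3_rstep_sym ku e; exists x => //; apply: connect1.
- by split=> w e; exists w.
split=> w e.
  by have [x c1 /h2 [y c2 ey]] := h1 _ e; exists y => //; apply: connect_trans c1 c2.
by have [x c1 /h1' [y c2 ey]] := h2' _ e; exists y => //; apply: connect_trans c1 c2.
Qed.

(** Knuth's theorem, with star operations in place of Knuth moves. *)
Lemma connect_rstepP w x : connect (@rstep r) w x <-> Ptab w = Ptab x.
Proof.
split; first exact: rstep_connect_kn.
rewrite !PtabE => /insw_kn /kn_rstep [h _]; have [y c /wd_inj e] := h _ erefl.
by rewrite -e.
Qed.

Lemma rowread_ex w : exists2 x, connect (@rstep r) w x & wd x = rowread (Ptab w).
Proof. by rewrite PtabE; have [h _] := kn_rstep (kn_rowread (wd w)); apply: h. Qed.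

Definition same_desc w x := forall i j, adj i j -> desc w i j = desc x i j.

Lemma same_desc_dom w x i j k l : same_desc w x -> nbr i j k l ->
  star_dom i j k l w = star_dom i j k l x.
Proof. by move=> sd /and3P[ij kl _]; rewrite /star_dom !sd. Qed.

Lemma connect_ldesc w x : connect (@rstep r) w x -> same_desc w^-1%g x^-1%g.
Proof.
case/connectP => p; elim: p w => [|y p IH] w /=; first by move=> _ ->.
case/andP => /rstepP[i [j [k [l [nb d ->]]]]] yp e a b ab.
by rewrite -(IH _ yp e) // rstar_ldesc.
Qed.

Lemma connect_lstar w x i j k l : nbr i j k l -> star_dom i j k l w^-1%g ->
  connect (@rstep r) w x -> connect (@rstep r) (lstar i j k l w) (lstar i j k l x).
Proof.
move=> nb + /connectP[p]; elim: p w => [|y p IH] w /=; first by move=> _ _ ->; apply: connect0.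
move=> dw /andP[st yp] e; have sd := connect_ldesc (connect1 st).
apply: connect_trans (IH y _ yp e); last by rewrite -(same_desc_dom sd nb).
case/rstepP: st => a [b [c [d [nb' d' ->]]]]; rewrite star_comm //.
have /and3P[ab cd _] := nb'.
by apply/connect1/rstepP; exists a, b, c, d; split=> //; rewrite /star_dom !lstar_desc.
Qed.

(** On inverses [Q] becomes [P] and the right star becomes a left star, which commutes with Knuth
    moves. *)
Lemma Qtab_rstar w x i j k l : nbr i j k l -> star_dom i j k l w -> star_dom i j k l x ->
  Qtab w = Qtab x -> Qtab (rstar i j k l w) = Qtab (rstar i j k l x).
Proof.
move=> nb dw dx; rewrite !Qtab_inv => /connect_rstepP c; apply/connect_rstepP.
have := @connect_lstar w^-1%g x^-1%g i j k l nb; rewrite invgK => /(_ dw c).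
by rewrite /lstar !invgK.
Qed.

Lemma Qtab_lstar w i j k l : nbr i j k l -> star_dom i j k l w^-1%g ->
  Qtab (lstar i j k l w) = Qtab w.
Proof.
move=> nb dw; rewrite !Qtab_inv invgK; symmetry; apply/connect_rstepP/connect1/rstepP.
by exists i, j, k, l.
Qed.

(** Equal descents keep the partner [x] in every star domain that [y] meets. Stars act on recording
    tableaux invertibly, so equality at the end of the path pulls back to its start. *)
Lemma walk_rstar (R : perm_r -> perm_r -> Prop) :
  (forall x y, R x y -> same_desc x y) ->
  (forall x y i j k l, R x y -> nbr i j k l -> star_dom i j k l x -> R (rstar i j k l x) (rstar i j k l y)) ->
  forall x y y', connect (@rstep r) y y' -> R x y ->
  exists x', [/\ connect (@rstep r) x x', R x' y' & Qtab x' = Qtab y' -> Qtab x = Qtab y].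
Proof.
move=> Rdesc Rstar x y y' /connectP[p]; elim: p x y => [|y1 p IH] x y /=.
  by move=> _ -> Rxy; exists x; split.
case/andP => /rstepP[i [j [k [l [nb d ->]]]]] yp e Rxy.
have dx : star_dom i j k l x by rewrite (same_desc_dom (Rdesc _ _ Rxy)).
have [x' [c R' back]] := IH _ _ yp e (Rstar _ _ _ _ _ _ Rxy nb dx).
exists x'; split=> // [|/back e'].
  by apply: connect_trans (connect1 _) c; apply/rstepP; exists i, j, k, l.
rewrite -(rstarK nb dx) -[y in RHS](rstarK nb d).
by apply: Qtab_rstar => //; rewrite 1?nbr_sym // ?rstar_dom.
Qed.

Lemma Ptab_run_sorted w (run : seq nat) : run \in rev (Ptab w) -> sorted ltn run.
Proof.
rewrite PtabE => h; rewrite ltn_sorted_uniq_leq; apply/andP; split.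
  have : uniq (rowread (insw [::] (wd w))) by rewrite -(perm_uniq (insw_perm _)) wd_uniq.
  rewrite /rowread; elim: (rev _) h => //= r1 rs IH.
  by rewrite inE cat_uniq => /orP[/eqP -> /andP[]|/IH {}IH /and3P[_ _]].
have /and3P[/allP s _ _] := insw_tab (wd w); apply: s.
by rewrite -mem_rev.
Qed.

Definition ncols w (m : nat) := count (fun p : nat * nat => p.2 < m) (cells (wd w)).

Lemma ncols_Ptab w x : Ptab w = Ptab x -> ncols w =1 ncols x.
Proof. by rewrite !PtabE => /cells_perm /seq.permP e m; apply: e. Qed.

Lemma ncols_sum w m : ncols w m = \sum_(n <- map size (rev (Ptab w))) minn m n.
Proof. by rewrite big_map (perm_big (Ptab w)) ?perm_rev //= PtabE; apply: count_cols. Qed.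

Lemma same_desc_runs w x (y : perm_r) : same_desc w x -> wd x = rowread (Ptab y) ->
  exists runs, [/\ wd w = flatten runs, map size runs = map size (rev (Ptab y)) &
    forall run, run \in runs -> sorted ltn run].
Proof.
move=> sd e; apply: runs_transfer => [||m lt].
- by rewrite -/(rowread _) -e !size_wd.
- exact: Ptab_run_sorted.
rewrite -/(rowread _) -e; rewrite size_wd in lt.
pose I := Ordinal (ltn_trans (ltnSn m) lt); pose J := Ordinal lt.
have ij : adj I J by rewrite /adj /=.
have nI z : nth 0 (wd z) m = z I by rewrite -nth_wd.
have nJ z : nth 0 (wd z) m.+1 = z J by rewrite -nth_wd.
by rewrite !nI !nJ -!ndescE // sd.
Qed.

Lemma ncols_runs w runs m : wd w = flatten runs -> (forall run, run \in runs -> sorted ltn run) ->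
  ncols w m <= \sum_(n <- map size runs) minn m n.
Proof.
move=> e s; rewrite /ncols e big_map; apply: runs_bound => // T run tT /s sr.
exact: cells_run_cols.
Qed.

(* Follow the right star path from [y] to the row reading word of [Ptab y]: the companion of [x] has the
   same descents, so it splits into increasing runs as long as the rows, which bounds its column counts. *)
Lemma tau_invariant (R : perm_r -> perm_r -> Prop) :
  (forall x y, R x y -> R y x) -> (forall x y, R x y -> same_desc x y) ->
  (forall x y i j k l, R x y -> nbr i j k l -> star_dom i j k l x -> R (rstar i j k l x) (rstar i j k l y)) ->
  forall x y, R x y -> Qtab x = Qtab y.
Proof.
move=> Rsym Rdesc Rstar.
have bound x y m : R x y -> ncols x m <= ncols y m.
  move=> Rxy; have [y' c e] := rowread_ex y.
  have [x' [cx R' _]] := walk_rstar Rdesc Rstar c Rxy.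
  have [runs [e1 e2 e3]] := same_desc_runs (Rdesc _ _ R') e.
  rewrite (ncols_Ptab (proj1 (connect_rstepP _ _) cx)) [in X in _ <= X]ncols_sum -e2.
  exact: ncols_runs.
move=> x y Rxy; have [y' c e] := rowread_ex y.
have [x' [cx R' back]] := walk_rstar Rdesc Rstar c Rxy; apply: back.
have [runs [e1 e2 e3]] := same_desc_runs (Rdesc _ _ R') e.
(* By symmetry both words attain the bound for their runs, so each run fills the columns from the
   first one on and the two column sequences agree. *)
apply/Qtab_eqP/cells_snd_inj; first by rewrite !size_wd.
have eqn m : ncols x' m = ncols y m.
  rewrite -(ncols_Ptab (proj1 (connect_rstepP _ _) cx)); apply/eqP.
  by rewrite eqn_leq !bound //; apply: Rsym.
rewrite e1 e canonical_cols // => [|m]; last first.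
  by rewrite -e1 -/(ncols _ m) eqn ncols_sum -e2 big_map.
rewrite /rowread canonical_cols ?e2 // => [run h|m]; first exact: (Ptab_run_sorted h).
rewrite -/(rowread _) -e -/(ncols _ m) -(ncols_Ptab (proj1 (connect_rstepP _ _) c)) ncols_sum.
by rewrite big_map.
Qed.

(** * Right cells as the fibres of the insertion tableau *)

Lemma connect_redge_ldesc x y : connect (@redge r) x y -> forall i j, adj i j ->
  desc x^-1%g i j -> desc y^-1%g i j.
Proof.
case/connectP => p; elim: p x => [|z p IH] x /=; first by move=> _ ->.
by case/andP => xz zp e i j ij d; apply: (IH z zp e i j ij); apply: redge_ldesc xz d.
Qed.

Definition rcell x y := connect (@redge r) x y && connect (@redge r) y x.

Lemma rcell_ldesc x y : rcell x y -> same_desc x^-1%g y^-1%g.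
Proof. by case/andP => c1 c2 i j ij; apply/idP/idP; apply: connect_redge_ldesc. Qed.

Lemma rcell_lstar x y i j k l : rcell x y -> nbr i j k l -> star_dom i j k l x^-1%g ->
  connect (@redge r) (lstar i j k l x) (lstar i j k l y).
Proof.
case/andP => /connectP[p + e] + nb; elim: p x e => [|z p IH] x /= e; first by rewrite e connect0.
case/andP => xz zp yx dx.
have yz : connect (@redge r) y z by apply: connect_trans yx (connect1 xz).
have zy : connect (@redge r) z y by apply/connectP; exists p.
have xzc : rcell x z by rewrite /rcell connect1 // (connect_trans zy yx).
have dz : star_dom i j k l z^-1%g by rewrite -(same_desc_dom (rcell_ldesc xzc) nb).
have /redgeP[a [b [ab h]]] := xz.
have step : redge (lstar i j k l x) (lstar i j k l z).
  by apply/redgeP; exists a, b; rewrite lstar_bcoef.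
exact: connect_trans (connect1 step) (IH z e zp yz dz).
Qed.

(** Left stars map right cells to right cells, and left descents are constant on a right cell. So
    the tau-invariant theorem applies to the inverses, whose [Q] is the wanted [P]. *)
Lemma rcell_Ptab x y : rcell x y -> Ptab x = Ptab y.
Proof.
move=> c; rewrite -[x]invgK -[y]invgK -!Qtab_inv.
apply: (@tau_invariant (fun p q : perm_r => rcell p^-1%g q^-1%g)); last by rewrite !invgK.
- by move=> p q; rewrite /rcell andbC.
- by move=> p q /rcell_ldesc; rewrite !invgK.
move=> p q i j k l cpq nb d.
have ec : rcell q^-1%g p^-1%g by rewrite /rcell andbC.
have dq : star_dom i j k l q by have := same_desc_dom (rcell_ldesc cpq) nb; rewrite !invgK d.
have := rcell_lstar cpq nb; have := rcell_lstar ec nb.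
by rewrite /rcell /lstar !invgK => h1 h2; rewrite h1 // h2.
Qed.

Lemma Ptab_rcell x y : Ptab x = Ptab y -> rcell x y.
Proof.
move=> /connect_rstepP c.
have sub w z : rstep w z -> redge w z /\ redge z w.
  by case/rstepP => i [j [k [l [nb d ->]]]]; apply: redge_rstar.
case/connectP: c => p; elim: p x => [|z p IH] x /=; first by move=> _ ->; rewrite /rcell connect0.
case/andP => /sub[e1 e2] zp /(IH z zp) /andP[c1 c2]; apply/andP; split.
  exact: connect_trans (connect1 e1) c1.
exact: connect_trans c2 (connect1 e2).
Qed.

(** The left stars that lead from [w] to [x] carry the rest of the right cell along, without
    changing recording tableaux or structure constants. *)
Lemma lstar_sync w x y : connect (@rstep r) w^-1%g x^-1%g -> Ptab y = Ptab w ->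
  exists z, [/\ Ptab z = Ptab x, Qtab z = Qtab y &
    forall a b, adj a b -> bcoef a b z x = bcoef a b y w].
Proof.
case/connectP => p; elim: p w y => [|w1 p IH] w y /=.
  by move=> _ /invg_inj -> e; exists y.
case/andP => /rstepP[i [j [k [l [nb d ew1]]]]] wp e eP.
have c : connect (@rstep r) y w by apply/connect_rstepP.
have dy : star_dom i j k l y^-1%g by rewrite (same_desc_dom (connect_ldesc c) nb).
have elw : (lstar i j k l w)^-1%g = w1 by rewrite /lstar invgK.
have eP' : Ptab (lstar i j k l y) = Ptab (lstar i j k l w).
  by apply/connect_rstepP; apply: connect_lstar.
rewrite -elw in wp e; have [z [zP zQ zb]] := IH _ _ wp e eP'.
exists z; split=> //; first by rewrite zQ Qtab_lstar.
by move=> a b ab; rewrite zb // lstar_bcoef.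
Qed.

(** The module of a right cell depends on recording tableaux only; this gives [mu_up] and [mu_low]
    their values. *)
Lemma bcoef_Qtab w' w (v' v : perm_r) a b : adj a b -> Ptab w' = Ptab w -> Ptab v' = Ptab v ->
  Qtab w' = Qtab v' -> Qtab w = Qtab v -> bcoef a b w' w = bcoef a b v' v.
Proof.
move=> ab eP eP' eQ' eQ.
have c : connect (@rstep r) w^-1%g v^-1%g by apply/connect_rstepP; rewrite -!Qtab_inv.
have [z [zP zQ zb]] := lstar_sync c eP.
by rewrite -(zb a b ab); congr bcoef; apply: PQ_inj; rewrite ?zP ?zQ.
Qed.

(** In a row reading word the rows are increasing runs attaining the column bound, so the shape
    alone determines the columns of all cells. *)
Lemma canonical_cells w x : wd w = rowread (Ptab w) -> wd x = rowread (Ptab x) ->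
  map size (Ptab w) = map size (Ptab x) -> cells (wd w) = cells (wd x).
Proof.
move=> ew ex es; apply: cells_snd_inj; first by rewrite !size_wd.
have can y : wd y = rowread (Ptab y) ->
    map snd (cells (wd y)) = flatten [seq iota 0 n | n <- map size (rev (Ptab y))].
  move=> ey; rewrite {1}ey /rowread; apply: canonical_cols => // [run|m].
    exact: Ptab_run_sorted.
  by rewrite -/(rowread _) -ey -/(ncols _ m) ncols_sum big_map.
by rewrite !can // !map_rev es.
Qed.

Lemma size_Qtab w : map size (Qtab w) = map size (Ptab w).
Proof.
rewrite QtabE PtabE -{1}(size_wd w) -/(Qw _); have [s1 s2 _ _] := Qw_spec (wd w).
apply: (@eq_from_nth _ 0); rewrite !size_map // => m lt.
by rewrite !(nth_map [::]) -?s1 //; apply: s2.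
Qed.

(** The row words of [P(x)] and of [Q(y)] have the same recording tableau, so left stars connect
    them. Applied to the inverse of the row word of [P(y)], they yield the required pair. *)
Lemma Ptab_of_shape x y : map size (Ptab x) = map size (Ptab y) ->
  exists w, Ptab w = Ptab x /\ Qtab w = Ptab y.
Proof.
move=> es; have [x' cx ex] := rowread_ex x; have [y' cy ey] := rowread_ex y.
have ePx := proj1 (connect_rstepP _ _) cx; have ePy := proj1 (connect_rstepP _ _) cy.
have [e ce ee] := rowread_ex y'^-1%g; have ePe := proj1 (connect_rstepP _ _) ce.
have eQ : Qtab e = Qtab x'.
  apply/Qtab_cells/canonical_cells; rewrite -?ePe -?ePx //.
  by rewrite -Qtab_inv size_Qtab -ePy es.
have c : connect (@rstep r) e^-1%g x'^-1%g by apply/connect_rstepP; rewrite -!Qtab_inv.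
have [z [zP zQ _]] := lstar_sync c ePe.
by exists z; rewrite zP zQ Qtab_inv invgK ePx ePy.
Qed.

Lemma wd_wz w : wd (wz w) = compl_word r.-1 (wd w).
Proof.
rewrite /wd /compl_word -map_comp; apply: eq_map => i /=; rewrite wzE /=.
by move: (ltn_ord (w i)); clear; lia.
Qed.

(** The origin of the transposes in the lower basis: [w0] complements the letters of the word. *)
Lemma pcell_wz w i : pcell (wz w) i = swap (pcell w i).
Proof.
rewrite /pcell wd_wz cells_comp ?wd_uniq //.
  by rewrite (nth_map (0, 0)) // size_cellsT size_wd.
by apply: sub_all (wd_lt w) => m; case: (r).
Qed.

Lemma Ptab_wz w x : Ptab w = Ptab x -> Ptab (wz w) = Ptab (wz x).
Proof.
rewrite !PtabE !wd_wz => e; apply/kn_insw/kn_comp; rewrite ?wd_uniq //.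
  exact: insw_kn.
by apply: sub_all (wd_lt w) => m; case: (r).
Qed.
End PermRSK.

(** * Standard tableaux and permutations *)

Section SYTs.
Local Open Scope nat_scope.
Variables (r : nat) (lam : seq nat).
Hypothesis lam_part : is_partition_of r lam.
Local Notation perm_r := (perm_r r).
Implicit Types (w x y : perm_r) (i j a b : 'I_r).

Lemma wd_ex (u : seq nat) : perm_eq u (iota 0 r) -> exists w : perm_r, wd w = u.
Proof.
move=> pu; have su : size u = r by rewrite (perm_size pu) size_iota.
have ltu (i : 'I_r) : nth 0 u i < r.
  have : nth 0 u i \in u by rewrite mem_nth // su.
  by rewrite (perm_mem pu) mem_iota.
have inj : injective (fun i => Ordinal (ltu i)).
  move=> i j [] /eqP; rewrite nth_uniq ?su // ?(perm_uniq pu) ?iota_uniq // => /eqP.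
  exact: val_inj.
exists (perm inj); apply: (@eq_from_nth _ 0); first by rewrite size_wd su.
move=> m; rewrite size_wd => lt; rewrite -[m]/(nat_of_ord (Ordinal lt)) nth_wd permE.
by [].
Qed.

Lemma domP r1 r2 : size r2 <= size r1 -> (forall c, c < size r2 -> nth 0 r1 c < nth 0 r2 c) -> row_dom r1 r2.
Proof.
elim: r1 r2 => [|e r1 IH] [|f r2] //= sz h; apply/andP; split; first exact: (h 0).
by apply: IH => // c lt; apply: (h c.+1).
Qed.

Lemma lam_mono p q : p <= q -> nth 0 lam q <= nth 0 lam p.
Proof.
have /andP[/andP[sl _] _] := lam_part => le; have [lt|ge] := ltnP q (size lam); last by rewrite nth_default.
have trg : transitive geq by move=> y x z h1 h2; apply: leq_trans h2 h1.
exact: (@sorted_leq_nth _ geq trg leqnn 0 lam sl p q (leq_ltn_trans le lt) lt le).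
Qed.

Lemma SYT_spec (Q : SYT r lam) : [/\ injective (tpos (val Q)),
  forall a, (tpos (val Q) a).2 < nth 0 lam (tpos (val Q) a).1,
  forall a b, (tpos (val Q) a).1 = (tpos (val Q) b).1 -> (tpos (val Q) a).2 < (tpos (val Q) b).2 -> a < b &
  forall a b, (tpos (val Q) a).2 = (tpos (val Q) b).2 -> (tpos (val Q) a).1 < (tpos (val Q) b).1 -> a < b].
Proof.
have /andP[/andP[/andP[/forallP h1 /forallP h2] /forallP h3] /forallP h4] := valP Q.
split=> [a b e|//|a b e lt|a b e lt].
- by have /forallP /(_ b) := h1 a; rewrite e eqxx => /eqP.
- by have /forallP /(_ b) := h3 a; rewrite e eqxx lt.
by have /forallP /(_ b) := h4 a; rewrite e eqxx lt.
Qed.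

(** By counting: [tpos] is injective on [r] entries, with values in a diagram of [r] cells. *)
Lemma SYT_onto (Q : SYT r lam) p c : c < nth 0 lam p -> exists a, tpos (val Q) a = (p, c).
Proof.
move=> lt; have [inj h2 _ _] := SYT_spec Q; have /andP[_ /eqP sl] := lam_part.
pose D := [seq (p, c) | p <- iota 0 (size lam), c <- iota 0 (nth 0 lam p)].
have sD : size D = r.
  rewrite size_allpairs_dep -sl; congr sumn; rewrite -[in RHS](mkseq_nth 0 lam).
  by apply: eq_map => q; rewrite size_iota.
have memD q d : ((q, d) \in D) = (d < nth 0 lam q).
  apply/allpairsPdep/idP => [[q' [d' [_ + [-> ->]]]]|ltd]; first by rewrite mem_iota.
  exists q, d; rewrite !mem_iota /= !add0n ltd; split=> //.
  by rewrite ltnNge; apply: contraTN ltd => le; rewrite nth_default.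
have uE : uniq [seq tpos (val Q) a | a <- enum 'I_r] by rewrite map_inj_uniq ?enum_uniq.
have sub : {subset [seq tpos (val Q) a | a <- enum 'I_r] <= D}.
  by move=> _ /mapP[a _ ->]; rewrite [tpos _ _]surjective_pairing memD.
have [] := uniq_min_size uE sub; first by rewrite sD size_map size_enum_ord.
move=> _ eqm; have : (p, c) \in D by rewrite memD.
by rewrite -eqm => /mapP[a _ ->]; exists a.
Qed.

Definition syt_entry (Q : SYT r lam) (p : nat * nat) := index p [seq tpos (val Q) a | a <- enum 'I_r].
Definition syt_rows (Q : SYT r lam) : seq (seq nat) :=
  [seq [seq syt_entry Q (p, c) | c <- iota 0 (nth 0 lam p)] | p <- iota 0 (size lam)].

Lemma syt_entry_tpos Q a : syt_entry Q (tpos (val Q) a) = a.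
Proof.
have [inj _ _ _] := SYT_spec Q.
by rewrite /syt_entry index_map // index_enum_ord.
Qed.

Lemma nth_syt_rows Q p : nth [::] (syt_rows Q) p = [seq syt_entry Q (p, c) | c <- iota 0 (nth 0 lam p)].
Proof.
have [lt|le] := ltnP p (size lam); first by rewrite (nth_map 0) ?size_iota // nth_iota.
by rewrite !nth_default ?size_map ?size_iota.
Qed.

Lemma nth_syt_row Q p c : c < nth 0 lam p ->
  nth 0 (nth [::] (syt_rows Q) p) c = syt_entry Q (p, c).
Proof. by move=> lt; rewrite nth_syt_rows (nth_map 0) ?size_iota // nth_iota. Qed.

Lemma syt_rows_tab Q : is_tab (syt_rows Q).
Proof.
have [inj _ hr hc] := SYT_spec Q; have /andP[/andP[_ lpos] _] := lam_part.
have sz p : size (nth [::] (syt_rows Q) p) = nth 0 lam p by rewrite nth_syt_rows size_map size_iota.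
have sT : size (syt_rows Q) = size lam by rewrite size_map size_iota.
apply/and3P; split.
- apply/(all_nthP [::]) => p lt; apply/(sortedP 0) => c; rewrite sz => ltc.
  rewrite !nth_syt_row ?(ltn_trans (ltnSn c)) //.
  have [a ea] := SYT_onto Q ltc; have [b eb] := SYT_onto Q (ltn_trans (ltnSn c) ltc).
  by rewrite -ea -eb !syt_entry_tpos ltnW // hr ?ea ?eb.
- apply/(sortedP [::]) => p lt; apply: domP; rewrite !sz ?lam_mono // => c ltc.
  have ltc' : c < nth 0 lam p by apply: leq_trans ltc (lam_mono _).
  rewrite !nth_syt_row //.
  have [a ea] := SYT_onto Q ltc; have [b eb] := SYT_onto Q ltc'.
  by rewrite -ea -eb !syt_entry_tpos hc ?ea ?eb.
apply/(all_nthP [::]) => p; rewrite sT -size_eq0 sz -lt0n => lt.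
by apply: (allP lpos); apply: mem_nth.
Qed.

Lemma syt_rows_pos Q : tab_is (syt_rows Q) (val Q).
Proof.
have [inj h2 _ _] := SYT_spec Q => a.
have rowP p : (nat_of_ord a \in nth [::] (syt_rows Q) p) = (p == (tpos (val Q) a).1).
  rewrite nth_syt_rows; apply/mapP/eqP => [[c] | ->]; last first.
    by exists (tpos (val Q) a).2; rewrite ?mem_iota ?h2 // -surjective_pairing syt_entry_tpos.
  rewrite mem_iota => /= lt; have [b eb] := SYT_onto Q lt.
  by rewrite -eb syt_entry_tpos => /val_inj ->; rewrite -[LHS]/((p, c).1) -eb.
rewrite (@pos_ofP _ _ (tpos (val Q) a).1) ?rowP ?eqxx //; last first.
  by move=> q lt; rewrite rowP (ltn_eqF lt).
rewrite [RHS]surjective_pairing; congr (_, _).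
have -> : nat_of_ord a = nth 0 (nth [::] (syt_rows Q) (tpos (val Q) a).1) (tpos (val Q) a).2.
  by rewrite nth_syt_row ?h2 // -surjective_pairing syt_entry_tpos.
rewrite index_uniq //; first by rewrite nth_syt_rows size_map size_iota.
rewrite nth_syt_rows map_inj_in_uniq ?iota_uniq // => c d; rewrite !mem_iota /= => lc ld.
have [b eb] := SYT_onto Q lc; have [b' eb'] := SYT_onto Q ld.
by rewrite -eb -eb' !syt_entry_tpos => /val_inj ebb; move: eb; rewrite ebb eb' => -[].
Qed.

(** The column reading word inserts to the tableau, and standardness makes this word a
    permutation. *)
Lemma SYT_Ptab (Q : SYT r lam) : exists x, tab_is (Ptab x) (val Q) /\ map size (Ptab x) = lam.
Proof.
have tT := syt_rows_tab Q; have [inj h2 _ _] := SYT_spec Q.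
set n := size (head [::] (syt_rows Q)).
have eT := insw_colread tT (leqnn n).
have [|x ex] := @wd_ex (colread n (syt_rows Q)).
  apply: perm_trans (insw_perm _) _; rewrite eT /rowread.
  have uf : uniq (flatten (syt_rows Q)).
    have -> : flatten (syt_rows Q) = [seq syt_entry Q p | p <- [seq (p, c) | p <- iota 0 (size lam), c <- iota 0 (nth 0 lam p)]].
      by rewrite map_flatten -map_comp; congr flatten; apply: eq_map => p /=; rewrite -map_comp.
    rewrite map_inj_in_uniq.
      by apply: allpairs_uniq_dep => [|p _|[p c] [p' c'] _ _ [-> ->]]; rewrite ?iota_uniq.
    move=> p q /allpairsPdep[p1 [c1 [_ + ep]]] /allpairsPdep[q1 [d1 [_ + eq]]].
    rewrite !mem_iota /= ep eq => lc ld.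
    have [b eb] := SYT_onto Q lc; have [b' eb'] := SYT_onto Q ld.
    by rewrite -eb -eb' !syt_entry_tpos => /val_inj ->.
  have pf : perm_eq (flatten (rev (syt_rows Q))) (flatten (syt_rows Q)).
    by apply: perm_flatten; rewrite perm_rev.
  apply: perm_trans pf _; apply: uniq_perm; rewrite ?iota_uniq // => m.
  rewrite mem_iota /= add0n; apply/flattenP/idP => [[row /mapP[p _ ->] /mapP[c]]|lt].
    by rewrite mem_iota /= => lt ->; have [b <-] := SYT_onto Q lt; rewrite syt_entry_tpos.
  exists (nth [::] (syt_rows Q) (tpos (val Q) (Ordinal lt)).1).
    apply: mem_nth; rewrite size_map size_iota ltnNge; apply/negP => le.
    by have := h2 (Ordinal lt); rewrite nth_default.
  rewrite nth_syt_rows; apply/mapP; exists (tpos (val Q) (Ordinal lt)).2; rewrite ?mem_iota ?h2 //.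
  by rewrite -surjective_pairing syt_entry_tpos.
exists x; rewrite PtabE ex eT; split; first exact: syt_rows_pos.
apply: (@eq_from_nth _ 0); rewrite !size_map size_iota // => p lt.
by rewrite (nth_map [::]) ?size_map ?size_iota // nth_syt_rows size_map size_iota.
Qed.

Lemma cells_before (u : seq nat) k p q : k < size u ->
  p <= (nth (0, 0) (cells u) k).1 -> q <= (nth (0, 0) (cells u) k).2 ->
  (p, q) != nth (0, 0) (cells u) k -> (p, q) \in take k (cells u).
Proof.
move=> ku; rewrite -{1 2 3 4}(cat_take_drop k u) (drop_nth 0 ku) /cells cellsT_cat nth_cat size_cellsT.
rewrite size_takel ?(ltnW ku) // ltnn subnn /= => pi qc ne.
rewrite take_size_cat; last by rewrite size_cellsT size_takel // ltnW.
by rewrite mem_cells; apply: added_cell_corner pi qc ne; apply: insw_tab.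
Qed.

Lemma mem_take_index (T : eqType) (s : seq T) k e : e \in take k s -> index e s < k.
Proof.
move=> h; rewrite -(cat_take_drop k s) index_cat h.
by apply: leq_trans (_ : size (take k s) <= k); rewrite ?index_mem // size_take_min geq_minl.
Qed.

Lemma pcell_before w i j : (pcell w i).1 <= (pcell w j).1 -> (pcell w i).2 <= (pcell w j).2 ->
  pcell w i != pcell w j -> i < j.
Proof.
move=> h1 h2 ne; have sz (k : 'I_r) : k < size (wd w) by rewrite size_wd.
have := @cells_before (wd w) j (pcell w i).1 (pcell w i).2 (sz j) h1 h2.
rewrite -surjective_pairing => /(_ ne) /mem_take_index.
by rewrite /pcell index_uniq ?cells_uniq // size_cellsT.
Qed.

(** The cells above, or to the left of, the cell of [i] were added earlier, so there are at most [i]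
    of them. This fits the encoding of positions by pairs of ordinals. *)
Lemma pcell_bound w i : (pcell w i).1 < r /\ (pcell w i).2 < r.
Proof.
have ir : nat_of_ord i < size (wd w) by rewrite size_wd.
have sz : size (take i (cells (wd w))) = i by rewrite size_takel // size_cellsT ltnW.
split; apply: leq_ltn_trans (ltn_ord i); rewrite -[X in _ <= X]sz.
  rewrite -(size_iota 0 (pcell w i).1) -(size_map (fun p => (p, (pcell w i).2))).
  apply: uniq_leq_size; first by rewrite map_inj_uniq ?iota_uniq // => p p' [].
  move=> _ /mapP[p + ->]; rewrite mem_iota /= add0n => lt.
  by apply: cells_before => //; [apply: ltnW|rewrite [X in _ != X]surjective_pairing xpair_eqE (ltn_eqF lt)].
rewrite -(size_iota 0 (pcell w i).2) -(size_map (fun p => ((pcell w i).1, p))).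
apply: uniq_leq_size; first by rewrite map_inj_uniq ?iota_uniq // => p p' [].
move=> _ /mapP[p + ->]; rewrite mem_iota /= add0n => lt.
by apply: cells_before => //; [apply: ltnW|rewrite [X in _ != X]surjective_pairing xpair_eqE (ltn_eqF lt) andbF].
Qed.

Lemma pcell_inj w : injective (pcell w).
Proof.
move=> i j /eqP; rewrite nth_uniq ?cells_uniq ?size_cellsT ?size_wd // => /eqP.
exact: val_inj.
Qed.

Lemma Qtab_SYT w : map size (Ptab w) = lam -> exists Q : SYT r lam, tab_is (Qtab w) (val Q).
Proof.
move=> es; pose f : tab r := [ffun i => (Ordinal (proj1 (pcell_bound w i)), Ordinal (proj2 (pcell_bound w i)))].
have ft a : tpos f a = pcell w a by rewrite /tpos ffunE /= -surjective_pairing.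
have fS : is_SYT lam f.
  apply/andP; split; first (apply/andP; split; first (apply/andP; split)).
  - apply/forallP => a; apply/forallP => b; apply/implyP; rewrite !ft => /eqP /pcell_inj ->.
    by rewrite eqxx.
  - apply/forallP => a; rewrite ft.
    have : pcell w a \in cells (wd w) by rewrite mem_nth // size_cellsT size_wd.
    rewrite [pcell w a]surjective_pairing mem_cells -PtabE /rsz -es => lt.
    have [h|h] := ltnP (pcell w a).1 (size (Ptab w)); first by rewrite (nth_map [::]).
    by move: lt; rewrite nth_default.
  - apply/forallP => a; apply/forallP => b; apply/implyP; rewrite !ft => /andP[/eqP e lt].
    apply: (@pcell_before w); rewrite ?e // ?(ltnW lt) //.
    by apply/eqP => e'; rewrite e' ltnn in lt.
  apply/forallP => a; apply/forallP => b; apply/implyP; rewrite !ft => /andP[/eqP e lt].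
  apply: (@pcell_before w); rewrite ?e // ?(ltnW lt) //.
  by apply/eqP => e'; rewrite e' ltnn in lt.
by exists (exist _ f fS) => a; rewrite pos_of_Qtab ft.
Qed.

Lemma tab_is_Qtab_inj w x (Q : SYT r lam) : tab_is (Qtab w) (val Q) -> tab_is (Qtab x) (val Q) -> Qtab w = Qtab x.
Proof.
by move=> h1 h2; apply/Qtab_cells/cells_eq => i; rewrite -!pos_of_Qtab h1 h2.
Qed.

Lemma tabT_is_wz w (Q : SYT r lam) : tabT_is (Qtab (wz w)) (val Q) <-> tab_is (Qtab w) (val Q).
Proof.
split=> h a; have := h a; rewrite !pos_of_Qtab pcell_wz /swap /= -surjective_pairing //.
Qed.

Lemma southR_desc w (Q : SYT r lam) i j : adj i j -> tab_is (Qtab w) (val Q) -> southR Q i j = desc w i j.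
Proof.
move=> ij h; rewrite /southR -!h !pos_of_Qtab.
have [d|nd] := boolP (desc w i j); first by case: (pcell_desc ij d).
by have [_ le] := pcell_asc ij nd; rewrite ltnNge le.
Qed.

Lemma eastR_desc w (Q : SYT r lam) i j : adj i j -> tab_is (Qtab w) (val Q) -> eastR Q i j = ~~ desc w i j.
Proof.
move=> ij h; rewrite /eastR -!h !pos_of_Qtab.
have [d|nd] := boolP (desc w i j); last by case: (pcell_asc ij nd).
by have [_ le] := pcell_desc ij d; rewrite ltnNge le.
Qed.

(** The descent conditions put the structure constant in its [mu] branch, the only one that reveals
    [mu]. *)
Lemma mu_Qtab w' w (v' v : perm_r) i j : adj i j -> Ptab w' = Ptab w -> Ptab v' = Ptab v ->
  Qtab w' = Qtab v' -> Qtab w = Qtab v -> desc w' i j -> ~~ desc w i j -> mu v' v = mu w' w.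
Proof.
move=> ij eP eP' eQ' eQ d nd; have := bcoef_Qtab ij eP eP' eQ' eQ.
have dQ x y : Qtab x = Qtab y -> desc x i j = desc y i j.
  move=> /Qtab_eqP e; have pe a : pcell x a = pcell y a by rewrite /pcell e.
  have [dx|ndx] := boolP (desc x i j); have [dy|ndy] := boolP (desc y i j) => //.
    by have [lt _] := pcell_desc ij dx; have [_] := pcell_asc ij ndy; rewrite -!pe leqNgt lt.
  by have [lt _] := pcell_desc ij dy; have [_] := pcell_asc ij ndx; rewrite !pe leqNgt lt.
by rewrite /bcoef -(dQ _ _ eQ) -(dQ _ _ eQ') d (negbTE nd) => /intK_inj ->.
Qed.

Lemma mu_upE (Q' Q : SYT r lam) w' w i j : adj i j -> Ptab w' = Ptab w ->
  tab_is (Qtab w') (val Q') -> tab_is (Qtab w) (val Q) -> desc w' i j -> ~~ desc w i j ->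
  mu_up Q' Q = mu w' w.
Proof.
move=> ij eP h' h d nd; apply: the_eq; first by exists w', w.
move=> _ [v' [v [eP' [g' [g ->]]]]]; apply: (mu_Qtab ij) => //; exact: tab_is_Qtab_inj.
Qed.

Lemma mu_lowE (Q' Q : SYT r lam) w' w i j : adj i j -> Ptab w' = Ptab w ->
  tab_is (Qtab w') (val Q') -> tab_is (Qtab w) (val Q) -> ~~ desc w' i j -> desc w i j ->
  mu_low Q' Q = mu (wz w') (wz w).
Proof.
move=> ij eP h' h d nd; apply: the_eq.
  by exists (wz w'), (wz w); split; [exact: Ptab_wz|rewrite !tabT_is_wz].
move=> _ [v' [v [eP' [g' [g ->]]]]].
(* Write the competing pair as [wz] of another pair, so that the transposed tableaux become ordinary
   recording tableaux. *)
rewrite -[v']wzK tabT_is_wz in g'; rewrite -[v]wzK tabT_is_wz in g.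
have Qwz x y : Qtab (wz x) = Qtab (wz y) <-> Qtab x = Qtab y.
  split=> /Qtab_eqP e; apply/Qtab_cells/cells_eq => a; have := congr1 (fun s => nth (0, 0) s a) e.
    by rewrite -!/(pcell _ _) !pcell_wz /swap => -[e1 e2]; rewrite [LHS]surjective_pairing e1 e2 -surjective_pairing.
  by rewrite -!/(pcell _ _) !pcell_wz => ->.
apply: (mu_Qtab ij) => //; try exact: Ptab_wz; rewrite ?desc_wz ?negbK //.
  by rewrite -[v']wzK Qwz; apply: tab_is_Qtab_inj g'.
by rewrite -[v]wzK Qwz; apply: tab_is_Qtab_inj g.
Qed.

Lemma cell_param (Q0 : SYT r lam) : exists (P : seq (seq nat)) (w : SYT r lam -> perm_r),
  [/\ injective w, forall Q, Ptab (w Q) = P, forall x, Ptab x = P -> exists Q, x = w Q &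
      forall Q, tab_is (Qtab (w Q)) (val Q)].
Proof.
have [x0 [_ sx0]] := SYT_Ptab Q0.
have /fin_all_exists [w hw] : forall Q : SYT r lam, exists w : perm_r, Ptab w = Ptab x0 /\ tab_is (Qtab w) (val Q).
  move=> Q; have [y [ty sy]] := SYT_Ptab Q.
  have [|w [eP eQ]] := @Ptab_of_shape _ x0 y; first by rewrite sx0 sy.
  by exists w; rewrite eP eQ.
exists (Ptab x0), w; split=> [Q Q' e|Q|x ex|Q]; try by case: (hw Q).
  have [_ h] := hw Q; have [_ h'] := hw Q'; apply/val_inj/ffunP => a.
  have : tpos (val Q) a = tpos (val Q') a by rewrite -h -h' e.
  by rewrite /tpos => -[/val_inj e1 /val_inj e2]; rewrite [LHS]surjective_pairing e1 e2 -surjective_pairing.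
have [|Q hQ] := @Qtab_SYT x; first by rewrite ex.
by exists Q; have [eP h] := hw Q; apply: PQ_inj; rewrite ?eP //; apply: tab_is_Qtab_inj hQ h.
Qed.
End SYTs.

(** * Intertwiners at u = 0 *)

Section Solutions.
Variables (r : nat) (I : finType) (v : I -> perm_r r).
Hypothesis v_inj : injective v.
Hypothesis v_Ptab : forall a b, Ptab (v a) = Ptab (v b).
Hypothesis v_onto : forall a x, Ptab x = Ptab (v a) -> exists b, x = v b.
Implicit Types (S : I -> I -> K) (N : I -> I -> {poly rat}) (a b c : I) (i j k l : 'I_r).

Definition cell_coef i j a b : K := bcoef i j (v a) (v b).

Definition intertwines S := forall i j, adj i j -> forall a b,
  \sum_c S a c * cell_coef i j c b = \sum_c cell_coef i j c a * S c b.

Lemma barK_cell_coef i j a b : barK (cell_coef i j a b) = cell_coef i j a b.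
Proof.
rewrite /cell_coef /bcoef; case: (desc _ _ _); first by rewrite rmorphM rmorph_nat /= barK_two.
by case: (desc _ _ _); rewrite ?rmorph_int ?rmorph0.
Qed.

Lemma intertwines_bar S : intertwines S -> intertwines (fun a b => barK (S a b)).
Proof.
move=> h i j ij a b; have := congr1 barK (h i j ij a b); rewrite !rmorph_sum /=.
under eq_bigr do rewrite rmorphM /= barK_cell_coef.
by under [in RHS]eq_bigr do rewrite rmorphM /= barK_cell_coef.
Qed.

Lemma intertwinesZ (e : K) S : intertwines S -> intertwines (fun a b => e * S a b).
Proof.
move=> h i j ij a b; under eq_bigr do rewrite -mulrA.
under [in RHS]eq_bigr do rewrite mulrCA.
by rewrite -!mulr_sumr h.
Qed.

Lemma intertwinesB S S' : intertwines S -> intertwines S' -> intertwines (fun a b => S a b - S' a b).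
Proof.
move=> h h' i j ij a b; under eq_bigr do rewrite mulrBl.
under [in RHS]eq_bigr do rewrite mulrBr.
by rewrite !sumrB h // h'.
Qed.

Lemma eq_intertwines S S' : (forall a b, S a b = S' a b) -> intertwines S -> intertwines S'.
Proof.
move=> e h i j ij a b; under eq_bigr do rewrite -e.
by under [in RHS]eq_bigr do rewrite -e; apply: h.
Qed.

Definition muQ a b : rat := (mu (v a) (v b))%:~R.

Lemma toK_muQ a b : toK (muQ a b)%:P = (mu (v a) (v b))%:~R.
Proof. by rewrite /muQ !rmorph_int. Qed.

Lemma two_toK : uK * two = toK ('X^2 + 1).
Proof. by rewrite /two mulrDr mulfV ?uK_neq0 // rmorphD rmorph1 rmorphXn /= -uK_X expr2. Qed.

(** One side of the relation collapses to [[2]] times a single entry, and the factor [u] makes the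
    equation polynomial. The twin [intertwines_desc_r] collapses the other side. *)
Lemma intertwines_desc_l N i j a b : intertwines (fun a b => toK (N a b)) -> adj i j ->
  desc (v b) i j -> ~~ desc (v a) i j ->
  ('X^2 + 1) * N a b = 'X * \sum_(c | desc (v c) i j) (muQ c a)%:P * N c b.
Proof.
move=> h ij db /negbTE da; apply: toK_inj; rewrite !toKM -uK_X -two_toK -mulrA rmorph_sum /=.
congr (_ * _); have := h i j ij a b.
rewrite (bigD1 b) //= big1 ?addr0 => [|c cb]; last first.
  by rewrite /cell_coef /bcoef db (inj_eq v_inj) (negbTE cb) mul0r mulr0.
rewrite {1}/cell_coef /bcoef db eqxx mul1r mulrC => ->.
rewrite [RHS]big_mkcond; apply: eq_bigr => c _.
rewrite /cell_coef /bcoef da; case: (desc _ _ _); last by rewrite mul0r.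
by rewrite toKM toK_muQ.
Qed.

Lemma intertwines_desc_r N i j a b : intertwines (fun a b => toK (N a b)) -> adj i j ->
  ~~ desc (v b) i j -> desc (v a) i j ->
  ('X^2 + 1) * N a b = 'X * \sum_(c | desc (v c) i j) (muQ c b)%:P * N a c.
Proof.
move=> h ij /negbTE db da; apply: toK_inj; rewrite !toKM -uK_X -two_toK -mulrA rmorph_sum /=.
congr (_ * _); have := h i j ij a b.
rewrite [RHS](bigD1 a) //= [X in _ = _ + X]big1 ?addr0 => [|c cb]; last first.
  by rewrite /cell_coef /bcoef da (inj_eq v_inj) (negbTE cb) !mul0r.
have -> : cell_coef i j a a = two by rewrite /cell_coef /bcoef da eqxx mul1r.
move=> <-.
rewrite [RHS]big_mkcond; apply: eq_bigr => c _.
rewrite /cell_coef /bcoef db; case: (desc _ _ _); last by rewrite mulr0.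
by rewrite toKM toK_muQ mulrC.
Qed.

Lemma coef01_eq (p q : {poly rat}) : ('X^2 + 1) * p = 'X * q -> p`_0 = 0 /\ p`_1 = q`_0.
Proof.
move=> e; have e0 := congr1 (fun p : {poly rat} => p`_0) e; have e1 := congr1 (fun p : {poly rat} => p`_1) e.
by move: e0 e1; rewrite /= mulrDl mul1r !coefD !coefXM !coefXnM /= !add0r.
Qed.

Lemma intertwines_coef0_desc N : intertwines (fun a b => toK (N a b)) ->
  forall a b, (N a b)`_0 != 0 -> same_desc (v a) (v b).
Proof.
move=> h a b n0 i j ij; apply/idP/idP => d; apply: contraNT n0 => nd.
  by have [-> _] := coef01_eq (intertwines_desc_r h ij nd d).
by have [-> _] := coef01_eq (intertwines_desc_l h ij d nd).
Qed.

(** The coefficient of [u] in [N a b'] is computed twice. The relation for [t] gives the constant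
    term at [(a', b')], the one for [s] that at [(a, b)], as each sum reduces to the star
    partner. *)
Lemma intertwines_coef0_rstar N i j k l a b a' b' : intertwines (fun a b => toK (N a b)) ->
  nbr i j k l -> star_dom i j k l (v a) -> star_dom i j k l (v b) ->
  v a' = rstar i j k l (v a) -> v b' = rstar i j k l (v b) ->
  (N a' b')`_0 = (N a b)`_0.
Proof.
move=> h nb da db ea eb; have /and3P[ij kl _] := nb; have sd := intertwines_coef0_desc h.
have db' : star_dom k l i j (v b') by rewrite eb rstar_dom.
have [/andP[a_ij a_kl] /andP[b_kl b_ij]] := (da, db').
have [_ e1] := coef01_eq (intertwines_desc_l h kl b_kl a_kl).
have [_ e2] := coef01_eq (intertwines_desc_r h ij b_ij a_ij).
have dl c : (N c b')`_0 != 0 -> star_dom k l i j (v c).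
  by move=> /sd e; rewrite /star_dom !e //; apply/andP.
have dr c : (N a c)`_0 != 0 -> star_dom i j k l (v c).
  by move=> /sd e; rewrite /star_dom -!e //; apply/andP.
have sumE (J : pred I) (q : I -> {poly rat}) (m : I -> rat) c0 :
    (forall c, J c -> (q c)`_0 != 0 -> m c = (c == c0)%:R) ->
    (~~ J c0 -> (q c0)`_0 = 0) -> (\sum_(c | J c) (m c)%:P * q c)`_0 = (q c0)`_0.
  move=> hm hJ; rewrite coef_sum big_mkcond (bigD1 c0) //= big1 ?addr0 => [|c cc].
    have [Jc|/hJ //] := boolP (J c0); rewrite coefCM.
    by have [->|/(hm _ Jc) ->] := eqVneq (q c0)`_0 0; rewrite ?mulr0 ?eqxx ?mul1r.
  case: ifP => // Jc; rewrite coefCM; have [->|/(hm _ Jc) ->] := eqVneq (q c)`_0 0.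
    by rewrite mulr0.
  by rewrite (negbTE cc) mul0r.
rewrite (@sumE _ _ _ a') in e1; last first.
- by apply: contraNeq => /dl /andP[].
- move=> c dc /dl sc; rewrite /muQ (mu_rstar nb da sc) -ea (inj_eq v_inj).
  by case: (_ == _).
rewrite (@sumE _ _ _ b) in e2; last first.
- by apply: contraNeq => /dr /andP[].
- move=> c dc /dr sc; rewrite /muQ muC (mu_rstar nb sc db').
  have -> : (v b' == rstar i j k l (v c)) = (c == b).
    rewrite eb -(inj_eq v_inj); apply/eqP/eqP => [e|-> //].
    by rewrite -(rstarK nb sc) -e rstarK.
  by case: (_ == _).
by rewrite -e1 -e2.
Qed.

Lemma rstar_in_cell i j k l a : nbr i j k l -> star_dom i j k l (v a) ->
  exists a', v a' = rstar i j k l (v a).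
Proof.
move=> nb d; have [|a' ->] := @v_onto a (rstar i j k l (v a)); last by exists a'.
symmetry; apply/connect_rstepP/connect1/rstepP; by exists i, j, k, l.
Qed.

(* At [u = 0] a solution links only elements with equal descent sets and is compatible with right stars,
   so [tau_invariant] makes it diagonal and connectedness of the cell under stars makes it scalar. *)
Lemma intertwines_coef0 N a0 : intertwines (fun a b => toK (N a b)) ->
  forall a b, (N a b)`_0 = (a == b)%:R * (N a0 a0)`_0.
Proof.
move=> h; have sd := intertwines_coef0_desc h.
have offdiag a b : (N a b)`_0 != 0 -> a = b.
  move=> nab; apply/v_inj/PQ_inj; first exact: v_Ptab.
  pose R x y := exists a b, [/\ v a = x, v b = y & (N a b)`_0 != 0 \/ (N b a)`_0 != 0].
  apply: (@tau_invariant r R); last by exists a, b; split=> //; left.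
  - by move=> x y [c [d [ec ed cd]]]; exists d, c; split=> //; case: cd; [right | left].
  - move=> x y [c [d [<- <- [/sd //|/sd e]]]] i j ij; by rewrite e.
  move=> x y i j k l [c [d [<- <- cd]]] nb dc.
  have sdcd : same_desc (v c) (v d) by case: cd => /sd // e i' j' ij; rewrite e.
  have dd : star_dom i j k l (v d) by rewrite -(same_desc_dom sdcd nb).
  have [c' ec] := rstar_in_cell nb dc; have [d' ed] := rstar_in_cell nb dd.
  exists c', d'; split=> //.
  rewrite (intertwines_coef0_rstar h nb dc dd ec ed).
  by rewrite (intertwines_coef0_rstar h nb dd dc ed ec).
move=> a b; have [->|ab] := eqVneq a b; last first.
  by rewrite mul0r; apply/eqP; apply: contraNT ab => /offdiag ->.
rewrite mul1r; have /connect_rstepP/connectP[p] := v_Ptab a0 b.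
elim: p a0 => [|x p IH] a1 /=; first by move=> _ /v_inj ->.
case/andP => /rstepP[i [j [k [l [nb d ex]]]]] xp e.
have [a' ea'] := rstar_in_cell nb d.
rewrite (IH a') ?ea' -?ex //; exact: (intertwines_coef0_rstar h nb d d ea' ea').
Qed.

(** Clear denominators, then divide by [u] as long as the common diagonal value at 0 vanishes; the
    size of a fixed nonzero entry bounds the number of divisions. *)
Lemma intertwines_normal S a0 b0 : intertwines S -> S a0 b0 != 0 ->
  exists (e : K) (M : I -> I -> {poly rat}), [/\ e != 0,
    forall a b, S a b = e * toK (M a b) & forall a b, (M a b)`_0 = (a == b)%:R].
Proof.
move=> h n0; have [d [n [d0 dn]]] := common_denom (fun p : I * I => S p.1 p.2).
have toKd0 : toK d != 0 by rewrite toK_eq0.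
suff {d n d0 dn toKd0} main m : forall (e : K) N, e != 0 -> (forall a b, S a b = e * toK (N a b)) ->
    (size (N a0 b0) <= m)%N -> exists (e : K) (M : I -> I -> {poly rat}), [/\ e != 0,
    forall a b, S a b = e * toK (M a b) & forall a b, (M a b)`_0 = (a == b)%:R].
  apply: (main _ (toK d)^-1 (fun a b => n (a, b))) (leqnn _) => [|a b].
    by rewrite invr_eq0.
  by rewrite mulrC (dn (a, b)).
elim: m => [|m IH] e N e0 eN sN.
  by move: n0; rewrite eN; move: sN; rewrite leqn0 size_poly_eq0 => /eqP ->; rewrite rmorph0 mulr0 eqxx.
have hN : intertwines (fun a b => toK (N a b)).
  apply: eq_intertwines (intertwinesZ e^-1 h) => a b.
  by rewrite eN mulKf.
have N0 := intertwines_coef0 a0 hN.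
have [z|nz] := eqVneq (N a0 a0)`_0 0; last first.
  have c0 : ((N a0 a0)`_0)%:P != 0 by rewrite polyC_eq0.
  have Kc0 : toK ((N a0 a0)`_0)%:P != 0 by rewrite toK_eq0.
  exists (e * toK ((N a0 a0)`_0)%:P), (fun a b => ((N a0 a0)`_0)^-1%:P * N a b); split=> [|a b|a b].
  - exact: mulf_neq0 e0 Kc0.
  - by rewrite -mulrA -toKM mulrA -polyCM mulfV // mul1r.
  by rewrite coefCM (N0 a b) mulrCA mulVf // mulr1.
(* If one diagonal entry vanishes at 0 then so does the whole matrix, which is therefore divisible
   by [u]. *)
have NX a b : N a b = 'X * (N a b %/ 'X).
  rewrite mulrC divpK //; rewrite -['X]subr0 -polyC0 dvdp_XsubCl.
  by rewrite /root horner_coef0 N0 z mulr0.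
apply: (IH (e * uK) (fun a b => N a b %/ 'X)) => [|a b|].
- exact: mulf_neq0 e0 uK_neq0.
- by rewrite -mulrA uK_X -toKM -NX.
have := sN; rewrite {1}NX mulrC size_mulX //.
by apply: contra_neq n0 => z0; rewrite eN NX z0 mulr0 rmorph0 mulr0.
Qed.

Lemma intertwines_diag_neq0 S a0 b0 : intertwines S -> S a0 b0 != 0 -> forall a, S a a != 0.
Proof.
move=> h n0 a; have [e [M [e0 -> M0]]] := intertwines_normal h n0.
apply: (mulf_neq0 e0); rewrite toK_eq0; apply/eqP => z; have := M0 a a; rewrite z coef0 eqxx => /eqP.
by rewrite eq_sym oner_eq0.
Qed.

Lemma intertwines_diag_eq0 S a0 : intertwines S -> S a0 a0 = 0 -> forall a b, S a b = 0.
Proof.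
move=> h z a b; apply/eqP; apply: contraT => n0.
by have := intertwines_diag_neq0 h n0 a0; rewrite z eqxx.
Qed.

(** The involution exchanges 0 and infinity: reversal in a common degree bound [n] moves constant
    terms to index [n], and the reversed denominator has exact degree [n]. *)
Lemma evalKinf_barK (p q : {poly rat}) : q.[0] != 0 ->
  evalKinf (barK (toK p / toK q)) (p.[0] / q.[0]).
Proof.
rewrite !horner_coef0 => q0; have qn0 : q != 0 by apply: contraNneq q0 => ->; rewrite coef0.
pose n := (size p + size q)%N.
have sp : (size p <= n.+1)%N by rewrite /n; lia.
have sq : (size q <= n.+1)%N by rewrite /n; lia.
have c0 (f : {poly rat}) : (rev_poly n f)`_n = f`_0 by rewrite coef_poly ltnSn subnn.
have srq : size (rev_poly n q) = n.+1 by rewrite size_poly_eq // subnn.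
exists (rev_poly n p), (rev_poly n q); split; [|split; [|split]].
- by rewrite -size_poly_eq0 srq.
- by rewrite srq size_poly.
- rewrite barK_frac // !toK_rev //.
  by rewrite -mulf_div divff ?mul1r // expf_neq0 // uK_neq0.
by rewrite /lead_coef srq /= !c0.
Qed.

Lemma intertwines_good S a0 : intertwines S -> S a0 a0 != 0 ->
  forall a b, let x := (S a0 a0)^-1 * S a b in
    barK x = x /\ evalK0 x (a == b)%:R /\ evalKinf x (a == b)%:R.
Proof.
move=> h n0 a b x; have [e [M [e0 eM M0]]] := intertwines_normal h n0.
have ex : x = toK (M a b) / toK (M a0 a0).
  by rewrite /x !eM invfM mulrC mulrACA divff // mul1r.
have M00 : (M a0 a0).[0] = 1 by rewrite horner_coef0 M0 eqxx.
have Mab : (M a b).[0] = (a == b)%:R by rewrite horner_coef0 M0.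
(* The normalized solution and its image under the bar both have entry 1 at [(a0, a0)]; their
   difference is a solution with a zero diagonal entry, hence zero. *)
have bx : barK x = x.
  have hS := intertwinesZ (S a0 a0)^-1 h.
  have hB := intertwinesB (intertwines_bar hS) hS.
  apply/eqP; rewrite -subr_eq0; apply/eqP; apply: (intertwines_diag_eq0 hB (a0 := a0)).
  by rewrite (mulVf n0) rmorph1 subrr.
split=> //; split; last rewrite -bx ex.
  by exists (M a b), (M a0 a0); rewrite M00 Mab divr1 oner_eq0.
have := @evalKinf_barK (M a b) (M a0 a0).
by rewrite M00 Mab divr1 oner_eq0; apply.
Qed.

(** The normalized polynomial matrix is the identity at [u = 0], so its determinant does not vanish
    there. *)
Lemma intertwines_inv S a0 : intertwines S -> S a0 a0 != 0 ->
  exists T : I -> I -> K, forall a b,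
    \sum_c S a c * T c b = (a == b)%:R /\ \sum_c T a c * S c b = (a == b)%:R.
Proof.
move=> h n0; have [e [M [e0 eM M0]]] := intertwines_normal h n0.
pose A : 'M[{poly rat}]_#|I| := \matrix_(i, j) M (enum_val i) (enum_val j).
have detA : \det A != 0.
  apply/eqP => /(congr1 (horner_eval 0)); rewrite -det_map_mx /= [RHS]horner0.
  have -> : map_mx (horner_eval 0) A = 1%:M.
    apply/matrixP => i j; rewrite !mxE /horner_eval horner_coef0 M0.
    by rewrite (inj_eq enum_val_inj).
  by rewrite det1 => /eqP; rewrite oner_eq0.
pose B := map_mx toK A.
have uB : B \in unitmx by rewrite unitmxE det_map_mx unitfE /= toK_eq0.
exists (fun a b => e^-1 * invmx B (enum_rank a) (enum_rank b)) => a b.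
have ent (c d : I) : S c d = e * B (enum_rank c) (enum_rank d).
  by rewrite eM !mxE !enum_rankK.
have fold (X Y : 'M[K]_#|I|) : \sum_c X (enum_rank a) (enum_rank c) * Y (enum_rank c) (enum_rank b) = (X *m Y) (enum_rank a) (enum_rank b).
  by rewrite mxE (reindex enum_rank) //; apply: onW_bij; apply: enum_rank_bij.
split.
  under eq_bigr do rewrite ent mulrACA (mulfV e0) mul1r.
  by rewrite fold (mulmxV uB) mxE (inj_eq enum_rank_inj).
under eq_bigr do rewrite ent mulrACA (mulVf e0) mul1r.
by rewrite fold (mulVmx uB) mxE (inj_eq enum_rank_inj).
Qed.
End Solutions.

(** * Existence of an intertwiner *)

Section Projection.
Variable r : nat.
Implicit Types (h a b : hecke r) (f g : perm_r r -> K) (x y z : perm_r r).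
Local Notation C := (@KLlow r).

Definition KLspan f : hecke r := \sum_x hscale (f x) (C x).

Lemma hdotDr h a b : hdot h (a + b) = hdot h a + hdot h b.
Proof. by rewrite -big_split; apply: eq_bigr => x _; rewrite ffunE mulrDr. Qed.

Lemma hdot_KLspan h f : hdot h (KLspan f) = \sum_x f x * hdot h (C x).
Proof. by rewrite hdot_linear; apply: eq_bigr => x _; rewrite hdotZ. Qed.

Lemma hdot_self_eq0 h : hdot h h = 0 -> h = 0.
Proof.
move=> h0; apply/ffunP => x; rewrite ffunE; apply: (sum_sqr_eq0 (a := h)).
by rewrite -[RHS]h0 /hdot; apply: eq_bigr => y _; rewrite expr2.
Qed.

Lemma KLspan_lin f g (t : K) : KLspan (fun x => f x + t * g x) = KLspan f + hscale t (KLspan g).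
Proof.
rewrite /KLspan hscale_sumr -big_split; apply: eq_bigr => x _.
by rewrite hscaleDl hscaleA.
Qed.

Lemma KLspan_delta z : KLspan (fun x => (x == z)%:R) = C z.
Proof.
rewrite /KLspan (bigD1 z) //= eqxx hscale1 big1 ?addr0 // => x /negbTE ->.
by rewrite hscale0l.
Qed.

(** Gram-Schmidt, one vector at a time, keeping the coefficients on the canonical basis. *)
Lemma orthogonal_projection (s : seq (perm_r r)) h : exists f,
  (forall z, z \notin s -> f z = 0) /\ forall z, z \in s -> hdot (h - KLspan f) (C z) = 0.
Proof.
elim: s h => [|z0 s IH] h; first by exists (fun=> 0).
have [f [f0 fo]] := IH h; have [g [g0 go]] := IH (C z0).
pose w := C z0 - KLspan g; pose t := hdot (h - KLspan f) w / hdot w w.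
exists (fun x => f x + t * ((x == z0)%:R + -1 * g x)); split=> [z|].
  rewrite inE negb_or => /andP[/negbTE -> zs].
  by rewrite (f0 _ zs) (g0 _ zs) mulr0 mulr0n addr0 mulr0 addr0.
have -> : KLspan (fun x => f x + t * ((x == z0)%:R + -1 * g x)) = KLspan f + hscale t w.
  by rewrite KLspan_lin KLspan_lin KLspan_delta hscaleN hscale1.
rewrite opprD addrA; set e := h - KLspan f.
have orth z : z \in s -> hdot (e - hscale t w) (C z) = 0.
  by move=> zs; rewrite hdotBl fo // hdotC hdotZ hdotC go // mulr0 subrr.
have orthw : hdot (e - hscale t w) w = 0.
  rewrite hdotBl [hdot (hscale _ _) _]hdotC hdotZ /t.
  (* Anisotropy settles the degenerate case: if [hdot w w = 0] then [w = 0], and orthogonality to it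
     is automatic. *)
  have [/hdot_self_eq0 w0|ww] := eqVneq (hdot w w) 0; last by rewrite mulfVK // subrr.
  have dw b : hdot b w = 0 by rewrite w0 /hdot big1 // => x _; rewrite ffunE mulr0.
  by rewrite !dw mulr0 subr0.
move=> z; rewrite inE => /predU1P[->|]; last exact: orth.
have -> : C z0 = w + KLspan g by rewrite subrK.
rewrite hdotDr orthw hdot_KLspan add0r big1 // => y _.
by have [/orth ->|/g0 ->] := boolP (y \in s); rewrite ?mulr0 ?mul0r.
Qed.
End Projection.

Section Existence.
Variables (r : nat) (I : finType) (v : I -> perm_r r).
Hypothesis v_inj : injective v.
Hypothesis v_Ptab : forall a b, Ptab (v a) = Ptab (v b).
Hypothesis v_onto : forall a x, Ptab x = Ptab (v a) -> exists b, x = v b.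
Implicit Types (a b c : I) (x y z : perm_r r) (i j k l : 'I_r).
Local Notation C := (@KLlow r).

Lemma rhoC_KLspan i j f : adj i j ->
  rhoC i j (KLspan f) = \sum_z hscale (f z) (\sum_x hscale (bcoef i j x z) (C x)).
Proof.
move=> ij; rewrite /KLspan (hlinear_sum _ _ (rhoC_linear i j)); apply: eq_bigr => z _.
by rewrite (proj2 (rhoC_linear i j)) KL_mul.
Qed.

(* The Gram matrix of the projections of [C (v a)] orthogonal to the [C z] with [z] strictly below the cell:
   multiplication by [C'_s] is self-adjoint for [hdot]. *)
Lemma intertwines_exists a0 : exists S : I -> I -> K, intertwines v S /\ S a0 a0 != 0.
Proof.
pose below z := (Ptab z != Ptab (v a0)) && connect (@redge r) (v a0) z.
pose s := enum below.
have ms z : (z \in s) = below z by rewrite mem_enum.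
have /fin_all_exists [f hf] := fun a => orthogonal_projection s (C (v a)).
pose c a := C (v a) - KLspan (f a).
have c_below a z : below z -> hdot (c a) (C z) = 0 by rewrite -ms; apply: (proj2 (hf a)).
have f_below a z : ~~ below z -> f a z = 0 by rewrite -ms; apply: (proj1 (hf a)).
have c_v a b : hdot (c b) (C (v a)) = hdot (c b) (c a).
  have -> : C (v a) = c a + KLspan (f a) by rewrite subrK.
  rewrite hdotDr hdot_KLspan big1 ?addr0 // => y _.
  by have [/c_below ->|/f_below ->] := boolP (below y); rewrite ?mulr0 ?mul0r.
have conn_v a : connect (@redge r) (v a0) (v a).
  by have /andP[] := Ptab_rcell (v_Ptab a0 a).
have edge_below i j z x : adj i j -> bcoef i j x z != 0 -> connect (@redge r) (v a0) z ->
    Ptab x != Ptab (v a0) -> below x.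
  move=> ij e cz px; rewrite /below px; apply: connect_trans cz (connect1 _).
  by apply/redgeP; exists i, j.
(* A step from [below] cannot return to the cell: that would put [z] in the right cell itself, and
   then [z] would have the same [P]. *)
have below_closed i j z x : adj i j -> bcoef i j x z != 0 -> below z -> below x.
  move=> ij e /andP[pz cz]; apply: (edge_below _ _ _ _ ij e cz).
  apply: contra pz => /eqP px; apply/eqP; rewrite -px; apply: rcell_Ptab.
  apply/andP; split; first by apply/connect1/redgeP; exists i, j.
  by have /andP[_ cx] := Ptab_rcell (esym px); apply: connect_trans cx cz.
(* Up to vectors orthogonal to [c b], the [c a] transform under [C'_s] like the cell module, as the
   correction terms stay in the span of [below]. *)
have act i j a b : adj i j ->
    hdot (c b) (rhoC i j (c a)) = \sum_d cell_coef v i j d a * hdot (c b) (c d).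
  move=> ij; rewrite -hdot_rhoC hdotC hdotBl -!hdot_rhoC ![hdot _ (c b)]hdotC.
  rewrite rhoC_KLspan // [X in _ - X]hdot_linear.
  rewrite [X in _ - X]big1 ?subr0 => [|z _]; last first.
    rewrite hdotZ; have [bz|/f_below ->] := boolP (below z); last by rewrite mul0r.
    rewrite hdot_linear big1 ?mulr0 // => x _; rewrite hdotZ.
    have [->|e] := eqVneq (bcoef i j x z) 0; first by rewrite mul0r.
    by rewrite c_below ?mulr0 //; apply: (below_closed _ _ _ _ ij e bz).
  rewrite (KL_mul _ ij) hdot_linear.
  rewrite (bigID (fun x => Ptab x == Ptab (v a0))) /= [X in _ + X]big1 ?addr0 => [|x px]; last first.
    rewrite hdotZ; have [->|e] := eqVneq (bcoef i j x (v a)) 0; first by rewrite mul0r.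
    by rewrite c_below ?mulr0 //; apply: (edge_below _ _ _ _ ij e (conn_v a) px).
  (* An inverse of [v] on the cell, with the dummy value [a0] elsewhere, used to reindex the sum. *)
  have /fin_all_exists [p hp] : forall x, exists b, Ptab x = Ptab (v a0) -> x = v b.
    move=> x; have [e|ne] := eqVneq (Ptab x) (Ptab (v a0)); last first.
      by exists a0 => e; rewrite e eqxx in ne.
    by have [d ->] := v_onto e; exists d.
  rewrite (reindex_onto v p) => [|x /eqP /hp //]; apply: eq_big => [d|d _].
    by rewrite (v_Ptab d a0) eqxx; apply/eqP/v_inj; rewrite -hp.
  by rewrite hdotZ c_v.
exists (fun a b => hdot (c a) (c b)); split.
  move=> i j ij a b.
  under eq_bigr do rewrite mulrC; rewrite -act // -hdot_rhoC hdotC.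
  by rewrite [RHS](eq_bigr (fun d => cell_coef v i j d a * hdot (c b) (c d))) -?act // => d _; rewrite hdotC.
(* By anisotropy [c a0] would be zero, but its coefficient on [C (v a0)] is 1 because [v a0] is not
   in [below]. *)
apply/eqP => /hdot_self_eq0 c0.
have : KLspan (fun x => (x == v a0)%:R + -1 * f a0 x) = 0.
  by rewrite KLspan_lin KLspan_delta hscaleN hscale1.
move/KL_indep => /(_ (v a0)) /eqP; rewrite eqxx f_below ?mulr0 ?addr0 ?oner_eq0 //.
by rewrite /below eqxx.
Qed.
End Existence.

(** * Both action matrices read off one right cell *)

Section Transition.
Variables (r : nat) (lam : seq nat).
Variable w : SYT r lam -> perm_r r.
Hypothesis w_Ptab : forall Q Q', Ptab (w Q) = Ptab (w Q').
Hypothesis w_tab : forall Q, tab_is (Qtab (w Q)) (val Q).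
Implicit Types (Q : SYT r lam) (S : SYT r lam -> SYT r lam -> K).

Lemma Blow_cell (i j : 'I_r) Q' Q : injective w -> adj i j -> Blow i j Q' Q = cell_coef (fun Q => wz (w Q)) i j Q' Q.
Proof.
move=> w_inj ij; rewrite /Blow /cell_coef /bcoef !(eastR_desc ij (w_tab _)) !desc_wz //.
have [d|d] := boolP (desc (w Q) i j) => /=; last first.
  by rewrite (inj_eq (can_inj (@wzK r))) (inj_eq w_inj).
by have [d'|d'] := boolP (desc (w Q') i j) => //=; rewrite (mu_lowE ij (w_Ptab Q' Q)).
Qed.

(** Adding [[2]] cancels the eigenvalue at descents and creates it at the others, which are the
    descents after [w0]. Off the diagonal, [mu_w0] moves [mu] to the cell [w0 w_Q] with its
    arguments exchanged, hence the transpose. *)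
Lemma Aup_cell (i j : 'I_r) Q' Q : injective w -> adj i j ->
  Aup i j Q' Q + (Q' == Q)%:R * two = cell_coef (fun Q => wz (w Q)) i j Q Q'.
Proof.
move=> w_inj ij; rewrite /Aup /cell_coef /bcoef !(southR_desc ij (w_tab _)) !desc_wz //.
rewrite (inj_eq (can_inj (@wzK r))) (inj_eq w_inj).
have [d|d] := boolP (desc (w Q) i j) => /=; have [d'|d'] := boolP (desc (w Q') i j) => //=.
- by have [e|_] := eqVneq Q' Q; rewrite ?mul0r ?addr0 // mulrN addNr.
- by rewrite mulrN addNr eq_sym; have [e|] := eqVneq Q Q'; [rewrite -e d in d'|rewrite mul0r].
- rewrite (mu_upE ij (w_Ptab Q' Q)) // (mu_w0 ij d' d) muC; case: eqP => [e|_]; last by rewrite mul0r addr0.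
  by rewrite e (negbTE d) in d'.
by rewrite add0r eq_sym.
Qed.
End Transition.

Lemma transition_intertwines (r : nat) (lam : seq nat) (w : SYT r lam -> perm_r r) S : injective w ->
  (forall Q Q', Ptab (w Q) = Ptab (w Q')) -> (forall Q, tab_is (Qtab (w Q)) (val Q)) ->
  intertwines (fun Q => wz (w Q)) S <->
  (forall i j : 'I_r, val j = (val i).+1 -> forall Q' Q : SYT r lam,
     \sum_(Q'' : SYT r lam) S Q' Q'' * Blow i j Q'' Q =
     \sum_(Q'' : SYT r lam) (Aup i j Q' Q'' + (Q' == Q'')%:R * two) * S Q'' Q).
Proof.
move=> w_inj wP wQ.
have eB i j Q' Q : adj i j -> \sum_Q'' S Q' Q'' * Blow i j Q'' Q =
    \sum_Q'' S Q' Q'' * cell_coef (fun Q => wz (w Q)) i j Q'' Q.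
  by move=> ij; apply: eq_bigr => Q'' _; rewrite (Blow_cell wP wQ).
have eA i j Q' Q : adj i j -> \sum_Q'' (Aup i j Q' Q'' + (Q' == Q'')%:R * two) * S Q'' Q =
    \sum_Q'' cell_coef (fun Q => wz (w Q)) i j Q'' Q' * S Q'' Q.
  by move=> ij; apply: eq_bigr => Q'' _; rewrite (Aup_cell wP wQ).
split=> h i j ij Q' Q; first by rewrite eB ?eA ?h //; apply/eqP.
by rewrite -eB // -eA // h //; apply/eqP.
Qed.

Theorem theorem7p12 (r : nat) (lam : seq nat) :
  (0 < r)%N -> is_partition_of r lam ->
  (exists S : SYT r lam -> SYT r lam -> K, transition_iso S) /\
  (forall S : SYT r lam -> SYT r lam -> K, transition_iso S ->
     exists c : K, c != 0 /\ good_matrix (fun Q' Q => c * S Q' Q)).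
Proof.
(* Over an empty index type all conditions are vacuous; otherwise a fixed tableau [Q0] serves as the
   base point of the normalization. *)
move=> _ lam_part; have [Q0 _|noQ] := pickP (@predT (SYT r lam)); last first.
  have void (Q : SYT r lam) : False by have := noQ Q.
  split=> [|S _].
    exists (fun _ _ => 0); split=> [i j _ Q|]; first by have := void Q.
    by exists (fun _ _ => 0) => Q; have := void Q.
  by exists 1; split=> [|Q]; [apply: oner_neq0|have := void Q].
have [P [w [w_inj wP w_onto wQ]]] := cell_param lam_part Q0.
have wP' Q Q' : Ptab (w Q) = Ptab (w Q') by rewrite !wP.
pose v Q := wz (w Q).
have v_inj : injective v by move=> Q Q' /(can_inj (@wzK r)) /w_inj.
have v_Ptab Q Q' : Ptab (v Q) = Ptab (v Q') by apply: Ptab_wz.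
have v_onto Q (x : perm_r r) : Ptab x = Ptab (v Q) -> exists Q', x = v Q'.
  move=> /Ptab_wz; rewrite wzK wP => /w_onto[Q' e]; exists Q'.
  by rewrite /v -e wzK.
split.
  have [S [hS S0]] := intertwines_exists v_inj v_Ptab v_onto Q0.
  exists S; split; first exact/(transition_intertwines _ w_inj wP' wQ).
  exact: (intertwines_inv v_inj v_Ptab v_onto hS S0).
move=> S [/(transition_intertwines _ w_inj wP' wQ) hS [T hT]].
have S0 : S Q0 Q0 != 0.
  (* A zero diagonal entry would make [S] vanish, against its invertibility. *)
  apply/eqP => z; have S0 := intertwines_diag_eq0 v_inj v_Ptab v_onto hS z.
  have [] := hT Q0 Q0; rewrite big1 => [/eqP|Q _]; last by rewrite S0 mul0r.
  by rewrite eqxx eq_sym oner_eq0.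
exists (S Q0 Q0)^-1; split; first by rewrite invr_eq0.
by move=> Q' Q; apply: (intertwines_good v_inj v_Ptab v_onto hS S0).
Qed.
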